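(* Let $a,b\in\mathbb C$. There is a harmonic mapping $u:\mathbb D\to\mathbb D$ with $u(0)=0$, $\partial u(0)=a$ and $\overline\partial u(0)=b$ if and only if $(|a|+|b|,\,|a|-|b|)\in\mathfrak K$.
   Context: $\mathbb D$ is the open unit disc in $\mathbb C\cong\mathbb R^2$; $\mathbb B_2$ is the open unit Euclidean disc in $\mathbb R^2$, and $T_{\mathbb B_2}:=\mathbb B_2+i\mathbb R^2\subset\mathbb C^2$ is the tube domain over it. A harmonic mapping $u=(u_1,u_2)=u_1+iu_2:\mathbb D\to\mathbb D$ is one with $u_1,u_2$ real harmonic functions. Convention of the paper for Wirtinger operators: $\partial:=\frac12\left(\frac{\partial}{\partial x}+i\frac{\partial}{\partial y}\right)$, $\overline\partial:=\frac12\left(\frac{\partial}{\partial x}-i\frac{\partial}{\partial y}\right)$, so that $$\overline\partial u=\tfrac12\left(u_{1x}+u_{2y}+i(u_{2x}-u_{1y})\right),\qquad \partial u=\tfrac12\left(u_{1x}-u_{2y}+i(u_{2x}+u_{1y})\right).$$ For a domain $G\subset\mathbb C^n$, $z\in G$, $X\in\mathbb C^n$, the Kobayashi-Royden pseudometric is $$\kappa_G(z;X):=\inf\{t>0:\ \exists f:\mathbb D\to G \text{ holomorphic},\ f(0)=z,\ tf'(0)=X\},$$ and the closed indicatrix of $G$ at $p\in G$ is $I_G(p):=\{X\in\mathbb C^n:\kappa_G(p;X)\le1\}$. The set $\mathfrak K$ is $$\mathfrak K:=\{(x,y)\in\mathbb R^2:\ (x,iy)\in I_{T_{\mathbb B_2}}(0)\}.$$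 *)

(* Defs.v *)
(* Stdlib reals with Coquelicot.  C is Coquelicot's R * R, so C also serves as R^2. *)
From Stdlib Require Import Reals.
From Coquelicot Require Import Coquelicot.

Open Scope R_scope.

(* Functions on the disc are total functions on C of which only the values on
   the disc matter; the disc is open, so derivatives at its points do not depend
   on the values outside. *)
Definition unit_disc (z : C) : Prop := Cmod z < 1.

(* ex_diff_n h 2 at every point of the open disc says that h is C^2 there. *)
Definition harmonic_on_disc (h : C -> R) : Prop :=
  forall x y : R, unit_disc (x, y) ->
    ex_diff_n (fun s t => h (s, t)) 2 x y /\
    partial_derive 2 0 (fun s t => h (s, t)) x y
    + partial_derive 0 2 (fun s t => h (s, t)) x y = 0.

Definition harmonic_self_map (u : C -> C) : Prop :=
  (forall z : C, unit_disc z -> unit_disc (u z)) /\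
  harmonic_on_disc (fun z => Re (u z)) /\
  harmonic_on_disc (fun z => Im (u z)).

Definition partial_x (u : C -> C) (z : C) : C :=
  (Derive (fun s => Re (u (s, Im z))) (Re z),
   Derive (fun s => Im (u (s, Im z))) (Re z)).

Definition partial_y (u : C -> C) (z : C) : C :=
  (Derive (fun t => Re (u (Re z, t))) (Im z),
   Derive (fun t => Im (u (Re z, t))) (Im z)).

(* These names are interchanged with respect to the usual convention: here the
   operator d is (d/dx + i d/dy)/2, and it kills the holomorphic functions. *)
Definition wirtinger_d (u : C -> C) (z : C) : C :=
  (RtoC (/ 2) * (partial_x u z + Ci * partial_y u z))%C.

Definition wirtinger_dbar (u : C -> C) (z : C) : C :=
  (RtoC (/ 2) * (partial_x u z - Ci * partial_y u z))%C.

(* V plays the role of C^n. *)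
Definition holomorphic_disc {V : NormedModule C_AbsRing}
    (G : V -> Prop) (f : C -> V) : Prop :=
  forall z : C, unit_disc z -> G (f z) /\ ex_derive (K := C_AbsRing) f z.

Definition kobayashi {V : NormedModule C_AbsRing}
    (G : V -> Prop) (z X : V) : Rbar :=
  Glb_Rbar (fun t : R => 0 < t /\
    exists (f : C -> V) (l : V),
      holomorphic_disc G f /\ f (RtoC 0) = z /\
      is_derive (K := C_AbsRing) f (RtoC 0) l /\
      scal (RtoC t) l = X).

Definition indicatrix {V : NormedModule C_AbsRing}
    (G : V -> Prop) (p : V) (X : V) : Prop :=
  Rbar_le (kobayashi G p X) 1.

Definition C2 : NormedModule C_AbsRing :=
  prod_NormedModule C_AbsRing C_NormedModule C_NormedModule.

Definition ball2 (p : R * R) : Prop := fst p ^ 2 + snd p ^ 2 < 1.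

Definition tube (B : R * R -> Prop) (w : C2) : Prop :=
  B (Re (fst w), Re (snd w)).

Definition frakK (p : R * R) : Prop :=
  indicatrix (tube ball2) (RtoC 0, RtoC 0)
    (RtoC (fst p), (Ci * RtoC (snd p))%C).

(* Main.v *)
Require Import Defs.
From Stdlib Require Import Reals.
From Coquelicot Require Import Coquelicot.
From Stdlib Require Import Lra Lia ClassicalEpsilon Classical Rtopology.
From Stdlib Require Import FunctionalExtensionality.

(* The components of u are real parts of holomorphic functions f1, f2 vanishing
   at 0, and u maps into the disc exactly when (f1, f2) maps into the tube.  The
   derivative of (f1, f2) at 0 is (b + conj a, i (conj a - b)), which becomes
   (|a| + |b|, i (|a| - |b|)) after a rotation of the source and a real rotation
   of the target.  A harmonic u thus gives a competitor with t = 1 for kappa.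
   Conversely kappa <= 1 only gives discs with derivative s X for every s < 1; a
   subsequential limit of their Taylor coefficients, which are bounded since the
   real parts are, gives a disc with derivative X.  The maximum principle puts
   its real part back in the open ball, and power series are smooth.
   As competitors are only assumed pointwise complex differentiable, Cauchy's
   formula is derived from Goursat's lemma. *)

Open Scope R_scope.

(** * Goursat's lemma for a pointwise closed form *)

(** The tube is unbounded in the imaginary directions, so the coefficient estimate may use only an
    upper bound of the real part. It reads |c_n| <= 4 (1 - Re F(0)) when Re F <= 1, and serves
    twice. With F(0) = 0 it is the uniform bound behind the compactness argument. With Re F(0) = 1
    it makes all higher coefficients vanish, which is the maximum principle once a disc automorphism
    has moved the extremal point to 0. The sharp constant is 2; the loss comes from bounding complex
    integrals through their real and imaginary parts. The dilation by s < 1 has two effects: it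
    copes with an infimum in [kobayashi] that may not be attained, and it makes a competitor
    holomorphic beyond the closed unit disc, so that all integrals run over the unit circle itself.
    Pointwise closedness has two clients: the conjugate differential of a harmonic function on the
    disc, and Cauchy's integrand on a rectangle in the coordinates (t, theta) of [cone]. *)

Lemma dependent_choice (A : Type) (Inv : nat -> A -> Prop)
    (Rel : nat -> A -> A -> Prop) (a0 : A) :
  Inv 0%nat a0 ->
  (forall n a, Inv n a -> exists a', Inv (S n) a' /\ Rel n a a') ->
  exists s : nat -> A,
    s 0%nat = a0 /\ forall n, Inv n (s n) /\ Rel n (s n) (s (S n)).
Proof.
  intros H0 Hstep.
  (* Each state carries a proof of its invariant, because a successor is only provided for states
     that satisfy it. *)
  pose (next := fun (n : nat) (p : {a | Inv n a}) =>
    let (a', Ha') := constructive_indefinite_description _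
                       (Hstep n (proj1_sig p) (proj2_sig p)) in
    exist (Inv (S n)) a' (proj1 Ha')).
  pose (s := nat_rect (fun n => {a | Inv n a}) (exist _ a0 H0) next).
  exists (fun n => proj1_sig (s n)).
  split; [reflexivity|].
  intros n; split; [exact (proj2_sig (s n))|].
  change (s (S n)) with (next n (s n)); unfold next.
  destruct (constructive_indefinite_description _ _) as [a' Ha']; simpl.
  exact (proj2 Ha').
Qed.

(* The equality of dP/dy and dQ/dx at a point, asking for no regularity of P in x
   and of Q in y: the Cauchy kernel below is then only needed to be continuous. *)
Definition closed_form_at (P Q : R -> R -> R) (x0 y0 : R) : Prop :=
  exists m : R, forall eps : posreal, exists delta : posreal,
    forall d x x' y y' : R, d < delta ->
      Rabs (x - x0) <= d -> Rabs (x' - x0) <= d ->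
      Rabs (y - y0) <= d -> Rabs (y' - y0) <= d ->
      Rabs (P x y - P x y' - m * (y - y')) <= eps * d /\
      Rabs (Q x y - Q x' y - m * (x - x')) <= eps * d.

(** The integral of P dx + Q dy along the boundary of [a,b] x [c,d], counterclockwise when a <= b
    and c <= d. *)
Definition loop_integral (P Q : R -> R -> R) (a b c d : R) : R :=
  RInt (fun x => P x c) a b - RInt (fun x => P x d) a b +
  RInt (fun y => Q b y) c d - RInt (fun y => Q a y) c d.

Definition continuous_on_rect (P : R -> R -> R) (a b c d : R) : Prop :=
  forall x y, a <= x <= b -> c <= y <= d -> continuity_2d_pt P x y.

Lemma continuity_2d_pt_continuous_1 (P : R -> R -> R) (x y : R) :
  continuity_2d_pt P x y -> continuous (fun s => P s y) x.
Proof.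
  intros H.
  apply continuity_pt_filterlim. intros eps Heps.
  destruct (H (mkposreal eps Heps)) as [d Hd].
  exists d; split; [apply cond_pos|].
  intros s [_ Hs]. apply Hd; [exact Hs|].
  rewrite Rminus_eq_0, Rabs_R0; apply cond_pos.
Qed.

Lemma continuity_2d_pt_continuous_2 (P : R -> R -> R) (x y : R) :
  continuity_2d_pt P x y -> continuous (fun t => P x t) y.
Proof.
  intros H.
  apply continuity_pt_filterlim. intros eps Heps.
  destruct (H (mkposreal eps Heps)) as [d Hd].
  exists d; split; [apply cond_pos|].
  intros s [_ Hs]. apply Hd; [|exact Hs].
  rewrite Rminus_eq_0, Rabs_R0; apply cond_pos.
Qed.

Lemma ex_RInt_rect_1 (P : R -> R -> R) (a b c d x x' y : R) :
  continuous_on_rect P a b c d -> a <= x -> x <= x' -> x' <= b ->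
  c <= y <= d -> ex_RInt (fun s => P s y) x x'.
Proof.
  intros H H1 H2 H3 Hy. apply (ex_RInt_continuous (V := R_CompleteNormedModule)).
  rewrite Rmin_left, Rmax_right by lra.
  intros s Hs. apply (continuity_2d_pt_continuous_1 P). apply H; lra.
Qed.

Lemma ex_RInt_rect_2 (P : R -> R -> R) (a b c d x y y' : R) :
  continuous_on_rect P a b c d -> c <= y -> y <= y' -> y' <= d ->
  a <= x <= b -> ex_RInt (fun t => P x t) y y'.
Proof.
  intros H H1 H2 H3 Hy. apply (ex_RInt_continuous (V := R_CompleteNormedModule)).
  rewrite Rmin_left, Rmax_right by lra.
  intros s Hs. apply (continuity_2d_pt_continuous_2 P). apply H; lra.
Qed.

Lemma RInt_split (f : R -> R) (a m b : R) :
  ex_RInt f a m -> ex_RInt f m b -> RInt f a b = RInt f a m + RInt f m b.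
Proof.
  intros H1 H2. symmetry. exact (RInt_Chasles f a m b H1 H2).
Qed.

(** Every inner edge is traversed twice, in opposite directions, and cancels. *)
Lemma loop_integral_quarter (P Q : R -> R -> R) (a b c d : R) :
  a <= b -> c <= d ->
  continuous_on_rect P a b c d -> continuous_on_rect Q a b c d ->
  let m := (a + b) / 2 in let n := (c + d) / 2 in
  loop_integral P Q a b c d =
    loop_integral P Q a m c n + loop_integral P Q m b c n +
    loop_integral P Q a m n d + loop_integral P Q m b n d.
Proof.
  intros Hab Hcd HP HQ m n.
  assert (Hm : a <= m <= b) by (unfold m; lra).
  assert (Hn : c <= n <= d) by (unfold n; lra).
  clearbody m n. unfold loop_integral.
  assert (HP' : forall y, c <= y <= d ->
    RInt (fun x => P x y) a b = RInt (fun x => P x y) a m + RInt (fun x => P x y) m b).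
  { intros y Hy. apply RInt_split.
    - apply (ex_RInt_rect_1 P a b c d); try assumption; lra.
    - apply (ex_RInt_rect_1 P a b c d); try assumption; lra. }
  assert (HQ' : forall x, a <= x <= b ->
    RInt (fun y => Q x y) c d = RInt (fun y => Q x y) c n + RInt (fun y => Q x y) n d).
  { intros x Hx. apply RInt_split.
    - apply (ex_RInt_rect_2 Q a b c d); try assumption; lra.
    - apply (ex_RInt_rect_2 Q a b c d); try assumption; lra. }
  rewrite (HP' c), (HP' d), (HQ' a), (HQ' b) by lra.
  ring.
Qed.

(** The subtracted constants integrate to (b - a) m (c - d) and (d - c) m (b - a), which are
    opposite, so the common slope [m] drops out and only the errors remain. *)
Lemma loop_integral_small (P Q : R -> R -> R) (a b c d m e : R) :
  a <= b -> c <= d ->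
  continuous_on_rect P a b c d -> continuous_on_rect Q a b c d ->
  (forall x, a <= x <= b -> Rabs (P x c - P x d - m * (c - d)) <= e) ->
  (forall y, c <= y <= d -> Rabs (Q b y - Q a y - m * (b - a)) <= e) ->
  Rabs (loop_integral P Q a b c d) <= (b - a) * e + (d - c) * e.
Proof.
  intros Hab Hcd HP HQ H1 H2.
  assert (E1 : is_RInt (fun x => P x c - P x d - m * (c - d)) a b
    (RInt (fun x => P x c) a b - RInt (fun x => P x d) a b - (b - a) * (m * (c - d)))).
  { apply (is_RInt_minus (V := R_NormedModule) (fun x => P x c - P x d) (fun _ => m * (c - d))).
    - apply (is_RInt_minus (V := R_NormedModule) (fun x => P x c) (fun x => P x d));
      apply (RInt_correct (V := R_CompleteNormedModule));
      apply (ex_RInt_rect_1 P a b c d); solve [assumption | lra].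
    - apply (is_RInt_const (V := R_NormedModule)). }
  assert (E2 : is_RInt (fun y => Q b y - Q a y - m * (b - a)) c d
    (RInt (fun y => Q b y) c d - RInt (fun y => Q a y) c d - (d - c) * (m * (b - a)))).
  { apply (is_RInt_minus (V := R_NormedModule) (fun y => Q b y - Q a y) (fun _ => m * (b - a))).
    - apply (is_RInt_minus (V := R_NormedModule) (fun y => Q b y) (fun y => Q a y));
      apply (RInt_correct (V := R_CompleteNormedModule));
      apply (ex_RInt_rect_2 Q a b c d); solve [assumption | lra].
    - apply (is_RInt_const (V := R_NormedModule)). }
  assert (B1 := abs_RInt_le_const _ a b e Hab (ex_intro _ _ E1) H1).
  assert (B2 := abs_RInt_le_const _ c d e Hcd (ex_intro _ _ E2) H2).
  apply (is_RInt_unique (V := R_CompleteNormedModule)) in E1, E2.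
  rewrite E1 in B1; rewrite E2 in B2.
  unfold loop_integral.
  replace (_ + _ - _) with
    ((RInt (fun x => P x c) a b - RInt (fun x => P x d) a b - (b - a) * (m * (c - d)))
    + (RInt (fun y => Q b y) c d - RInt (fun y => Q a y) c d - (d - c) * (m * (b - a)))) by ring.
  eapply Rle_trans; [apply Rabs_triang|]. lra.
Qed.

(** The supremum of the left ends works, since each right end bounds all left ends. *)
Lemma nested_intervals_point (x : nat -> R) (h : R) :
  (forall n, x n <= x (S n) /\ x (S n) + h / 2 ^ S n <= x n + h / 2 ^ n) ->
  0 <= h ->
  exists l, forall n, x n <= l <= x n + h / 2 ^ n.
Proof.
  intros Hx Hh.
  assert (Hpow : forall n, 0 < 2 ^ n) by (intros n; apply pow_lt; lra).
  assert (Hinc : forall n k, x n <= x (n + k)%nat).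
  { intros n; induction k as [|k IH].
    - rewrite Nat.add_0_r; lra.
    - rewrite Nat.add_succ_r. pose proof (proj1 (Hx (n + k)%nat)); lra. }
  assert (Hdec : forall n k, x (n + k)%nat + h / 2 ^ (n + k) <= x n + h / 2 ^ n).
  { intros n; induction k as [|k IH].
    - rewrite Nat.add_0_r; lra.
    - rewrite Nat.add_succ_r. pose proof (proj2 (Hx (n + k)%nat)); lra. }
  assert (Hpos : forall n, 0 <= h / 2 ^ n).
  { intros n. apply Rmult_le_pos; [lra|]. left; apply Rinv_0_lt_compat, Hpow. }
  assert (Hub : forall n k, x k <= x n + h / 2 ^ n).
  { intros n k. destruct (Nat.le_ge_cases n k) as [Hle|Hle].
    - replace k with (n + (k - n))%nat by lia.
      pose proof (Hdec n (k - n)%nat); pose proof (Hpos (n + (k - n))%nat); lra.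
    - replace n with (k + (n - k))%nat by lia.
      pose proof (Hinc k (n - k)%nat); pose proof (Hpos (k + (n - k))%nat); lra. }
  destruct (completeness (fun r => exists n, r = x n)) as [l [Hl1 Hl2]].
  - exists (x 0%nat + h / 2 ^ 0). intros r [n ->]. apply Hub.
  - exists (x 0%nat); exists 0%nat; reflexivity.
  - exists l. intros n; split.
    + apply Hl1; exists n; reflexivity.
    + apply Hl2. intros r [k ->]. apply Hub.
Qed.

(* Quadrisection: a loop integral of size e leaves one of size at least e / 4^n
   around some rectangle of side 2^-n, against closedness at the common point. *)
Lemma goursat_rect (P Q : R -> R -> R) (a b c d : R) :
  a <= b -> c <= d ->
  continuous_on_rect P a b c d -> continuous_on_rect Q a b c d ->
  (forall x y, a <= x <= b -> c <= y <= d -> closed_form_at P Q x y) ->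
  loop_integral P Q a b c d = 0.
Proof.
  intros Hab Hcd HP HQ Hcl.
  destruct (Req_dec (loop_integral P Q a b c d) 0) as [H0|H0]; [exact H0|exfalso].
  set (e := Rabs (loop_integral P Q a b c d)).
  assert (He : 0 < e) by (apply Rabs_pos_lt; exact H0).
  set (h := b - a). set (k := d - c).
  assert (Hpow : forall n, 0 < 2 ^ n) by (intros n; apply pow_lt; lra).
  assert (Hpow4 : forall n, 0 < 4 ^ n) by (intros n; apply pow_lt; lra).
  pose (Inv := fun (n : nat) (p : R * R) =>
    (a <= fst p /\ fst p + h / 2 ^ n <= b) /\
    (c <= snd p /\ snd p + k / 2 ^ n <= d) /\
    e / 4 ^ n <= Rabs (loop_integral P Q (fst p) (fst p + h / 2 ^ n)
                                       (snd p) (snd p + k / 2 ^ n))).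
  pose (Rel := fun (n : nat) (p q : R * R) =>
    (fst p <= fst q /\ fst q + h / 2 ^ S n <= fst p + h / 2 ^ n) /\
    (snd p <= snd q /\ snd q + k / 2 ^ S n <= snd p + k / 2 ^ n)).
  assert (Hh : 0 <= h) by (unfold h; lra).
  assert (Hk : 0 <= k) by (unfold k; lra).
  destruct (dependent_choice (R * R) Inv Rel (a, c)) as [s [_ Hs]].
  - unfold Inv; simpl.
    replace (a + h / 1) with b by (unfold h; field).
    replace (c + k / 1) with d by (unfold k; field).
    repeat split; try lra. fold e. lra.
  - intros n [x y] [[Hx1 Hx2] [[Hy1 Hy2] Hl]]; simpl in *.
    set (hn := h / 2 ^ n) in *. set (kn := k / 2 ^ n) in *.
    assert (Ehn : h / (2 * 2 ^ n) = hn / 2).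
    { unfold hn; field. apply Rgt_not_eq, Hpow. }
    assert (Ekn : k / (2 * 2 ^ n) = kn / 2).
    { unfold kn; field. apply Rgt_not_eq, Hpow. }
    assert (E4 : e / (4 * 4 ^ n) = e / 4 ^ n / 4).
    { field. apply Rgt_not_eq, Hpow4. }
    assert (Phn : 0 <= hn).
    { apply Rmult_le_pos; [lra|]. left; apply Rinv_0_lt_compat, Hpow. }
    assert (Pkn : 0 <= kn).
    { apply Rmult_le_pos; [lra|]. left; apply Rinv_0_lt_compat, Hpow. }
    rewrite (loop_integral_quarter P Q) in Hl;
      [|lra|lra|intros u v Hu Hv; apply HP; lra|intros u v Hu Hv; apply HQ; lra].
    replace ((x + (x + hn)) / 2) with (x + hn / 2) in Hl by field.
    replace ((y + (y + kn)) / 2) with (y + kn / 2) in Hl by field.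
    assert (Hbig : forall r1 r2 r3 r4 E, E <= Rabs (r1 + r2 + r3 + r4) ->
       E / 4 <= Rabs r1 \/ E / 4 <= Rabs r2 \/ E / 4 <= Rabs r3 \/ E / 4 <= Rabs r4).
    { intros r1 r2 r3 r4 E HE.
      destruct (Rle_dec (E / 4) (Rabs r1)); [tauto|].
      destruct (Rle_dec (E / 4) (Rabs r2)); [tauto|].
      destruct (Rle_dec (E / 4) (Rabs r3)); [tauto|].
      destruct (Rle_dec (E / 4) (Rabs r4)); [tauto|]. exfalso.
      pose proof (Rabs_triang (r1 + r2 + r3) r4).
      pose proof (Rabs_triang (r1 + r2) r3).
      pose proof (Rabs_triang r1 r2). lra. }
    assert (Hfin : forall x' y', (x' = x \/ x' = x + hn / 2) ->
       (y' = y \/ y' = y + kn / 2) ->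
       e / 4 ^ n / 4 <= Rabs (loop_integral P Q x' (x' + hn / 2) y' (y' + kn / 2)) ->
       exists p, Inv (S n) p /\ Rel n (x, y) p).
    { intros x' y' Hx' Hy' HL. exists (x', y'). unfold Inv, Rel; simpl.
      rewrite Ehn, Ekn, E4. fold hn kn.
      destruct Hx' as [->| ->]; destruct Hy' as [->| ->]; repeat split; try lra. }
    apply Hbig in Hl.
    replace (x + hn) with (x + hn / 2 + hn / 2) in Hl by field.
    replace (y + kn) with (y + kn / 2 + kn / 2) in Hl by field.
    destruct Hl as [Hl|[Hl|[Hl|Hl]]].
    + apply (Hfin x y); auto.
    + apply (Hfin (x + hn / 2) y); auto.
    + apply (Hfin x (y + kn / 2)); auto.
    + apply (Hfin (x + hn / 2) (y + kn / 2)); auto.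
  - destruct (nested_intervals_point (fun n => fst (s n)) h) as [xs Hxs];
      [intros n; apply (Hs n)|exact Hh|].
    destruct (nested_intervals_point (fun n => snd (s n)) k) as [ys Hys];
      [intros n; apply (Hs n)|exact Hk|].
    assert (Hin : a <= xs <= b /\ c <= ys <= d).
    { destruct (Hs 0%nat) as [[[I1 I2] [[I3 I4] _]] _].
      pose proof (Hxs 0%nat); pose proof (Hys 0%nat); simpl in *; lra. }
    destruct (Hcl xs ys (proj1 Hin) (proj2 Hin)) as [m Hm].
    set (D := h + k).
    assert (HD : 0 <= D) by (unfold D; lra).
    (* With this tolerance the small-loop bound at stage n is e D^2 / (2 D^2 + 1) / 4^n, strictly
       below e / 4^n. The + 1 covers D = 0. *)
    assert (Heps : 0 < e / (2 * D * D + 1)).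
    { apply Rdiv_lt_0_compat; nra. }
    destruct (Hm (mkposreal _ Heps)) as [delta Hdelta]; simpl in Hdelta.
    assert (Hn : exists n, D / 2 ^ n < delta).
    { destruct (pow_lt_1_zero (/ 2)) with (y := delta / (D + 1)) as [N HN].
      - rewrite Rabs_pos_eq; lra.
      - apply Rdiv_lt_0_compat; [apply cond_pos|lra].
      - exists N. specialize (HN N (Nat.le_refl N)).
        rewrite Rabs_pos_eq in HN by (apply pow_le; lra).
        rewrite pow_inv in HN.
        apply (Rmult_lt_compat_r (D + 1)) in HN; [|lra].
        replace (delta / (D + 1) * (D + 1)) with (pos delta) in HN by (field; lra).
        assert (0 < / 2 ^ N) by apply Rinv_0_lt_compat, Hpow.
        unfold Rdiv. nra. }
    destruct Hn as [n Hn].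
    destruct (Hs n) as [[[I1 I2] [[I3 I4] I5]] _].
    specialize (Hxs n); specialize (Hys n); cbv beta in Hxs, Hys.
    set (x := fst (s n)) in *. set (y := snd (s n)) in *.
    assert (EhD : h / 2 ^ n <= D / 2 ^ n).
    { apply Rmult_le_compat_r; [left; apply Rinv_0_lt_compat, Hpow|unfold D; lra]. }
    assert (EkD : k / 2 ^ n <= D / 2 ^ n).
    { apply Rmult_le_compat_r; [left; apply Rinv_0_lt_compat, Hpow|unfold D; lra]. }
    assert (Hsm := loop_integral_small P Q x (x + h / 2 ^ n) y (y + k / 2 ^ n) m
       (e / (2 * D * D + 1) * (D / 2 ^ n))).
    assert (Hle : e / 4 ^ n <= e / (2 * D * D + 1) * (D / 2 ^ n) * (D / 2 ^ n)).
    { eapply Rle_trans; [exact I5|]. eapply Rle_trans; [apply Hsm|].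
      - lra.
      - lra.
      - intros u v Hu Hv; apply HP; lra.
      - intros u v Hu Hv; apply HQ; lra.
      - intros u Hu. apply (Hdelta _ u u); try exact Hn; apply Rabs_le; lra.
      - intros v Hv. apply (Hdelta _ (x + h / 2 ^ n) x v v); try exact Hn; apply Rabs_le; lra.
      - right. unfold D. field. split; [apply Rgt_not_eq, Hpow|apply Rgt_not_eq; unfold D in HD; nra]. }
    replace (4 ^ n) with (2 ^ n * 2 ^ n) in Hle
      by (rewrite <- Rpow_mult_distr; f_equal; lra).
    assert (Hp := Hpow n).
    apply (Rmult_le_compat_r (2 ^ n * 2 ^ n)) in Hle; [|nra].
    replace (e / (2 ^ n * 2 ^ n) * (2 ^ n * 2 ^ n)) with e in Hle by (field; lra).
    replace (e / (2 * D * D + 1) * (D / 2 ^ n) * (D / 2 ^ n) * (2 ^ n * 2 ^ n))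
      with (e * ((D * D) / (2 * D * D + 1))) in Hle by (field; split; [lra|nra]).
    assert (D * D / (2 * D * D + 1) < 1).
    { apply Rlt_div_l; nra. }
    nra.
Qed.

(** * Primitives on the disc and harmonic conjugates *)

(** Two first-order expansions at the same point are subtracted; one variable is frozen in each
    difference, so only the shared slope [m] survives, and each expansion contributes half of the
    error. *)
Lemma differentiable_closed_form_at (P Q : R -> R -> R) (x y p m q : R) :
  differentiable_pt_lim P x y p m -> differentiable_pt_lim Q x y m q ->
  closed_form_at P Q x y.
Proof.
  intros HP HQ. exists m. intros eps.
  assert (He : 0 < eps / 2) by (pose proof (cond_pos eps); lra).
  destruct (HP (mkposreal _ He)) as [d1 H1]; simpl in H1.
  destruct (HQ (mkposreal _ He)) as [d2 H2]; simpl in H2.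
  exists (mkposreal _ (Rmin_stable_in_posreal d1 d2)); simpl.
  intros d u u' v v' Hd Hu Hu' Hv Hv'.
  assert (Hd1 : d < d1) by (eapply Rlt_le_trans; [exact Hd|apply Rmin_l]).
  assert (Hd2 : d < d2) by (eapply Rlt_le_trans; [exact Hd|apply Rmin_r]).
  assert (Hb : forall F r s, (forall u v, Rabs (u - x) <= d -> Rabs (v - y) <= d ->
     Rabs (F u v - F x y - (r * (u - x) + s * (v - y)))
       <= eps / 2 * Rmax (Rabs (u - x)) (Rabs (v - y))) ->
     forall u1 u2 v1 v2, Rabs (u1 - x) <= d -> Rabs (v1 - y) <= d ->
       Rabs (u2 - x) <= d -> Rabs (v2 - y) <= d ->
       Rabs (F u1 v1 - F u2 v2 - (r * (u1 - u2) + s * (v1 - v2))) <= eps * d).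
  { intros F r s HF u1 u2 v1 v2 Hu1 Hv1 Hu2 Hv2.
    assert (B1 := HF u1 v1 Hu1 Hv1). assert (B2 := HF u2 v2 Hu2 Hv2).
    assert (M1 := Rmax_lub _ _ _ Hu1 Hv1). assert (M2 := Rmax_lub _ _ _ Hu2 Hv2).
    apply (Rmult_le_compat_l (eps / 2)) in M1; [|lra].
    apply (Rmult_le_compat_l (eps / 2)) in M2; [|lra].
    replace (_ - _ - _) with
      ((F u1 v1 - F x y - (r * (u1 - x) + s * (v1 - y)))
       - (F u2 v2 - F x y - (r * (u2 - x) + s * (v2 - y)))) by ring.
    eapply Rle_trans; [apply Rabs_triang|]. rewrite Rabs_Ropp. lra. }
  split.
  - replace (_ - _) with (P u v - P u v' - (p * (u - u) + m * (v - v'))) by ring.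
    apply Hb; try assumption.
    intros; apply H1; lra.
  - replace (_ - _) with (Q u v - Q u' v - (m * (u - u') + q * (v - v))) by ring.
    apply Hb; try assumption.
    intros; apply H2; lra.
Qed.

(** The square-root-free form of [unit_disc], within reach of [nra]. *)
Definition in_disc (x y : R) : Prop := x ^ 2 + y ^ 2 < 1.

Lemma unit_disc_in_disc (z : C) : unit_disc z <-> in_disc (Re z) (Im z).
Proof.
  unfold unit_disc, in_disc.
  rewrite <- Cmod2_alt. pose proof (Cmod_ge_0 z). split; nra.
Qed.

Lemma in_disc_segment_1 (a b s y : R) :
  in_disc a y -> in_disc b y -> Rmin a b <= s <= Rmax a b -> in_disc s y.
Proof.
  unfold in_disc, Rmin, Rmax. intros Ha Hb Hs.
  (* The sign of s tells which end of the segment has the larger absolute value. *)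
  destruct (Rle_dec a b); destruct (Rle_dec 0 s); nra.
Qed.

Lemma in_disc_segment_2 (x c d t : R) :
  in_disc x c -> in_disc x d -> Rmin c d <= t <= Rmax c d -> in_disc x t.
Proof.
  unfold in_disc, Rmin, Rmax. intros Ha Hb Hs.
  destruct (Rle_dec c d); destruct (Rle_dec 0 t); nra.
Qed.

Lemma in_disc_open (x y : R) :
  in_disc x y -> exists delta : posreal, forall u v,
    Rabs (u - x) < delta -> Rabs (v - y) < delta -> in_disc u v.
Proof.
  unfold in_disc. intros H.
  (* With e this radius, a coordinate of size at most 1 moved by less than e raises its square by at
     most 2e + e^2. Twice that is less than the available 8e, as e <= 1/8. *)
  assert (Hd : 0 < (1 - x ^ 2 - y ^ 2) / 8) by lra.
  exists (mkposreal _ Hd); simpl. intros u v Hu Hv.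
  apply Rabs_def2 in Hu; apply Rabs_def2 in Hv.
  set (e := (1 - x * (x * 1) - y * (y * 1)) / 8) in *.
  assert (Hx : -1 <= x <= 1) by (split; nra).
  assert (Hy : -1 <= y <= 1) by (split; nra).
  assert (e <= 1 / 8) by (unfold e; nra).
  assert (x ^ 2 + y ^ 2 = 1 - 8 * e) by (unfold e; field).
  assert (u ^ 2 <= x ^ 2 + 2 * e + e ^ 2).
  { replace u with (x + (u - x)) by ring. set (k := u - x) in *. nra. }
  assert (v ^ 2 <= y ^ 2 + 2 * e + e ^ 2).
  { replace v with (y + (v - y)) by ring. set (k := v - y) in *. nra. }
  nra.
Qed.

Definition continuous_on_disc (P : R -> R -> R) : Prop :=
  forall x y, in_disc x y -> continuity_2d_pt P x y.

Lemma ex_RInt_disc_1 (P : R -> R -> R) (a b y : R) :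
  continuous_on_disc P -> in_disc a y -> in_disc b y ->
  ex_RInt (fun s => P s y) a b.
Proof.
  intros HP Ha Hb. apply (ex_RInt_continuous (V := R_CompleteNormedModule)).
  intros s Hs. apply (continuity_2d_pt_continuous_1 P), HP.
  exact (in_disc_segment_1 a b s y Ha Hb Hs).
Qed.

Lemma ex_RInt_disc_2 (P : R -> R -> R) (x c d : R) :
  continuous_on_disc P -> in_disc x c -> in_disc x d ->
  ex_RInt (fun t => P x t) c d.
Proof.
  intros HP Ha Hb. apply (ex_RInt_continuous (V := R_CompleteNormedModule)).
  intros s Hs. apply (continuity_2d_pt_continuous_2 P), HP.
  exact (in_disc_segment_2 x c d s Ha Hb Hs).
Qed.

Lemma RInt_swap_R (f : R -> R) (a b : R) :
  ex_RInt f a b -> RInt f b a = - RInt f a b.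
Proof. intros H. symmetry. exact (opp_RInt_swap f a b H). Qed.

(** By convexity the rectangle lies in the disc as soon as its corners do. Exchanging a with b, or c
    with d, only changes the sign of the loop integral, so the corners need no order. *)
Lemma goursat_disc (P Q : R -> R -> R) (a b c d : R) :
  continuous_on_disc P -> continuous_on_disc Q ->
  (forall x y, in_disc x y -> closed_form_at P Q x y) ->
  in_disc a c -> in_disc a d -> in_disc b c -> in_disc b d ->
  loop_integral P Q a b c d = 0.
Proof.
  intros HP HQ Hcl.
  assert (Hle : forall a b c d, in_disc a c -> in_disc a d -> in_disc b c ->
    in_disc b d -> a <= b -> c <= d -> loop_integral P Q a b c d = 0).
  { clear a b c d. intros a b c d H1 H2 H3 H4 Hab Hcd.
    assert (Hin : forall x y, a <= x <= b -> c <= y <= d -> in_disc x y).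
    { intros x y Hx Hy. apply (in_disc_segment_1 a b).
      - apply (in_disc_segment_2 a c d); try assumption.
        rewrite Rmin_left, Rmax_right; lra.
      - apply (in_disc_segment_2 b c d); try assumption.
        rewrite Rmin_left, Rmax_right; lra.
      - rewrite Rmin_left, Rmax_right; lra. }
    apply goursat_rect; try assumption.
    - intros x y Hx Hy; apply HP, Hin; assumption.
    - intros x y Hx Hy; apply HQ, Hin; assumption.
    - intros x y Hx Hy; apply Hcl, Hin; assumption. }
  assert (Hle1 : forall a b c d, in_disc a c -> in_disc a d -> in_disc b c ->
    in_disc b d -> c <= d -> loop_integral P Q a b c d = 0).
  { clear a b c d. intros a b c d H1 H2 H3 H4 Hcd.
    destruct (Rle_dec a b) as [Hab|Hab]; [apply Hle; assumption|].
    assert (E := Hle b a c d H3 H4 H1 H2 ltac:(lra) Hcd).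
    unfold loop_integral in *.
    rewrite (RInt_swap_R (fun x => P x c) b a) by (apply ex_RInt_disc_1; assumption).
    rewrite (RInt_swap_R (fun x => P x d) b a) by (apply ex_RInt_disc_1; assumption).
    lra. }
  intros H1 H2 H3 H4.
  destruct (Rle_dec c d) as [Hcd|Hcd]; [apply Hle1; assumption|].
  assert (E := Hle1 a b d c H2 H1 H4 H3 ltac:(lra)).
  unfold loop_integral in *.
  rewrite (RInt_swap_R (fun y => Q b y) d c) by (apply ex_RInt_disc_2; assumption).
  rewrite (RInt_swap_R (fun y => Q a y) d c) by (apply ex_RInt_disc_2; assumption).
  lra.
Qed.

Lemma RInt_near_const (f : R -> R) (a b l e : R) :
  ex_RInt f a b -> (forall x, Rmin a b <= x <= Rmax a b -> Rabs (f x - l) <= e) ->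
  Rabs (RInt f a b - l * (b - a)) <= e * Rabs (b - a).
Proof.
  assert (Hle : forall a b, a <= b -> ex_RInt f a b ->
    (forall x, a <= x <= b -> Rabs (f x - l) <= e) ->
    Rabs (RInt f a b - l * (b - a)) <= e * (b - a)).
  { clear a b. intros a b Hab Hf Hb.
    assert (E : is_RInt (fun x => f x - l) a b (RInt f a b - (b - a) * l)).
    { apply (is_RInt_minus (V := R_NormedModule) f (fun _ => l)).
      - apply (RInt_correct (V := R_CompleteNormedModule)); exact Hf.
      - apply (is_RInt_const (V := R_NormedModule)). }
    assert (B := abs_RInt_le_const _ a b e Hab (ex_intro _ _ E) Hb).
    apply (is_RInt_unique (V := R_CompleteNormedModule)) in E.
    rewrite E in B. rewrite (Rmult_comm l), (Rmult_comm e). exact B. }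
  intros Hf Hb. destruct (Rle_dec a b) as [Hab|Hab].
  - rewrite (Rabs_pos_eq (b - a)) by lra. apply Hle; try assumption.
    rewrite Rmin_left, Rmax_right in Hb by lra. exact Hb.
  - rewrite (Rabs_left (b - a)) by lra.
    rewrite Rmin_right, Rmax_left in Hb by lra.
    apply ex_RInt_swap in Hf.
    assert (B := Hle b a ltac:(lra) Hf Hb).
    rewrite (RInt_swap_R f b a) by exact Hf.
    replace (- RInt f b a - l * (b - a)) with (- (RInt f b a - l * (a - b))) by ring.
    rewrite Rabs_Ropp. lra.
Qed.

Lemma in_disc_axis (x y : R) : in_disc x y -> in_disc x 0.
Proof. unfold in_disc; nra. Qed.

(** The primitive integrates along the x-axis and then vertically, a path that stays in the disc.
    Since the loop around [x,x'] x [0,y] vanishes, its increment from (x, y) to (x', y') equals the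
    integral along the short path through (x', y), where P and Q are close to their values at (x,
    y). *)
Lemma poincare_disc (P Q : R -> R -> R) :
  continuous_on_disc P -> continuous_on_disc Q ->
  (forall x y, in_disc x y -> closed_form_at P Q x y) ->
  exists F : R -> R -> R, F 0 0 = 0 /\ forall x y, in_disc x y -> differentiable_pt_lim F x y (P x y) (Q x y).
Proof.
  intros HP HQ Hcl.
  exists (fun x y => RInt (fun s => P s 0) 0 x + RInt (fun t => Q x t) 0 y).
  split.
  { rewrite !(RInt_point (V := R_CompleteNormedModule)). apply Rplus_0_r. }
  intros x y Hxy eps.
  assert (He : 0 < eps / 2) by (pose proof (cond_pos eps); lra).
  destruct (in_disc_open x y Hxy) as [d0 Hd0].
  destruct (HP x y Hxy (mkposreal _ He)) as [d1 Hd1].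
  destruct (HQ x y Hxy (mkposreal _ He)) as [d2 Hd2].
  simpl in Hd1, Hd2.
  exists (mkposreal _ (Rmin_stable_in_posreal d0
    (mkposreal _ (Rmin_stable_in_posreal d1 d2)))); simpl.
  intros x' y' Hx' Hy'.
  assert (Hmin : forall r, r < Rmin d0 (Rmin d1 d2) -> r < d0 /\ r < d1 /\ r < d2).
  { intros r. unfold Rmin. destruct (Rle_dec d1 d2); destruct (Rle_dec _ _); lra. }
  apply Hmin in Hx'; apply Hmin in Hy'.
  assert (Z : Rabs (y - y) < d0) by (rewrite Rminus_eq_0, Rabs_R0; apply cond_pos).
  assert (H1 : in_disc x' y) by (apply Hd0; tauto).
  assert (H2 : in_disc x' y') by (apply Hd0; tauto).
  assert (H00 : in_disc 0 0) by (unfold in_disc; lra).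
  assert (Hx0 := in_disc_axis _ _ Hxy). assert (Hx'0 := in_disc_axis _ _ H1).
  assert (Hloop := goursat_disc P Q x x' 0 y HP HQ Hcl Hx0 Hxy Hx'0 H1).
  unfold loop_integral in Hloop.
  assert (E1 : RInt (fun s => P s 0) 0 x' =
    RInt (fun s => P s 0) 0 x + RInt (fun s => P s 0) x x').
  { apply RInt_split; apply ex_RInt_disc_1; assumption. }
  assert (E2 : RInt (fun t => Q x' t) 0 y' =
    RInt (fun t => Q x' t) 0 y + RInt (fun t => Q x' t) y y').
  { apply RInt_split; apply ex_RInt_disc_2; assumption. }
  rewrite E1, E2.
  assert (Habs : forall a b s, Rmin a b <= s <= Rmax a b -> Rabs (s - a) <= Rabs (b - a)).
  { intros a b s. unfold Rmin, Rmax. destruct (Rle_dec a b); intros Hs;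
    [rewrite (Rabs_pos_eq (b - a)), Rabs_pos_eq|
     rewrite (Rabs_left1 (b - a)), Rabs_left1]; lra. }
  assert (B1 := RInt_near_const (fun s => P s y) x x' (P x y) (eps / 2)
    (ex_RInt_disc_1 P x x' y HP Hxy H1)).
  assert (B2 := RInt_near_const (fun t => Q x' t) y y' (Q x y) (eps / 2)
    (ex_RInt_disc_2 Q x' y y' HQ H1 H2)).
  assert (C1 : Rabs (RInt (fun s => P s y) x x' - P x y * (x' - x))
                 <= eps / 2 * Rabs (x' - x)).
  { apply B1. intros s Hs. left. apply Hd1.
    - apply Habs in Hs. lra.
    - rewrite Rminus_eq_0, Rabs_R0; apply cond_pos. }
  assert (C2 : Rabs (RInt (fun t => Q x' t) y y' - Q x y * (y' - y))
                 <= eps / 2 * Rabs (y' - y)).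
  { apply B2. intros t Ht. left. apply Hd2.
    - tauto.
    - apply Habs in Ht. lra. }
  assert (M1 := Rmax_l (Rabs (x' - x)) (Rabs (y' - y))).
  assert (M2 := Rmax_r (Rabs (x' - x)) (Rabs (y' - y))).
  apply (Rmult_le_compat_l (eps / 2)) in M1; [|lra].
  apply (Rmult_le_compat_l (eps / 2)) in M2; [|lra].
  replace (_ - _ - _) with
    ((RInt (fun s => P s y) x x' - P x y * (x' - x)) +
     (RInt (fun t => Q x' t) y y' - Q x y * (y' - y))) by lra.
  eapply Rle_trans; [apply Rabs_triang|]. lra.
Qed.

(** * Complex differentiability and the Cauchy-Riemann equations *)

Definition C_diff_at (f : C -> C) (z l : C) : Prop :=
  forall eps : posreal, exists delta : posreal, forall w : C,
    Cmod (w - z) < delta -> Cmod (f w - f z - l * (w - z)) <= eps * Cmod (w - z).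

Lemma C_diff_at_is_derive (f : C -> C) (z l : C) :
  C_diff_at f z l <->
  is_derive (K := C_AbsRing) (V := AbsRing_NormedModule C_AbsRing) f z l.
Proof.
  split.
  - intros H. split; [apply is_linear_scal_l|].
    intros x Hx. apply (is_filter_lim_locally_unique (K := C_AbsRing)
      (V := AbsRing_NormedModule C_AbsRing)) in Hx. subst x.
    intros eps. destruct (H eps) as [delta Hd].
    exists delta. intros w Hw. specialize (Hd w Hw).
    change (Cmod (f w - f z - (w - z) * l) <= eps * Cmod (w - z)).
    rewrite (Cmult_comm (w - z)). exact Hd.
  - intros [_ H] eps.
    destruct (H z (fun P HP => HP) eps) as [delta Hd].
    exists delta. intros w Hw. specialize (Hd w Hw).
    change (Cmod (f w - f z - (w - z) * l) <= eps * Cmod (w - z)) in Hd.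
    rewrite (Cmult_comm (w - z)) in Hd. exact Hd.
Qed.

Lemma im_le_Cmod (z : C) : Rabs (Im z) <= Cmod z.
Proof.
  eapply Rle_trans; [apply Rmax_r|apply Rmax_Cmod].
Qed.

Lemma Cmod_le_abs_sum (z : C) : Cmod z <= Rabs (Re z) + Rabs (Im z).
Proof.
  replace z with (RtoC (Re z) + Ci * RtoC (Im z))%C at 1.
  - eapply Rle_trans; [apply Cmod_triangle|].
    rewrite Cmod_mult, Cmod_Ci, !Cmod_R. lra.
  - apply injective_projections; simpl; unfold Re, Im; ring.
Qed.

Lemma cauchy_riemann_C_diff_at (U V : R -> R -> R) (x y p q : R) :
  differentiable_pt_lim U x y p (- q) -> differentiable_pt_lim V x y q p ->
  C_diff_at (fun z => (U (Re z) (Im z), V (Re z) (Im z))) (x, y) (p, q).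
Proof.
  intros HU HV eps.
  assert (He : 0 < eps / 2) by (pose proof (cond_pos eps); lra).
  destruct (HU (mkposreal _ He)) as [d1 H1].
  destruct (HV (mkposreal _ He)) as [d2 H2]. simpl in H1, H2.
  exists (mkposreal _ (Rmin_stable_in_posreal d1 d2)); simpl.
  intros [u v] Hw.
  assert (Hw1 : Cmod ((u, v) - (x, y)) < d1) by (eapply Rlt_le_trans; [exact Hw|apply Rmin_l]).
  assert (Hw2 : Cmod ((u, v) - (x, y)) < d2) by (eapply Rlt_le_trans; [exact Hw|apply Rmin_r]).
  assert (HM := Rmax_Cmod ((u, v) - (x, y))%C). simpl in HM.
  fold (u - x) (v - y) in HM.
  assert (M1 := Rmax_l (Rabs (u - x)) (Rabs (v - y))).
  assert (M2 := Rmax_r (Rabs (u - x)) (Rabs (v - y))).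
  specialize (H1 u v ltac:(lra) ltac:(lra)). specialize (H2 u v ltac:(lra) ltac:(lra)).
  apply (Rmult_le_compat_l (eps / 2)) in HM; [|lra].
  eapply Rle_trans; [apply Cmod_le_abs_sum|]. simpl.
  replace (U u v + - U x y + - (p * (u + - x) - q * (v + - y)))
    with (U u v - U x y - (p * (u - x) + - q * (v - y))) by ring.
  replace (V u v + - V x y + - (p * (v + - y) + q * (u + - x)))
    with (V u v - V x y - (q * (u - x) + p * (v - y))) by ring.
  lra.
Qed.

Lemma differentiable_pt_lim_opp (F : R -> R -> R) (x y lx ly : R) :
  differentiable_pt_lim F x y lx ly ->
  differentiable_pt_lim (fun u v => - F u v) x y (- lx) (- ly).
Proof.
  intros H eps. destruct (H eps) as [d Hd]. exists d. intros u v Hu Hv.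
  specialize (Hd u v Hu Hv).
  replace (_ - _ - _) with (- (F u v - F x y - (lx * (u - x) + ly * (v - y)))) by ring.
  rewrite Rabs_Ropp. exact Hd.
Qed.

Lemma locally_in_disc (x y : R) :
  in_disc x y -> locally (x, y) (fun u : R * R => in_disc (fst u) (snd u)).
Proof.
  intros H. destruct (in_disc_open x y H) as [d Hd].
  exists d. intros u [Hu1 Hu2]. apply Hd; [exact Hu1|exact Hu2].
Qed.

Lemma ex_diff_1_differentiable (F : R -> R -> R) (x y : R) :
  (forall u v, in_disc u v -> ex_diff_n F 1 u v) -> in_disc x y ->
  differentiable_pt_lim F x y
    (Derive (fun s => F s y) x) (Derive (fun t => F x t) y).
Proof.
  intros HF Hxy.
  apply (proj1 (filterdiff_differentiable_pt_lim _ _ _ _ _)).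
  apply (is_derive_filterdiff F x y (fun u v => Derive (fun s => F s v) u)).
  - apply (filter_imp (fun u : R * R => in_disc (fst u) (snd u))).
    + intros u Hu. destruct (HF _ _ Hu) as [_ [H _]]. apply Derive_correct, H.
    + apply locally_in_disc, Hxy.
  - destruct (HF _ _ Hxy) as [_ [_ [H _]]]. apply Derive_correct, H.
  - destruct (HF _ _ Hxy) as [_ [_ [_ [[H _] _]]]].
    apply continuity_2d_pt_filterlim in H. exact H.
Qed.

(** The conjugate V is a primitive of -h_y dx + h_x dy, and h + iV then satisfies the Cauchy-Riemann
    equations with derivative h_x - i h_y. *)
Lemma harmonic_conjugate (h : C -> R) :
  harmonic_on_disc h ->
  exists V : C -> R, V (RtoC 0) = 0 /\
    forall z, unit_disc z ->
      C_diff_at (fun w => (h w, V w)) z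
        (Derive (fun s => h (s, Im z)) (Re z),
         - Derive (fun t => h (Re z, t)) (Im z)).
Proof.
  intros Hh.
  set (H := fun s t => h (s, t)).
  assert (HD : forall x y, in_disc x y -> unit_disc (x, y)).
  { intros x y Hxy. apply unit_disc_in_disc. exact Hxy. }
  assert (H2 : forall x y, in_disc x y -> ex_diff_n H 2 x y).
  { intros x y Hxy. apply (Hh x y), HD, Hxy. }
  assert (HX : forall x y, in_disc x y ->
    ex_diff_n (fun u v => Derive (fun s => H s v) u) 1 x y).
  { intros x y Hxy. apply (ex_diff_n_deriv_aux1 H 1), H2, Hxy. }
  assert (HY : forall x y, in_disc x y ->
    ex_diff_n (fun u v => Derive (fun t => H u t) v) 1 x y).
  { intros x y Hxy. apply (ex_diff_n_deriv_aux2 H 1), H2, Hxy. }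
  destruct (poincare_disc (fun u v => - Derive (fun t => H u t) v)
              (fun u v => Derive (fun s => H s v) u)) as [V [V0 HV]].
  - intros x y Hxy. apply continuity_2d_pt_opp. apply HY, Hxy.
  - intros x y Hxy. apply HX, Hxy.
  - intros x y Hxy.
    assert (DX := ex_diff_1_differentiable _ x y HX Hxy).
    assert (DY := differentiable_pt_lim_opp _ _ _ _ _
                    (ex_diff_1_differentiable _ x y HY Hxy)).
    assert (Lap := proj2 (Hh x y (HD x y Hxy))).
    unfold partial_derive in Lap; simpl in Lap. cbv beta in DX, DY.
    (* Harmonicity enters here: the form is closed because -h_yy = h_xx. *)
    replace (- Derive (fun t => Derive (fun t0 => H x t0) t) y)
      with (Derive (fun s => Derive (fun s0 => H s0 y) s) x) in DY.
    + exact (differentiable_closed_form_at _ _ _ _ _ _ _ DY DX).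
    + unfold H.
      apply (Rplus_eq_reg_r (Derive (fun t => Derive (fun t0 => h (x, t0)) t) y)).
      rewrite Rplus_opp_l. exact Lap.
  - exists (fun z => V (Re z) (Im z)). split; [exact V0|].
    intros [x y] Hz. apply unit_disc_in_disc in Hz. simpl in Hz.
    assert (DH : differentiable_pt_lim H x y
       (Derive (fun s => H s y) x) (Derive (fun t => H x t) y)).
    { apply ex_diff_1_differentiable; [|exact Hz].
      intros u v Huv. apply (ex_diff_n_m 2 1); [lia|]. apply H2, Huv. }
    assert (CD := cauchy_riemann_C_diff_at H V x y
      (Derive (fun s => H s y) x) (- Derive (fun t => H x t) y)).
    rewrite Ropp_involutive in CD. specialize (CD DH (HV x y Hz)).
    intros eps. destruct (CD eps) as [d Hd]. exists d.
    intros [u v] Hw. exact (Hd (u, v) Hw).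
Qed.

(** * Cauchy's formula and Taylor coefficients *)

Definition holomorphic_within (rho : R) (f : C -> C) : Prop :=
  forall z, Cmod z < rho -> exists l, C_diff_at f z l.

Definition cis (t : R) : C := (cos t, sin t).

(** Continuity is asked on the whole line: all integrands are defined there, and no end point of
    [0, 2 pi] needs special treatment. *)
Definition continuous_path (g : R -> C) : Prop :=
  forall t, continuity_pt (fun s => Re (g s)) t /\ continuity_pt (fun s => Im (g s)) t.

(** The integral is against d theta and is not normalised; the factor of dw = i w d theta goes into
    [cauchy_kernel]. *)
Definition circle_integral (g : R -> C) : C :=
  (RInt (fun t => Re (g t)) 0 (2 * PI), RInt (fun t => Im (g t)) 0 (2 * PI)).

Lemma Cmod_cis (t : R) : Cmod (cis t) = 1.
Proof.
  unfold Cmod, cis; simpl. rewrite !Rmult_1_r.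
  replace (cos t * cos t + sin t * sin t) with 1; [apply sqrt_1|].
  pose proof (sin2_cos2 t) as H; unfold Rsqr in H; lra.
Qed.

Lemma continuous_path_const (c : C) : continuous_path (fun _ => c).
Proof. intros t; split; apply continuity_pt_const; intros u v; reflexivity. Qed.

Lemma continuous_path_cis : continuous_path cis.
Proof.
  intros t; split; [exact (continuity_cos t)|exact (continuity_sin t)].
Qed.

Lemma continuous_path_plus (g h : R -> C) :
  continuous_path g -> continuous_path h ->
  continuous_path (fun t => (g t + h t)%C).
Proof.
  intros Hg Hh t. destruct (Hg t), (Hh t).
  split; apply (continuity_pt_plus (fun s => _ (g s)) (fun s => _ (h s))); assumption.
Qed.

Lemma continuous_path_mult (g h : R -> C) :
  continuous_path g -> continuous_path h ->
  continuous_path (fun t => (g t * h t)%C).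
Proof.
  intros Hg Hh t. destruct (Hg t) as [G1 G2], (Hh t) as [H1 H2]. split.
  - apply (continuity_pt_minus (fun s => Re (g s) * Re (h s)) (fun s => Im (g s) * Im (h s)));
    apply (continuity_pt_mult (fun s => _ (g s)) (fun s => _ (h s))); assumption.
  - apply (continuity_pt_plus (fun s => Re (g s) * Im (h s)) (fun s => Im (g s) * Re (h s)));
    apply (continuity_pt_mult (fun s => _ (g s)) (fun s => _ (h s))); assumption.
Qed.

Lemma continuous_path_inv (g : R -> C) :
  continuous_path g -> (forall t, g t <> RtoC 0) ->
  continuous_path (fun t => (/ g t)%C).
Proof.
  intros Hg Hn t. destruct (Hg t) as [G1 G2].
  assert (HN : Re (g t) ^ 2 + Im (g t) ^ 2 <> 0).
  { rewrite <- Cmod2_alt. apply pow_nonzero. intros E. apply (Hn t), Cmod_eq_0, E. }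
  assert (HD : continuity_pt (fun s => Re (g s) ^ 2 + Im (g s) ^ 2) t).
  { apply (continuity_pt_plus (fun s => Re (g s) ^ 2) (fun s => Im (g s) ^ 2)).
    - apply (continuity_pt_comp (fun s => Re (g s)) (fun x => x ^ 2)); [exact G1|].
      apply derivable_continuous_pt, derivable_pt_pow.
    - apply (continuity_pt_comp (fun s => Im (g s)) (fun x => x ^ 2)); [exact G2|].
      apply derivable_continuous_pt, derivable_pt_pow. }
  split.
  - apply (continuity_pt_div (fun s => Re (g s)) (fun s => Re (g s) ^ 2 + Im (g s) ^ 2));
      assumption.
  - apply (continuity_pt_div (fun s => - Im (g s)) (fun s => Re (g s) ^ 2 + Im (g s) ^ 2));
      [|assumption|assumption].
    apply (continuity_pt_opp (fun s => Im (g s))); exact G2.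
Qed.

Lemma continuous_path_pow (g : R -> C) (n : nat) :
  continuous_path g -> continuous_path (fun t => (g t ^ n)%C).
Proof.
  intros Hg. induction n as [|n IH]; [exact (continuous_path_const (RtoC 1))|].
  exact (continuous_path_mult g (fun t => (g t ^ n)%C) Hg IH).
Qed.

Lemma continuous_path_conj (g : R -> C) :
  continuous_path g -> continuous_path (fun t => Cconj (g t)).
Proof.
  intros Hg t. destruct (Hg t). split; [assumption|].
  apply (continuity_pt_opp (fun s => Im (g s))); assumption.
Qed.

Lemma C_diff_at_lipschitz (f : C -> C) (z l : C) :
  C_diff_at f z l ->
  exists (K : posreal) (delta : posreal), forall w, Cmod (w - z) < delta ->
    Cmod (f w - f z) <= K * Cmod (w - z).
Proof.
  intros H. destruct (H (mkposreal 1 Rlt_0_1)) as [d Hd]; simpl in Hd.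
  assert (HK : 0 < Cmod l + 1) by (pose proof (Cmod_ge_0 l); lra).
  exists (mkposreal _ HK), d. intros w Hw; simpl.
  specialize (Hd w Hw).
  replace (f w - f z)%C with ((f w - f z - l * (w - z)) + l * (w - z))%C by ring.
  eapply Rle_trans; [apply Cmod_triangle|]. rewrite Cmod_mult. lra.
Qed.

Lemma C_diff_at_continuous (f : C -> C) (z l : C) :
  C_diff_at f z l -> forall eps : posreal, exists delta : posreal,
    forall w, Cmod (w - z) < delta -> Cmod (f w - f z) < eps.
Proof.
  intros H eps. destruct (C_diff_at_lipschitz f z l H) as [K [d Hd]].
  assert (He : 0 < eps / K) by (apply Rdiv_lt_0_compat; apply cond_pos).
  exists (mkposreal _ (Rmin_stable_in_posreal d (mkposreal _ He))); simpl.
  intros w Hw.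
  assert (Hw1 : Cmod (w - z) < d) by (eapply Rlt_le_trans; [exact Hw|apply Rmin_l]).
  assert (Hw2 : Cmod (w - z) < eps / K) by (eapply Rlt_le_trans; [exact Hw|apply Rmin_r]).
  eapply Rle_lt_trans; [apply Hd, Hw1|].
  apply (Rmult_lt_compat_l K) in Hw2; [|apply cond_pos].
  replace (K * (eps / K)) with (pos eps) in Hw2; [exact Hw2|].
  field. apply Rgt_not_eq, cond_pos.
Qed.

Lemma continuous_path_near (g : R -> C) (t : R) :
  continuous_path g -> forall eps : posreal, exists delta : posreal,
    forall s, Rabs (s - t) < delta -> Cmod (g s - g t) < eps.
Proof.
  intros Hg eps. destruct (Hg t) as [G1 G2].
  assert (He : 0 < eps / 2) by (pose proof (cond_pos eps); lra).
  assert (Hpt : forall p, continuity_pt p t -> exists delta : posreal,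
    forall s, Rabs (s - t) < delta -> Rabs (p s - p t) < eps / 2).
  { intros p Hp. destruct (Hp _ He) as [d [Hd Hp']].
    exists (mkposreal d Hd); simpl. intros s Hs.
    destruct (Req_dec s t) as [->|Hne].
    - rewrite Rminus_eq_0, Rabs_R0; exact He.
    - apply Hp'. split; [|exact Hs]. split; [exact I|]. intros E; apply Hne; symmetry; exact E. }
  destruct (Hpt _ G1) as [d1 H1], (Hpt _ G2) as [d2 H2].
  exists (mkposreal _ (Rmin_stable_in_posreal d1 d2)); simpl. intros s Hs.
  specialize (H1 s). specialize (H2 s).
  eapply Rle_lt_trans; [apply Cmod_le_abs_sum|].
  change (Rabs (Re (g s) - Re (g t)) + Rabs (Im (g s) - Im (g t)) < eps).
  assert (Hs1 : Rabs (s - t) < d1) by (eapply Rlt_le_trans; [exact Hs|apply Rmin_l]).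
  assert (Hs2 : Rabs (s - t) < d2) by (eapply Rlt_le_trans; [exact Hs|apply Rmin_r]).
  specialize (H1 Hs1); specialize (H2 Hs2). lra.
Qed.

Lemma continuous_path_intro (g : R -> C) :
  (forall (t : R) (eps : posreal), exists delta : posreal,
     forall s, Rabs (s - t) < delta -> Cmod (g s - g t) < eps) ->
  continuous_path g.
Proof.
  intros H t.
  split; intros eps Heps; destruct (H t (mkposreal eps Heps)) as [d Hd];
    exists d; (split; [apply cond_pos|]); intros s [_ Hs].
  - eapply Rle_lt_trans; [apply (re_le_Cmod (g s - g t)%C)|]. apply Hd, Hs.
  - eapply Rle_lt_trans; [apply (im_le_Cmod (g s - g t)%C)|]. apply Hd, Hs.
Qed.

Lemma continuous_path_holomorphic (rho : R) (f : C -> C) (g : R -> C) :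
  holomorphic_within rho f -> continuous_path g -> (forall t, Cmod (g t) < rho) ->
  continuous_path (fun t => f (g t)).
Proof.
  intros Hf Hg Hr. apply continuous_path_intro. intros t eps.
  destruct (Hf (g t) (Hr t)) as [l Hl].
  destruct (C_diff_at_continuous f _ _ Hl eps) as [d Hd].
  destruct (continuous_path_near g t Hg d) as [d' Hd'].
  exists d'. intros s Hs. apply Hd, Hd', Hs.
Qed.

Lemma continuous_path_ex_RInt (g : R -> C) (a b : R) :
  continuous_path g ->
  ex_RInt (fun t => Re (g t)) a b /\ ex_RInt (fun t => Im (g t)) a b.
Proof.
  intros Hg.
  split; apply (ex_RInt_continuous (V := R_CompleteNormedModule)); intros t _;
    apply continuity_pt_filterlim, Hg.
Qed.

Lemma circle_integral_ext (g h : R -> C) :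
  (forall t, g t = h t) -> circle_integral g = circle_integral h.
Proof.
  intros E. unfold circle_integral. f_equal; apply RInt_ext; intros t _; rewrite E; reflexivity.
Qed.

Lemma circle_integral_plus (g h : R -> C) :
  continuous_path g -> continuous_path h ->
  circle_integral (fun t => (g t + h t)%C) = (circle_integral g + circle_integral h)%C.
Proof.
  intros Hg Hh.
  destruct (continuous_path_ex_RInt g 0 (2 * PI) Hg).
  destruct (continuous_path_ex_RInt h 0 (2 * PI) Hh).
  apply injective_projections; simpl;
    apply (RInt_plus (V := R_CompleteNormedModule)); assumption.
Qed.

Lemma circle_integral_scal (c : C) (g : R -> C) :
  continuous_path g ->
  circle_integral (fun t => (c * g t)%C) = (c * circle_integral g)%C.
Proof.
  intros Hg.
  destruct (continuous_path_ex_RInt g 0 (2 * PI) Hg) as [H1 H2].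
  apply (RInt_correct (V := R_CompleteNormedModule)) in H1, H2.
  apply injective_projections; simpl; apply (is_RInt_unique (V := R_CompleteNormedModule)).
  - apply (is_RInt_minus (V := R_NormedModule) (fun t => fst c * fst (g t)) (fun t => snd c * snd (g t)));
    apply (is_RInt_scal (V := R_NormedModule)); assumption.
  - apply (is_RInt_plus (V := R_NormedModule) (fun t => fst c * snd (g t)) (fun t => snd c * fst (g t)));
    apply (is_RInt_scal (V := R_NormedModule)); assumption.
Qed.

Lemma circle_integral_const (c : C) :
  circle_integral (fun _ => c) = (RtoC (2 * PI) * c)%C.
Proof.
  unfold circle_integral. rewrite !(RInt_const (V := R_CompleteNormedModule)).
  apply injective_projections; simpl; unfold scal; simpl; unfold mult; simpl;
    unfold Re, Im; ring.
Qed.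

(** The constant is twice the sharp 2 pi, as real and imaginary parts are estimated separately. *)
Lemma circle_integral_bound (g : R -> C) (M : R) :
  continuous_path g -> (forall t, 0 <= t <= 2 * PI -> Cmod (g t) <= M) ->
  Cmod (circle_integral g) <= 4 * PI * M.
Proof.
  intros Hg HM. pose proof PI_RGT_0.
  destruct (continuous_path_ex_RInt g 0 (2 * PI) Hg) as [H1 H2].
  eapply Rle_trans; [apply Cmod_le_abs_sum|]. simpl.
  assert (B1 := abs_RInt_le_const _ 0 (2 * PI) M ltac:(lra) H1
    (fun t Ht => Rle_trans _ _ _ (re_le_Cmod (g t)) (HM t Ht))).
  assert (B2 := abs_RInt_le_const _ 0 (2 * PI) M ltac:(lra) H2
    (fun t Ht => Rle_trans _ _ _ (im_le_Cmod (g t)) (HM t Ht))).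
  lra.
Qed.

Lemma cis_lipschitz (s t : R) : Cmod (cis s - cis t) <= 2 * Rabs (s - t).
Proof.
  assert (B1 : Rabs (cos s - cos t) <= 1 * Rabs (s - t)).
  { apply (bounded_variation cos (fun u => - sin u)). intros u _.
    split; [apply is_derive_cos|]. rewrite Rabs_Ropp. apply Rabs_le, SIN_bound. }
  assert (B2 : Rabs (sin s - sin t) <= 1 * Rabs (s - t)).
  { apply (bounded_variation sin cos). intros u _.
    split; [apply is_derive_sin|]. apply Rabs_le, COS_bound. }
  eapply Rle_trans; [apply Cmod_le_abs_sum|]. simpl. fold (cos s - cos t) (sin s - sin t). lra.
Qed.

Lemma cis_derivative (t : R) (eps : posreal) :
  exists delta : posreal, forall s, Rabs (s - t) < delta ->
    Cmod (cis s - cis t - Ci * cis t * RtoC (s - t)) <= eps * Rabs (s - t).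
Proof.
  assert (He : 0 < eps / 2) by (pose proof (cond_pos eps); lra).
  assert (HD : forall f l, derivable_pt_lim f t l -> exists delta : posreal,
    forall s, Rabs (s - t) < delta -> Rabs (f s - f t - l * (s - t)) <= eps / 2 * Rabs (s - t)).
  { intros f l Hf. destruct (Hf _ He) as [d Hd]. exists d. intros s Hs.
    destruct (Req_dec (s - t) 0) as [E|E].
    - replace s with t by lra. rewrite !Rminus_eq_0, Rmult_0_r, Rminus_0_r, Rabs_R0. lra.
    - specialize (Hd (s - t) E Hs). replace (t + (s - t)) with s in Hd by ring.
      replace (f s - f t - l * (s - t)) with (((f s - f t) / (s - t) - l) * (s - t)) by (field; exact E).
      rewrite Rabs_mult. apply Rmult_le_compat_r; [apply Rabs_pos|lra]. }
  destruct (HD cos _ (derivable_pt_lim_cos t)) as [d1 H1].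
  destruct (HD sin _ (derivable_pt_lim_sin t)) as [d2 H2].
  exists (mkposreal _ (Rmin_stable_in_posreal d1 d2)); simpl. intros s Hs.
  specialize (H1 s ltac:(eapply Rlt_le_trans; [exact Hs|apply Rmin_l])).
  specialize (H2 s ltac:(eapply Rlt_le_trans; [exact Hs|apply Rmin_r])).
  eapply Rle_trans; [apply Cmod_le_abs_sum|]. simpl.
  match goal with |- Rabs ?a + Rabs ?b <= _ =>
    replace a with (cos s - cos t - - sin t * (s - t)) by ring;
    replace b with (sin s - sin t - cos t * (s - t)) by ring end.
  lra.
Qed.

(** * Cauchy's formula by shrinking the unit circle to a point *)

Lemma closed_form_at_components (P Q : R -> R -> C) (x0 y0 : R) (m : C) :
  (forall eps : posreal, exists delta : posreal,
    forall d x x' y y' : R, d < delta ->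
      Rabs (x - x0) <= d -> Rabs (x' - x0) <= d ->
      Rabs (y - y0) <= d -> Rabs (y' - y0) <= d ->
      Cmod (P x y - P x y' - m * RtoC (y - y')) <= eps * d /\
      Cmod (Q x y - Q x' y - m * RtoC (x - x')) <= eps * d) ->
  closed_form_at (fun x y => Re (P x y)) (fun x y => Re (Q x y)) x0 y0 /\
  closed_form_at (fun x y => Im (P x y)) (fun x y => Im (Q x y)) x0 y0.
Proof.
  intros H. split; [exists (Re m)|exists (Im m)]; intros eps;
    destruct (H eps) as [delta Hd]; exists delta;
    intros d x x' y y' H1 H2 H3 H4 H5;
    destruct (Hd d x x' y y' H1 H2 H3 H4 H5) as [B1 B2].
  - assert (C1 := re_le_Cmod (P x y - P x y' - m * RtoC (y - y'))%C).
    assert (C2 := re_le_Cmod (Q x y - Q x' y - m * RtoC (x - x'))%C).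
    split; [replace (_ - _) with (Re (P x y - P x y' - m * RtoC (y - y'))%C)
           |replace (_ - _) with (Re (Q x y - Q x' y - m * RtoC (x - x'))%C)];
      try lra; simpl; unfold Re; ring.
  - assert (C1 := im_le_Cmod (P x y - P x y' - m * RtoC (y - y'))%C).
    assert (C2 := im_le_Cmod (Q x y - Q x' y - m * RtoC (x - x'))%C).
    split; [replace (_ - _) with (Im (P x y - P x y' - m * RtoC (y - y'))%C)
           |replace (_ - _) with (Im (Q x y - Q x' y - m * RtoC (x - x'))%C)];
      try lra; simpl; unfold Im; ring.
Qed.

(** The homotopy from the constant path z at t = 0 to the unit circle at t = 1, along segments. *)
Definition cone (z : C) (t theta : R) : C := (z + RtoC t * (cis theta - z))%C.

(** This is -i dw / (w - z) on the unit circle. On the circle of parameter t in the cone, both dw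
    and w - z acquire a factor t, so the same kernel serves for every t. *)
Definition cauchy_kernel (z : C) (theta : R) : C := (cis theta / (cis theta - z))%C.

Lemma cis_minus_bound (z : C) (theta : R) : 1 - Cmod z <= Cmod (cis theta - z).
Proof.
  rewrite <- (Cmod_cis theta).
  pose proof (Cmod_triangle (cis theta - z) z) as H.
  replace (cis theta - z + z)%C with (cis theta) in H by ring. lra.
Qed.

Lemma cis_minus_neq_0 (z : C) (theta : R) : Cmod z < 1 -> (cis theta - z)%C <> RtoC 0.
Proof.
  intros Hz E. pose proof (cis_minus_bound z theta) as H.
  rewrite E, Cmod_0 in H. lra.
Qed.

Lemma cauchy_kernel_bound (z : C) (theta : R) :
  Cmod z < 1 -> Cmod (cauchy_kernel z theta) <= / (1 - Cmod z).
Proof.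
  intros Hz. unfold cauchy_kernel.
  rewrite Cmod_div by (apply cis_minus_neq_0, Hz). rewrite Cmod_cis.
  unfold Rdiv; rewrite Rmult_1_l. apply Rinv_le_contravar; [lra|apply cis_minus_bound].
Qed.

Lemma continuous_path_cauchy_kernel (z : C) :
  Cmod z < 1 -> continuous_path (cauchy_kernel z).
Proof.
  intros Hz.
  apply (continuous_path_mult cis (fun t => / (cis t - z))%C); [apply continuous_path_cis|].
  apply (continuous_path_inv (fun t => cis t - z)%C).
  - apply (continuous_path_plus cis (fun _ => - z)%C);
      [apply continuous_path_cis|apply continuous_path_const].
  - intros t; apply cis_minus_neq_0, Hz.
Qed.

Lemma Cmod_cone (z : C) (t theta : R) :
  Cmod z < 1 -> 0 <= t <= 1 -> Cmod (cone z t theta) <= 1.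
Proof.
  intros Hz Ht. unfold cone.
  replace (z + RtoC t * (cis theta - z))%C
    with (RtoC (1 - t) * z + RtoC t * cis theta)%C by (rewrite RtoC_minus; ring).
  eapply Rle_trans; [apply Cmod_triangle|].
  rewrite !Cmod_mult, !Cmod_R, Cmod_cis, !Rabs_pos_eq by lra. nra.
Qed.

(** The 4 is 2, a bound of |cis theta - z|, plus the constant 2 of [cis_lipschitz]. *)
Lemma cone_near (z : C) (t0 theta0 t theta d : R) :
  Cmod z < 1 -> 0 <= t0 <= 1 -> Rabs (t - t0) <= d -> Rabs (theta - theta0) <= d ->
  Cmod (cone z t theta - cone z t0 theta0) <= 4 * d.
Proof.
  intros Hz Ht0 Ht Hth. unfold cone.
  replace (_ - _)%C with (RtoC (t - t0) * (cis theta - z) + RtoC t0 * (cis theta - cis theta0))%C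
    by (rewrite RtoC_minus; ring).
  eapply Rle_trans; [apply Cmod_triangle|].
  rewrite !Cmod_mult, !Cmod_R, (Rabs_pos_eq t0) by lra.
  assert (B1 : Cmod (cis theta - z) <= 2).
  { eapply Rle_trans; [apply Cmod_triangle|]. rewrite Cmod_cis, Cmod_opp. lra. }
  assert (B2 := cis_lipschitz theta theta0).
  pose proof (Rabs_pos (t - t0)). pose proof (Cmod_ge_0 (cis theta - cis theta0)). nra.
Qed.

(* P dt + Q dtheta is -i F(w) dw / (w - z) pulled back by the cone map. *)
Lemma cone_form_closed (rho : R) (F : C -> C) (z : C) (t0 theta0 : R) :
  holomorphic_within rho F -> 1 < rho -> Cmod z < 1 -> 0 < t0 <= 1 ->
  let P := fun t theta => (- Ci * RtoC (/ t) * F (cone z t theta))%C in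
  let Q := fun t theta => (F (cone z t theta) * cauchy_kernel z theta)%C in
  closed_form_at (fun x y => Re (P x y)) (fun x y => Re (Q x y)) t0 theta0 /\
  closed_form_at (fun x y => Im (P x y)) (fun x y => Im (Q x y)) t0 theta0.
Proof.
  intros HF Hrho Hz Ht0 P Q.
  destruct (HF (cone z t0 theta0)) as [l Hl].
  { pose proof (Cmod_cone z t0 theta0 Hz ltac:(lra)). lra. }
  (* The common slope, with l = F'(w): differentiating P in theta gives (-i / t) l (t i cis theta),
     and Q in t gives l (cis theta - z) times the kernel; both equal l cis theta. *)
  apply (closed_form_at_components P Q t0 theta0 (l * cis theta0)%C).
  intros eps.
  set (L := Cmod l). assert (HL : 0 <= L) by apply Cmod_ge_0.
  set (kappa := / (1 - Cmod z)).
  assert (Hkappa : 0 < kappa) by (apply Rinv_0_lt_compat; lra).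
  assert (Hit : 0 < / t0) by (apply Rinv_0_lt_compat; lra).
  (* This sum collects all error terms: 16 / t0 and 8 kappa come from the remainder of F in P and in
     Q, and 2 L from the variation of [cis] in either. *)
  assert (HM : 0 < 2 * L + 16 * / t0 + 8 * kappa) by lra.
  assert (Heta : 0 < eps / (2 * L + 16 * / t0 + 8 * kappa)).
  { apply Rdiv_lt_0_compat; [apply cond_pos|exact HM]. }
  set (eta := eps / (2 * L + 16 * / t0 + 8 * kappa)) in *.
  assert (Eeta : eta * (2 * L + 16 * / t0 + 8 * kappa) = eps).
  { unfold eta, Rdiv. rewrite Rmult_assoc, Rinv_l by lra. apply Rmult_1_r. }
  clearbody eta.
  destruct (Hl (mkposreal _ Heta)) as [dF HdF]; simpl in HdF.
  destruct (cis_derivative theta0 (mkposreal _ Heta)) as [dc Hdc]; simpl in Hdc.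
  (* The four bounds keep the cone points within dF, the angles within dc, the variation of [cis]
     below eta, and t above t0 / 2. *)
  assert (Hdelta : 0 < Rmin (Rmin (dF / 4) dc) (Rmin (eta / 2) (t0 / 2))).
  { pose proof (cond_pos dF); pose proof (cond_pos dc).
    repeat apply Rmin_glb_lt; lra. }
  exists (mkposreal _ Hdelta); simpl.
  intros d t t' th th' Hd Ht Ht' Hth Hth'.
  assert (Hd' : d < dF / 4 /\ d < dc /\ d < eta / 2 /\ d < t0 / 2).
  { repeat split; (eapply Rlt_le_trans; [exact Hd|]).
    - eapply Rle_trans; [apply Rmin_l|apply Rmin_l].
    - eapply Rle_trans; [apply Rmin_l|apply Rmin_r].
    - eapply Rle_trans; [apply Rmin_r|apply Rmin_l].
    - eapply Rle_trans; [apply Rmin_r|apply Rmin_r]. }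
  destruct Hd' as [Hd1 [Hd2 [Hd3 Hd4]]].
  assert (Hd0 : 0 <= d) by (pose proof (Rabs_pos (t - t0)); lra).
  assert (Htt : Rabs (t - t') <= 2 * d).
  { replace (t - t') with ((t - t0) - (t' - t0)) by ring.
    eapply Rle_trans; [apply Rabs_triang|]. rewrite Rabs_Ropp. lra. }
  assert (HE : forall t1 th1 t2 th2, Rabs (t1 - t0) <= d -> Rabs (th1 - theta0) <= d ->
     Rabs (t2 - t0) <= d -> Rabs (th2 - theta0) <= d ->
     Cmod (F (cone z t1 th1) - F (cone z t2 th2) - l * (cone z t1 th1 - cone z t2 th2))
       <= 8 * eta * d).
  { intros t1 th1 t2 th2 A1 A2 A3 A4.
    assert (N1 := cone_near z t0 theta0 t1 th1 d Hz ltac:(lra) A1 A2).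
    assert (N2 := cone_near z t0 theta0 t2 th2 d Hz ltac:(lra) A3 A4).
    assert (B1 := HdF (cone z t1 th1) ltac:(lra)).
    assert (B2 := HdF (cone z t2 th2) ltac:(lra)).
    set (g0 := cone z t0 theta0) in *. set (g1 := cone z t1 th1) in *.
    set (g2 := cone z t2 th2) in *.
    replace (_ - _ - _)%C with ((F g1 - F g0 - l * (g1 - g0)) + - (F g2 - F g0 - l * (g2 - g0)))%C by ring.
    eapply Rle_trans; [apply Cmod_triangle|]. rewrite Cmod_opp.
    apply (Rmult_le_compat_l eta) in N1; [|lra].
    apply (Rmult_le_compat_l eta) in N2; [|lra]. lra. }
  assert (Hc : forall th1, Rabs (th1 - theta0) <= d ->
    Cmod (cis th1 - cis theta0 - Ci * cis theta0 * RtoC (th1 - theta0)) <= eta * d).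
  { intros th1 A. eapply Rle_trans; [apply Hdc; lra|]. apply Rmult_le_compat_l; lra. }
  split.
  - assert (Htp : t0 / 2 < t) by (apply Rabs_le_between in Ht; lra).
    assert (Hti : 0 < / t <= 2 * / t0).
    { split; [apply Rinv_0_lt_compat; lra|].
      replace (2 * / t0) with (/ (t0 / 2)) by (field; lra).
      apply Rinv_le_contravar; lra. }
    assert (B := HE t th t th' Ht Hth Ht Hth').
    assert (C1 := Hc th Hth). assert (C2 := Hc th' Hth').
    set (E := (F (cone z t th) - F (cone z t th') - l * (cone z t th - cone z t th'))%C) in *.
    set (e1 := (cis th - cis theta0 - Ci * cis theta0 * RtoC (th - theta0))%C) in *.
    set (e2 := (cis th' - cis theta0 - Ci * cis theta0 * RtoC (th' - theta0))%C) in *.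
    replace (P t th - P t th' - l * cis theta0 * RtoC (th - th'))%C
      with (- Ci * RtoC (/ t) * E + - Ci * l * (e1 + - e2))%C.
    + eapply Rle_trans; [apply Cmod_triangle|].
      rewrite !Cmod_mult, Cmod_opp, Cmod_Ci, Cmod_R, (Rabs_pos_eq (/ t)) by lra.
      assert (Cmod (e1 + - e2) <= 2 * eta * d).
      { eapply Rle_trans; [apply Cmod_triangle|]. rewrite Cmod_opp. lra. }
      fold L. pose proof (Cmod_ge_0 E). pose proof (Cmod_ge_0 (e1 + - e2)).
      assert (/ t * Cmod E <= 2 * / t0 * (8 * eta * d)) by (apply Rmult_le_compat; lra).
      assert (L * Cmod (e1 + - e2) <= L * (2 * eta * d)) by (apply Rmult_le_compat_l; lra).
      rewrite <- Eeta. assert (0 <= eta * kappa * d) by (repeat apply Rmult_le_pos; lra). lra.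
    + unfold E, e1, e2, P, cone. rewrite !RtoC_minus, RtoC_inv by lra.
      assert (RtoC t <> 0) by (intros X; apply RtoC_inj in X; lra).
      assert (Ci2 : (Ci * Ci = - 1)%C).
      { apply injective_projections; simpl; ring. }
      replace (- Ci * / RtoC t *
        (F (z + RtoC t * (cis th - z)) - F (z + RtoC t * (cis th' - z)) -
        l * (z + RtoC t * (cis th - z) - (z + RtoC t * (cis th' - z)))))%C
        with (- Ci * / RtoC t * F (z + RtoC t * (cis th - z)) -
          - Ci * / RtoC t * F (z + RtoC t * (cis th' - z)) + Ci * l * (cis th - cis th'))%C
        by (field; assumption).
      match goal with |- (?a = ?b)%C => replace a with
        (b + l * cis theta0 * (RtoC th - RtoC th') * (Ci * Ci + 1))%C by ring end.
      rewrite Ci2. ring.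
  - assert (B := HE t th t' th Ht Hth Ht' Hth).
    assert (C1 := cis_lipschitz th theta0).
    assert (Kb := cauchy_kernel_bound z th Hz). fold kappa in Kb.
    set (E := (F (cone z t th) - F (cone z t' th) - l * (cone z t th - cone z t' th))%C) in *.
    replace (Q t th - Q t' th - l * cis theta0 * RtoC (t - t'))%C
      with (E * cauchy_kernel z th + l * RtoC (t - t') * (cis th - cis theta0))%C.
    + eapply Rle_trans; [apply Cmod_triangle|].
      rewrite !Cmod_mult, Cmod_R. fold L.
      pose proof (Cmod_ge_0 E). pose proof (Cmod_ge_0 (cauchy_kernel z th)).
      pose proof (Cmod_ge_0 (cis th - cis theta0)). pose proof (Rabs_pos (t - t')).
      assert (Cmod E * Cmod (cauchy_kernel z th) <= 8 * eta * d * kappa) by (apply Rmult_le_compat; lra).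
      assert (Rabs (t - t') * Cmod (cis th - cis theta0) <= (2 * d) * eta) by (apply Rmult_le_compat; lra).
      assert (L * (Rabs (t - t') * Cmod (cis th - cis theta0)) <= L * ((2 * d) * eta))
        by (apply Rmult_le_compat_l; lra).
      rewrite <- Eeta. assert (0 <= eta * / t0 * d) by (repeat apply Rmult_le_pos; lra). lra.
    + unfold E, Q, cone, cauchy_kernel. rewrite RtoC_minus. field.
      apply cis_minus_neq_0, Hz.
Qed.

Lemma holomorphic_cone_continuity (rho : R) (F : C -> C) (z : C) (t0 theta0 : R) :
  holomorphic_within rho F -> 1 < rho -> Cmod z < 1 -> 0 <= t0 <= 1 ->
  continuity_2d_pt (fun t theta => Re (F (cone z t theta))) t0 theta0 /\
  continuity_2d_pt (fun t theta => Im (F (cone z t theta))) t0 theta0.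
Proof.
  intros HF Hrho Hz Ht0.
  destruct (HF (cone z t0 theta0)) as [l Hl].
  { pose proof (Cmod_cone z t0 theta0 Hz ltac:(lra)). lra. }
  assert (Hc : forall eps : posreal, locally_2d (fun t theta =>
    Cmod (F (cone z t theta) - F (cone z t0 theta0)) < eps) t0 theta0).
  { intros eps. destruct (C_diff_at_continuous F _ _ Hl eps) as [d Hd].
    assert (Hd8 : 0 < d / 8) by (pose proof (cond_pos d); lra).
    exists (mkposreal _ Hd8); simpl. intros t theta Ht Hth. apply Hd.
    eapply Rle_lt_trans; [apply (cone_near z t0 theta0 t theta (d / 8)); try assumption; lra|].
    pose proof (cond_pos d); lra. }
  split; intros eps; destruct (Hc eps) as [d Hd]; exists d; intros t theta Ht Hth;
    specialize (Hd t theta Ht Hth); eapply Rle_lt_trans; try exact Hd.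
  - exact (re_le_Cmod (F (cone z t theta) - F (cone z t0 theta0))%C).
  - exact (im_le_Cmod (F (cone z t theta) - F (cone z t0 theta0))%C).
Qed.

Lemma continuous_path_cone (z : C) (t : R) : continuous_path (cone z t).
Proof.
  apply (continuous_path_plus (fun _ => z) (fun th => RtoC t * (cis th - z))%C);
    [apply continuous_path_const|].
  apply (continuous_path_mult (fun _ => RtoC t) (fun th => cis th - z)%C);
    [apply continuous_path_const|].
  apply (continuous_path_plus cis (fun _ => - z)%C);
    [apply continuous_path_cis|apply continuous_path_const].
Qed.

Lemma continuous_path_cauchy_integrand (rho : R) (F : C -> C) (z : C) (t : R) :
  holomorphic_within rho F -> 1 < rho -> Cmod z < 1 -> 0 <= t <= 1 ->
  continuous_path (fun th => (F (cone z t th) * cauchy_kernel z th)%C).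
Proof.
  intros HF Hrho Hz Ht.
  apply (continuous_path_mult (fun th => F (cone z t th)) (cauchy_kernel z));
    [|apply continuous_path_cauchy_kernel, Hz].
  apply (continuous_path_holomorphic rho); [exact HF|apply continuous_path_cone|].
  intros th. pose proof (Cmod_cone z t th Hz Ht). lra.
Qed.

(** The form has zero loop integral around [e,1] x [0, 2 pi]. Its sides theta = 0 and theta = 2 pi
    cancel by periodicity, which leaves the circles t = 1 and t = e. The bound e > 0 avoids the pole
    of 1 / t. *)
Lemma cauchy_homotopy (rho : R) (F : C -> C) (z : C) (e : R) :
  holomorphic_within rho F -> 1 < rho -> Cmod z < 1 -> 0 < e <= 1 ->
  circle_integral (fun th => (F (cone z 1 th) * cauchy_kernel z th)%C) =
  circle_integral (fun th => (F (cone z e th) * cauchy_kernel z th)%C).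
Proof.
  intros HF Hrho Hz He.
  set (P := fun t th => (- Ci * RtoC (/ t) * F (cone z t th))%C).
  set (Q := fun t th => (F (cone z t th) * cauchy_kernel z th)%C).
  assert (HPI := PI_RGT_0).
  assert (Hcont : forall t th, e <= t <= 1 ->
    (continuity_2d_pt (fun t th => Re (P t th)) t th /\
     continuity_2d_pt (fun t th => Im (P t th)) t th) /\
    (continuity_2d_pt (fun t th => Re (Q t th)) t th /\
     continuity_2d_pt (fun t th => Im (Q t th)) t th)).
  { intros t th Ht.
    destruct (holomorphic_cone_continuity rho F z t th HF Hrho Hz ltac:(lra)) as [F1 F2].
    assert (Hinv : continuity_2d_pt (fun t _ => / t) t th).
    { apply (continuity_2d_pt_inv (fun t _ => t)); [apply continuity_2d_pt_id1|lra]. }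
    destruct (continuous_path_cauchy_kernel z Hz th) as [K1 K2].
    assert (K1' : continuity_2d_pt (fun _ th => Re (cauchy_kernel z th)) t th)
      by (apply (continuity_1d_2d_pt_comp (fun s => Re (cauchy_kernel z s)) (fun _ v => v));
          [exact K1|apply continuity_2d_pt_id2]).
    assert (K2' : continuity_2d_pt (fun _ th => Im (cauchy_kernel z th)) t th)
      by (apply (continuity_1d_2d_pt_comp (fun s => Im (cauchy_kernel z s)) (fun _ v => v));
          [exact K2|apply continuity_2d_pt_id2]).
    split; split.
    - apply (continuity_2d_pt_ext (fun t th => / t * Im (F (cone z t th)))).
      + intros u v. unfold P; simpl. unfold Re, Im. ring.
      + apply continuity_2d_pt_mult; assumption.
    - apply (continuity_2d_pt_ext (fun t th => - (/ t * Re (F (cone z t th))))).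
      + intros u v. unfold P; simpl. unfold Re, Im. ring.
      + apply continuity_2d_pt_opp, continuity_2d_pt_mult; assumption.
    - apply (continuity_2d_pt_minus
        (fun t th => Re (F (cone z t th)) * Re (cauchy_kernel z th))
        (fun t th => Im (F (cone z t th)) * Im (cauchy_kernel z th)));
      apply continuity_2d_pt_mult; assumption.
    - apply (continuity_2d_pt_plus
        (fun t th => Re (F (cone z t th)) * Im (cauchy_kernel z th))
        (fun t th => Im (F (cone z t th)) * Re (cauchy_kernel z th)));
      apply continuity_2d_pt_mult; assumption. }
  assert (Hper : forall t, P t 0 = P t (2 * PI)).
  { intros t. unfold P, cone, cis. rewrite cos_0, sin_0, cos_2PI, sin_2PI. reflexivity. }
  assert (L1 : loop_integral (fun t th => Re (P t th)) (fun t th => Re (Q t th)) e 1 0 (2 * PI) = 0).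
  { apply goursat_rect; try lra; try (intros t th Ht _; apply Hcont, Ht).
    intros t th Ht _. apply (cone_form_closed rho); try assumption. lra. }
  assert (L2 : loop_integral (fun t th => Im (P t th)) (fun t th => Im (Q t th)) e 1 0 (2 * PI) = 0).
  { apply goursat_rect; try lra; try (intros t th Ht _; apply Hcont, Ht).
    intros t th Ht _. apply (cone_form_closed rho); try assumption. lra. }
  unfold loop_integral in L1, L2.
  rewrite (RInt_ext (fun x => Re (P x 0)) (fun x => Re (P x (2 * PI)))) in L1
    by (intros x _; rewrite Hper; reflexivity).
  rewrite (RInt_ext (fun x => Im (P x 0)) (fun x => Im (P x (2 * PI)))) in L2
    by (intros x _; rewrite Hper; reflexivity).
  apply injective_projections; unfold circle_integral; simpl.
  - change (RInt (fun t => Re (Q 1 t)) 0 (2 * PI) = RInt (fun t => Re (Q e t)) 0 (2 * PI)). lra.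
  - change (RInt (fun t => Im (Q 1 t)) 0 (2 * PI) = RInt (fun t => Im (Q e t)) 0 (2 * PI)). lra.
Qed.

Lemma Cmod_small_eq (u v : C) :
  (forall eps : posreal, Cmod (u - v) <= eps) -> u = v.
Proof.
  intros H.
  assert (E : (u - v)%C = RtoC 0).
  { apply Cmod_eq_0. apply Rle_antisym; [|apply Cmod_ge_0].
    apply Rnot_lt_le. intros Hp.
    assert (Hp2 : 0 < Cmod (u - v) / 2) by lra.
    specialize (H (mkposreal _ Hp2)); simpl in H. lra. }
  replace u with (u - v + v)%C by ring. rewrite E. ring.
Qed.

(** On the shrunken circle F is uniformly close to F z, while the kernel does not change with [e].
    The integral of the kernel stays unevaluated: its value 2 pi is derived later from this very
    formula, applied to powers. *)
Lemma cauchy_formula (rho : R) (F : C -> C) (z : C) :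
  holomorphic_within rho F -> 1 < rho -> Cmod z < 1 ->
  circle_integral (fun th => (F (cis th) * cauchy_kernel z th)%C) =
  (F z * circle_integral (cauchy_kernel z))%C.
Proof.
  intros HF Hrho Hz. apply Cmod_small_eq. intros eps.
  assert (HPI := PI_RGT_0).
  destruct (HF z ltac:(lra)) as [l Hl].
  set (kappa := / (1 - Cmod z)).
  assert (Hkappa : 0 < kappa) by (apply Rinv_0_lt_compat; lra).
  assert (Heta : 0 < eps / (4 * PI * kappa)).
  { apply Rdiv_lt_0_compat; [apply cond_pos|]. nra. }
  destruct (C_diff_at_continuous F z l Hl (mkposreal _ Heta)) as [d Hd]; simpl in Hd.
  (* Cone points at parameter e lie within 2e <= d / 2 of z. *)
  pose (e := Rmin 1 (d / 4)).
  assert (He : 0 < e <= 1).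
  { unfold e; split; [apply Rmin_glb_lt; [lra|pose proof (cond_pos d); lra]|apply Rmin_l]. }
  rewrite (circle_integral_ext _ (fun th => F (cone z 1 th) * cauchy_kernel z th)%C).
  2: { intros t. f_equal. f_equal. unfold cone. ring. }
  rewrite (cauchy_homotopy rho F z e) by assumption.
  assert (HQ : continuous_path (fun th => F (cone z e th) * cauchy_kernel z th)%C)
    by (apply (continuous_path_cauchy_integrand rho); try assumption; lra).
  assert (HK := continuous_path_cauchy_kernel z Hz).
  assert (HFK : continuous_path (fun th => - F z * cauchy_kernel z th)%C).
  { apply (continuous_path_mult (fun _ => - F z)%C); [apply continuous_path_const|exact HK]. }
  replace (_ - _)%C with (circle_integral (fun th =>
    (F (cone z e th) * cauchy_kernel z th) + - F z * cauchy_kernel z th)%C).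
  2: { rewrite circle_integral_plus by assumption.
       rewrite circle_integral_scal by assumption. ring. }
  eapply Rle_trans.
  - apply (circle_integral_bound _ (eps / (4 * PI * kappa) * kappa)).
    + apply continuous_path_plus; assumption.
    + intros th _.
      replace (_ + _)%C with ((F (cone z e th) - F z) * cauchy_kernel z th)%C by ring.
      rewrite Cmod_mult. apply Rmult_le_compat; try apply Cmod_ge_0.
      * left. apply Hd. unfold cone.
        replace (_ - _)%C with (RtoC e * (cis th - z))%C by ring.
        rewrite Cmod_mult, Cmod_R, Rabs_pos_eq by lra.
        assert (Cmod (cis th - z) <= 2).
        { eapply Rle_trans; [apply Cmod_triangle|]. rewrite Cmod_cis, Cmod_opp. lra. }
        assert (e <= d / 4) by apply Rmin_r. pose proof (cond_pos d).
        pose proof (Cmod_ge_0 (cis th - z)). nra.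
      * apply cauchy_kernel_bound, Hz.
  - right. field. split; lra.
Qed.

(** * Expansion of the Cauchy integral in powers of z *)

Lemma cis_conj (th : R) : (cis th * Cconj (cis th) = 1)%C.
Proof. rewrite <- Cmod2_conj, Cmod_cis. simpl. f_equal. ring. Qed.

(** One step of the geometric series for w / (w - z), with 1 / w written as the conjugate of w;
    iterating it produces the Taylor polynomial with an explicit remainder. *)
Lemma cauchy_kernel_geometric (z : C) (th : R) :
  Cmod z < 1 ->
  cauchy_kernel z th = (1 + z * Cconj (cis th) * cauchy_kernel z th)%C.
Proof.
  intros Hz. assert (Hn := cis_minus_neq_0 z th Hz). assert (Hc := cis_conj th).
  unfold cauchy_kernel.
  replace (z * Cconj (cis th) * (cis th / (cis th - z)))%C
    with ((cis th * Cconj (cis th)) * (z / (cis th - z)))%C by (field; assumption).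
  rewrite Hc. field. assumption.
Qed.

(** The index stops at N - 1, so that the remainder after this sum carries exactly the factor
    z^N. *)
Fixpoint Csum (a : nat -> C) (N : nat) : C :=
  match N with
  | O => RtoC 0
  | S n => (Csum a n + a n)%C
  end.

(** For boundary values of a holomorphic function this is 2 pi times its n-th Taylor coefficient. *)
Definition fourier_coef (G : R -> C) (n : nat) : C :=
  circle_integral (fun th => (G th * Cconj (cis th) ^ n)%C).

Lemma continuous_path_fourier (G : R -> C) (n : nat) :
  continuous_path G -> continuous_path (fun th => (G th * Cconj (cis th) ^ n)%C).
Proof.
  intros HG. apply (continuous_path_mult G); [exact HG|].
  apply (continuous_path_pow (fun th => Cconj (cis th))).
  apply (continuous_path_conj cis), continuous_path_cis.
Qed.

Lemma cauchy_expansion (G : R -> C) (z : C) (N : nat) :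
  continuous_path G -> Cmod z < 1 ->
  circle_integral (fun th => (G th * cauchy_kernel z th)%C) =
  (Csum (fun n => fourier_coef G n * z ^ n) N +
   z ^ N * circle_integral (fun th =>
     G th * Cconj (cis th) ^ N * cauchy_kernel z th))%C.
Proof.
  intros HG Hz. induction N as [|N IH].
  - simpl Csum. rewrite (circle_integral_ext (fun th => G th * Cconj (cis th) ^ 0 * cauchy_kernel z th)%C
      (fun th => G th * cauchy_kernel z th)%C); [simpl; ring|].
    intros t; simpl; ring.
  - rewrite IH. simpl Csum. rewrite <- Cplus_assoc. f_equal.
    rewrite (circle_integral_ext (fun th => G th * Cconj (cis th) ^ N * cauchy_kernel z th)%C
      (fun th => G th * Cconj (cis th) ^ N +
                 z * (G th * Cconj (cis th) ^ S N * cauchy_kernel z th))%C).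
    + assert (HK := continuous_path_cauchy_kernel z Hz).
      assert (H1 := continuous_path_fourier G N HG).
      assert (H2 : continuous_path (fun th => G th * Cconj (cis th) ^ S N * cauchy_kernel z th)%C).
      { apply (continuous_path_mult (fun th => G th * Cconj (cis th) ^ S N)%C); [|exact HK].
        apply continuous_path_fourier, HG. }
      rewrite circle_integral_plus; [|exact H1|].
      * rewrite circle_integral_scal by exact H2. unfold fourier_coef. rewrite Cpow_S. ring.
      * apply (continuous_path_mult (fun _ => z)); [apply continuous_path_const|exact H2].
    + intros t. rewrite (cauchy_kernel_geometric z t Hz) at 1. rewrite Cpow_S. ring.
Qed.

Lemma cauchy_remainder_bound (G : R -> C) (z : C) (N : nat) (M : R) :
  continuous_path G -> Cmod z < 1 -> (forall th, 0 <= th <= 2 * PI -> Cmod (G th) <= M) ->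
  Cmod (circle_integral (fun th => (G th * cauchy_kernel z th)%C) -
        Csum (fun n => fourier_coef G n * z ^ n)%C N) <=
  4 * PI * (M / (1 - Cmod z)) * Cmod z ^ N.
Proof.
  intros HG Hz HM. rewrite (cauchy_expansion G z N HG Hz).
  replace (_ - _)%C with (z ^ N * circle_integral (fun th =>
     G th * Cconj (cis th) ^ N * cauchy_kernel z th))%C by ring.
  rewrite Cmod_mult, Cmod_pow, Rmult_comm.
  apply Rmult_le_compat_r; [apply pow_le, Cmod_ge_0|].
  apply circle_integral_bound.
  - apply (continuous_path_mult (fun th => G th * Cconj (cis th) ^ N)%C);
      [apply continuous_path_fourier, HG|apply continuous_path_cauchy_kernel, Hz].
  - intros th Hth. rewrite !Cmod_mult, Cmod_pow, Cmod_conj, Cmod_cis, pow1, Rmult_1_r.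
    apply Rmult_le_compat; try apply Cmod_ge_0; [apply HM, Hth|apply cauchy_kernel_bound, Hz].
Qed.

(** * Rules for complex derivatives *)

Lemma C_diff_at_const (c z : C) : C_diff_at (fun _ => c) z (RtoC 0).
Proof.
  apply C_diff_at_is_derive, (is_derive_const (K := C_AbsRing) (V := AbsRing_NormedModule C_AbsRing)).
Qed.

Lemma C_diff_at_id (z : C) : C_diff_at (fun w => w) z (RtoC 1).
Proof. apply C_diff_at_is_derive, (is_derive_id (K := C_AbsRing)). Qed.

Lemma C_diff_at_plus (f g : C -> C) (z l m : C) :
  C_diff_at f z l -> C_diff_at g z m ->
  C_diff_at (fun w => (f w + g w)%C) z (l + m)%C.
Proof.
  rewrite !C_diff_at_is_derive.
  apply (is_derive_plus (K := C_AbsRing) (V := AbsRing_NormedModule C_AbsRing)).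
Qed.

Lemma C_diff_at_mult (f g : C -> C) (z l m : C) :
  C_diff_at f z l -> C_diff_at g z m ->
  C_diff_at (fun w => (f w * g w)%C) z (l * g z + f z * m)%C.
Proof.
  rewrite !C_diff_at_is_derive. intros Hf Hg.
  apply (is_derive_mult (K := C_AbsRing) f g z l m Hf Hg Cmult_comm).
Qed.

Lemma C_diff_at_comp (f g : C -> C) (z l m : C) :
  C_diff_at f (g z) l -> C_diff_at g z m ->
  C_diff_at (fun w => f (g w)) z (m * l)%C.
Proof.
  rewrite !C_diff_at_is_derive. intros Hf Hg.
  apply (is_derive_comp (K := C_AbsRing) (V := AbsRing_NormedModule C_AbsRing) f g z l m Hf Hg).
Qed.

Lemma C_diff_at_inv (z : C) : z <> RtoC 0 -> C_diff_at Cinv z (- / (z * z))%C.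
Proof.
  intros Hz eps.
  assert (Hp : 0 < Cmod z) by (apply Cmod_gt_0; exact Hz).
  (* The remainder is (w - z)^2 / (z^2 w). The first bound gives |w| > |z| / 2, and then the second
     gives |w - z| <= eps |z|^2 |w|. *)
  assert (Hd : 0 < Rmin (Cmod z / 2) (eps * (Cmod z * Cmod z * Cmod z) / 2)).
  { pose proof (cond_pos eps). apply Rmin_glb_lt; [lra|].
    repeat apply Rmult_lt_0_compat; lra. }
  exists (mkposreal _ Hd); simpl. intros w Hw.
  assert (H1 : Cmod (w - z) < Cmod z / 2) by (eapply Rlt_le_trans; [exact Hw|apply Rmin_l]).
  assert (H2 : Cmod (w - z) < eps * (Cmod z * Cmod z * Cmod z) / 2)
    by (eapply Rlt_le_trans; [exact Hw|apply Rmin_r]).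
  assert (Hw0 : Cmod z / 2 < Cmod w).
  { pose proof (Cmod_triangle w (z - w)) as T.
    replace (w + (z - w))%C with z in T by ring.
    replace (z - w)%C with (- (w - z))%C in T by ring. rewrite Cmod_opp in T. lra. }
  assert (Hwn : w <> RtoC 0) by (apply Cmod_gt_0; lra).
  replace (_ - _ - _)%C with ((w - z) * (w - z) / (z * z * w))%C
    by (field; split; assumption).
  rewrite Cmod_div by (repeat apply Cmult_neq_0; assumption).
  rewrite !Cmod_mult.
  pose proof (Cmod_ge_0 (w - z)).
  apply Rle_div_l; [repeat apply Rmult_lt_0_compat; lra|].
  set (a := Cmod z) in *. set (b := Cmod w) in *. set (d := Cmod (w - z)) in *.
  rewrite (Rmult_comm eps), !Rmult_assoc. apply Rmult_le_compat_l; [assumption|].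
  assert (eps * (a * a) * (a / 2) <= eps * (a * a) * b).
  { apply Rmult_le_compat_l; [|lra]. pose proof (cond_pos eps). repeat apply Rmult_le_pos; lra. }
  lra.
Qed.

Lemma holomorphic_within_mult (rho : R) (f g : C -> C) :
  holomorphic_within rho f -> holomorphic_within rho g ->
  holomorphic_within rho (fun w => (f w * g w)%C).
Proof.
  intros Hf Hg z Hz. destruct (Hf z Hz) as [l Hl], (Hg z Hz) as [m Hm].
  eexists. apply C_diff_at_mult; eassumption.
Qed.

Lemma holomorphic_within_pow (rho : R) (n : nat) :
  holomorphic_within rho (fun w => (w ^ n)%C).
Proof.
  induction n as [|n IH].
  - intros z _. exists (RtoC 0). exact (C_diff_at_const (RtoC 1) z).
  - apply (holomorphic_within_mult rho (fun w => w)); [|exact IH].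
    intros z _. exists (RtoC 1). apply C_diff_at_id.
Qed.

(** * Mean values and the one-sided coefficient estimate *)

Lemma mean_value (rho : R) (F : C -> C) :
  holomorphic_within rho F -> 1 < rho ->
  circle_integral (fun th => F (cis th)) = (RtoC (2 * PI) * F (RtoC 0))%C.
Proof.
  intros HF Hrho.
  assert (H0 : Cmod (RtoC 0) < 1) by (rewrite Cmod_0; lra).
  assert (HK : forall th, cauchy_kernel (RtoC 0) th = RtoC 1).
  { intros th. rewrite cauchy_kernel_geometric by exact H0. ring. }
  assert (E := cauchy_formula rho F (RtoC 0) HF Hrho H0).
  rewrite (circle_integral_ext _ (fun th => F (cis th))) in E
    by (intros t; rewrite HK; ring).
  rewrite (circle_integral_ext (cauchy_kernel (RtoC 0)) (fun _ => RtoC 1)) in E by exact HK.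
  rewrite E, circle_integral_const. ring.
Qed.

Lemma circle_integral_conj (g : R -> C) :
  continuous_path g ->
  circle_integral (fun t => Cconj (g t)) = Cconj (circle_integral g).
Proof.
  intros Hg. destruct (continuous_path_ex_RInt g 0 (2 * PI) Hg) as [_ H2].
  apply injective_projections; simpl; [reflexivity|].
  exact (RInt_opp (V := R_CompleteNormedModule) _ _ _ H2).
Qed.

Lemma C0_pow (n : nat) : (1 <= n)%nat -> (RtoC 0 ^ n)%C = RtoC 0.
Proof. intros H. destruct n as [|n]; [lia|]. simpl. ring. Qed.

Lemma circle_integral_conj_cis_pow (n : nat) :
  (1 <= n)%nat -> circle_integral (fun th => (Cconj (cis th) ^ n)%C) = RtoC 0.
Proof.
  intros Hn.
  rewrite (circle_integral_ext _ (fun th => Cconj (cis th ^ n)))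
    by (intros t; symmetry; apply Cpow_conj).
  rewrite (circle_integral_conj (fun th => (cis th ^ n)%C))
    by (apply (continuous_path_pow cis), continuous_path_cis).
  rewrite (mean_value 2 (fun w => (w ^ n)%C) (holomorphic_within_pow 2 n)) by lra.
  rewrite C0_pow by exact Hn. apply injective_projections; simpl; ring.
Qed.

Lemma pow_lt_eps (x K : R) (eps : posreal) :
  0 <= x < 1 -> exists N, forall n, (N <= n)%nat -> K * x ^ n < eps.
Proof.
  intros Hx.
  assert (He : 0 < eps / (Rabs K + 1)).
  { apply Rdiv_lt_0_compat; [apply cond_pos|]. pose proof (Rabs_pos K); lra. }
  destruct (pow_lt_1_zero x) with (y := eps / (Rabs K + 1)) as [N HN];
    [rewrite Rabs_pos_eq; lra|exact He|].
  exists N. intros n Hn. specialize (HN n Hn).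
  assert (Hp : 0 <= x ^ n) by (apply pow_le; lra).
  rewrite Rabs_pos_eq in HN by exact Hp.
  apply Rlt_div_r in HN; [|pose proof (Rabs_pos K); lra].
  pose proof (Rle_abs K). nra.
Qed.

(** In the expansion for the constant function 1 only the coefficient of index 0 is nonzero, and the
    remainder tends to 0. *)
Lemma circle_integral_cauchy_kernel (z : C) :
  Cmod z < 1 -> circle_integral (cauchy_kernel z) = RtoC (2 * PI).
Proof.
  intros Hz. apply Cmod_small_eq. intros eps.
  set (one := fun _ : R => RtoC 1).
  destruct (pow_lt_eps (Cmod z) (4 * PI * (1 / (1 - Cmod z))) eps) as [N HN].
  { split; [apply Cmod_ge_0|exact Hz]. }
  assert (B := cauchy_remainder_bound one z (S N) 1 (continuous_path_const _) Hz).
  assert (E : Csum (fun n => fourier_coef one n * z ^ n)%C (S N) = RtoC (2 * PI)).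
  { clear. induction N as [|N IH].
    - simpl. unfold fourier_coef, one.
      rewrite (circle_integral_ext _ (fun _ => RtoC 1)) by (intros t; simpl; ring).
      rewrite circle_integral_const. ring.
    - change (Csum (fun n => fourier_coef one n * z ^ n)%C (S N) +
        fourier_coef one (S N) * z ^ S N = RtoC (2 * PI))%C.
      rewrite IH. unfold fourier_coef, one.
      rewrite (circle_integral_ext _ (fun th => Cconj (cis th) ^ S N)%C)
        by (intros t; ring).
      rewrite circle_integral_conj_cis_pow by lia. ring. }
  rewrite E in B.
  rewrite (circle_integral_ext _ (cauchy_kernel z)) in B by (intros t; unfold one; ring).
  left. eapply Rle_lt_trans; [apply B|apply HN; lia].
  intros th _. unfold one. rewrite Cmod_1. lra.
Qed.

Lemma continuous_path_bounded (g : R -> C) :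
  continuous_path g ->
  exists M, 0 <= M /\ forall t, 0 <= t <= 2 * PI -> Cmod (g t) <= M.
Proof.
  intros Hg. assert (HPI := PI_RGT_0).
  destruct (continuity_ab_maj (fun t => Re (g t * Cconj (g t))%C) 0 (2 * PI)) as [tm [Hm _]].
  - lra.
  - intros t _. apply (continuous_path_mult g (fun t => Cconj (g t))); [exact Hg|].
    apply continuous_path_conj, Hg.
  (* Maximising |g|^2 keeps to polynomial expressions; x^2 <= y^2 gives x <= 1 + y^2. *)
  - exists (1 + Cmod (g tm) ^ 2). split.
    { pose proof (pow2_ge_0 (Cmod (g tm))). lra. }
    intros t Ht. specialize (Hm t Ht). cbv beta in Hm.
    rewrite <- !Cmod2_conj in Hm. change (Cmod (g t) ^ 2 <= Cmod (g tm) ^ 2) in Hm.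
    pose proof (Cmod_ge_0 (g t)). nra.
Qed.

(** The bound is by the integral of the weight, not by its supremum. The weight will be 1 - Re F,
    whose integral the mean value property evaluates; this is what makes a one-sided bound on Re F
    sufficient. *)
Lemma circle_integral_weighted_bound (p : R -> R) (h : R -> C) :
  (forall t, continuity_pt p t) -> continuous_path h ->
  (forall t, 0 <= t <= 2 * PI -> 0 <= p t) -> (forall t, Cmod (h t) <= 1) ->
  Cmod (circle_integral (fun t => (RtoC (p t) * h t)%C)) <= 2 * RInt p 0 (2 * PI).
Proof.
  intros Hp Hh Hpos Hb. assert (HPI := PI_RGT_0).
  assert (Hpath : continuous_path (fun t => RtoC (p t))).
  { intros t. split; [exact (Hp t)|]. apply continuity_pt_const. intros u v; reflexivity. }
  assert (Hpr : ex_RInt p 0 (2 * PI)) by apply (continuous_path_ex_RInt _ 0 (2 * PI) Hpath).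
  destruct (continuous_path_ex_RInt _ 0 (2 * PI) (continuous_path_mult _ _ Hpath Hh)) as [H1 H2].
  eapply Rle_trans; [apply Cmod_le_abs_sum|]. simpl.
  assert (Hbd : forall q, (forall t, 0 <= t <= 2 * PI -> Rabs (q t) <= p t) ->
     ex_RInt q 0 (2 * PI) -> Rabs (RInt q 0 (2 * PI)) <= RInt p 0 (2 * PI)).
  { intros q Hq Hqi. apply Rabs_le. split.
    - assert (E := RInt_opp (V := R_CompleteNormedModule) p 0 (2 * PI) Hpr).
      change (RInt (fun t => - p t) 0 (2 * PI) = - RInt p 0 (2 * PI)) in E. rewrite <- E.
      apply RInt_le; [lra| |exact Hqi|].
      + exact (ex_RInt_opp (V := R_NormedModule) p _ _ Hpr).
      + intros t Ht. specialize (Hq t ltac:(lra)). apply Rabs_le_between in Hq. lra.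
    - apply RInt_le; [lra|exact Hqi|exact Hpr|].
      intros t Ht. specialize (Hq t ltac:(lra)). apply Rabs_le_between in Hq. lra. }
  assert (Hmod : forall t, 0 <= t <= 2 * PI -> Cmod (RtoC (p t) * h t) <= p t).
  { intros t Ht. rewrite Cmod_mult, Cmod_R, Rabs_pos_eq by (apply Hpos, Ht).
    specialize (Hpos t Ht). specialize (Hb t). pose proof (Cmod_ge_0 (h t)). nra. }
  assert (B1 := Hbd _ (fun t Ht => Rle_trans _ _ _ (re_le_Cmod _) (Hmod t Ht)) H1).
  assert (B2 := Hbd _ (fun t Ht => Rle_trans _ _ _ (im_le_Cmod _) (Hmod t Ht)) H2).
  simpl in B1, B2. lra.
Qed.

(** A Borel-Caratheodory type estimate. In the constant 4, one factor 2 comes from replacing F by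
    twice its real part and the other from [circle_integral_weighted_bound]. As rho > 1, the unit
    circle is inside the domain. *)
Lemma taylor_expansion (rho : R) (F : C -> C) :
  holomorphic_within rho F -> 1 < rho -> (forall z, Cmod z < rho -> Re (F z) <= 1) ->
  exists c : nat -> C,
    c 0%nat = F (RtoC 0) /\
    (forall n, (1 <= n)%nat -> Cmod (c n) <= 4 * (1 - Re (F (RtoC 0)))) /\
    exists M, 0 <= M /\ forall z N, Cmod z < 1 ->
      Cmod (F z - Csum (fun n => c n * z ^ n)%C N) <= M / (1 - Cmod z) * Cmod z ^ N.
Proof.
  intros HF Hrho Hre. assert (HPI := PI_RGT_0).
  assert (HPIc : RtoC (2 * PI) <> RtoC 0) by (intros E; apply RtoC_inj in E; lra).
  set (G := fun th => F (cis th)).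
  assert (HG : continuous_path G).
  { apply (continuous_path_holomorphic rho); [exact HF|apply continuous_path_cis|].
    intros t; rewrite Cmod_cis; exact Hrho. }
  exists (fun n => (fourier_coef G n / RtoC (2 * PI))%C).
  split; [|split].
  - unfold fourier_coef.
    rewrite (circle_integral_ext _ (fun th => F (cis th))) by (intros t; unfold G; simpl; ring).
    rewrite (mean_value rho F HF Hrho). field. exact HPIc.
  - intros n Hn.
    set (H := fun th => (Cconj (cis th) ^ n)%C).
    assert (HH : continuous_path H).
    { apply (continuous_path_pow (fun th => Cconj (cis th))).
      apply (continuous_path_conj cis), continuous_path_cis. }
    assert (HC : continuous_path (fun th => Cconj (G th * cis th ^ n)%C)).
    { apply (continuous_path_conj (fun th => G th * cis th ^ n)%C).
      apply (continuous_path_mult G); [exact HG|].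
      apply (continuous_path_pow cis), continuous_path_cis. }
    assert (E0 : circle_integral (fun th => Cconj (G th * cis th ^ n)%C) = RtoC 0).
    { rewrite (circle_integral_conj (fun th => G th * cis th ^ n)%C).
      - unfold G. rewrite (mean_value rho (fun w => F w * w ^ n)%C).
        + rewrite C0_pow by exact Hn. apply injective_projections; simpl; ring.
        + apply holomorphic_within_mult; [exact HF|apply holomorphic_within_pow].
        + exact Hrho.
      - apply (continuous_path_mult G); [exact HG|].
        apply (continuous_path_pow cis), continuous_path_cis. }
    set (p := fun th => 1 - Re (G th)).
    assert (Hp : forall t, continuity_pt p t).
    { intros t. apply (continuity_pt_minus (fun _ => 1) (fun th => Re (G th))).
      - apply continuity_pt_const. intros u v; reflexivity.
      - apply HG. }
    assert (Hpath : continuous_path (fun t => RtoC (p t) * H t)%C).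
    { apply (continuous_path_mult (fun t => RtoC (p t))); [|exact HH].
      intros t. split; [exact (Hp t)|]. apply continuity_pt_const. intros u v; reflexivity. }
    (* Adding the integrals of conj(G w^n) and of -2 conj(w)^n changes nothing, as both vanish for n
       >= 1. The integrand becomes (G + conj G - 2) conj(w)^n, that is -2 (1 - Re G) conj(w)^n. *)
    assert (E : fourier_coef G n =
      (RtoC (- 2) * circle_integral (fun t => RtoC (p t) * H t))%C).
    { transitivity (fourier_coef G n + circle_integral (fun th => Cconj (G th * cis th ^ n)%C)
         + RtoC (- 2) * circle_integral H)%C.
      - rewrite E0. unfold H. rewrite circle_integral_conj_cis_pow by exact Hn. ring.
      - unfold fourier_coef. rewrite <- circle_integral_plus;
          [|apply continuous_path_fourier, HG|exact HC].
        rewrite <- !circle_integral_scal by assumption.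
        rewrite <- circle_integral_plus.
        + apply circle_integral_ext. intros t. unfold H, p.
          rewrite Cmult_conj, Cpow_conj.
          apply injective_projections; simpl; unfold Re, Im; ring.
        + apply (continuous_path_plus (fun th => G th * Cconj (cis th) ^ n)%C);
            [apply continuous_path_fourier, HG|exact HC].
        + apply (continuous_path_mult (fun _ => RtoC (- 2)));
            [apply continuous_path_const|exact HH]. }
    rewrite E, Cmod_div by exact HPIc.
    rewrite Cmod_mult, !Cmod_R, (Rabs_left (- 2)), (Rabs_pos_eq (2 * PI)) by lra.
    assert (B : Cmod (circle_integral (fun t => RtoC (p t) * H t)%C) <= 2 * RInt p 0 (2 * PI)).
    { apply circle_integral_weighted_bound; try assumption.
      - intros t _. unfold p, G. specialize (Hre (cis t)). rewrite Cmod_cis in Hre.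
        specialize (Hre Hrho). lra.
      - intros t. unfold H. rewrite Cmod_pow, Cmod_conj, Cmod_cis, pow1. lra. }
    assert (Ep : RInt p 0 (2 * PI) = 2 * PI * (1 - Re (F (RtoC 0)))).
    { assert (Em := mean_value rho F HF Hrho). apply (f_equal Re) in Em.
      unfold circle_integral in Em. simpl in Em.
      destruct (continuous_path_ex_RInt G 0 (2 * PI) HG) as [H1 _].
      apply (is_RInt_unique (V := R_CompleteNormedModule)).
      replace (2 * PI * (1 - Re (F (RtoC 0)))) with
        ((2 * PI - 0) * 1 - RInt (fun t => Re (G t)) 0 (2 * PI)).
      - apply (is_RInt_minus (V := R_NormedModule) (fun _ => 1) (fun th => Re (G th))).
        + apply (is_RInt_const (V := R_NormedModule)).
        + apply (RInt_correct (V := R_CompleteNormedModule)), H1.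
      - unfold G. rewrite Em. unfold Re. ring. }
    rewrite Ep in B. apply Rle_div_l; [lra|]. lra.
  - destruct (continuous_path_bounded G HG) as [M [HM0 HM]].
    (* The 4 pi M of the remainder bound divided by the 2 pi of the normalisation. *)
    exists (2 * M). split; [lra|]. intros z N Hz.
    assert (B := cauchy_remainder_bound G z N M HG Hz HM).
    unfold G at 1 in B. rewrite (cauchy_formula rho F z HF Hrho Hz) in B.
    rewrite circle_integral_cauchy_kernel in B by exact Hz.
    assert (Es : Csum (fun n => fourier_coef G n * z ^ n)%C N =
      (RtoC (2 * PI) * Csum (fun n => fourier_coef G n / RtoC (2 * PI) * z ^ n) N)%C).
    { clear - HPIc. induction N as [|N IH]; simpl; [ring|].
      rewrite IH. field. exact HPIc. }
    rewrite Es in B.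
    replace (_ - _)%C with (RtoC (2 * PI) *
      (F z - Csum (fun n => fourier_coef G n / RtoC (2 * PI) * z ^ n) N))%C in B by ring.
    rewrite Cmod_mult, Cmod_R, Rabs_pos_eq in B by lra.
    apply (Rmult_le_reg_l (2 * PI)); [lra|]. eapply Rle_trans; [exact B|].
    right. field. lra.
Qed.

(** * Complex power series *)

Definition C_sums (a : nat -> C) (s : C) : Prop :=
  forall eps : posreal, exists N0, forall N, (N0 <= N)%nat -> Cmod (Csum a N - s) < eps.

Fixpoint Rsum (a : nat -> R) (N : nat) : R :=
  match N with
  | O => 0
  | S n => Rsum a n + a n
  end.

Lemma Cmod_Csum_le (a : nat -> C) (b : nat -> R) (N : nat) :
  (forall n, (n < N)%nat -> Cmod (a n) <= b n) -> Cmod (Csum a N) <= Rsum b N.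
Proof.
  induction N as [|N IH]; intros H; simpl.
  - rewrite Cmod_0; lra.
  - eapply Rle_trans; [apply Cmod_triangle|].
    apply Rplus_le_compat; [apply IH; intros n Hn; apply H; lia|apply H; lia].
Qed.

Lemma sum_n_Rsum (a : nat -> R) (N : nat) : sum_n a N = Rsum a (S N).
Proof.
  induction N as [|N IH].
  - rewrite sum_O. simpl. ring.
  - rewrite sum_Sn, IH. reflexivity.
Qed.

Lemma Rsum_le_Series (a : nat -> R) (N : nat) :
  (forall n, 0 <= a n) -> ex_series a -> Rsum a N <= Series a.
Proof.
  intros Ha Hex.
  apply Rle_trans with (Rsum a (S N)); [simpl; specialize (Ha N); lra|].
  rewrite <- sum_n_Rsum.
  apply (is_lim_seq_incr_compare (sum_n a) (Series a)).
  - exact (Series_correct a Hex).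
  - intros n. rewrite sum_Sn. specialize (Ha (S n)). unfold plus; simpl. lra.
Qed.

Lemma Csum_parts (a : nat -> C) (N : nat) :
  Csum a N = (Rsum (fun n => Re (a n)) N, Rsum (fun n => Im (a n)) N).
Proof.
  induction N as [|N IH]; simpl; [reflexivity|]. rewrite IH. reflexivity.
Qed.

Lemma ex_series_Rsum_lim (a : nat -> R) (eps : posreal) :
  ex_series a -> exists N0, forall N, (N0 <= N)%nat -> Rabs (Rsum a N - Series a) < eps.
Proof.
  intros Hex. assert (H := Series_correct a Hex).
  change (is_lim_seq (sum_n a) (Series a)) in H.
  apply is_lim_seq_spec in H. destruct (H eps) as [N0 HN].
  exists (S N0). intros [|N] HNN; [lia|].
  rewrite <- sum_n_Rsum. apply HN. lia.
Qed.

(** [Series] is total, so this has a meaning only where [C_series_sums] applies. *)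
Definition C_series (a : nat -> C) : C :=
  (Series (fun n => Re (a n)), Series (fun n => Im (a n))).

Lemma C_series_sums (a : nat -> C) :
  ex_series (fun n => Cmod (a n)) -> C_sums a (C_series a).
Proof.
  intros Hex eps.
  assert (H1 : ex_series (fun n => Re (a n))).
  { apply (ex_series_le (K := R_AbsRing) (V := R_CompleteNormedModule) _ (fun n => Cmod (a n)));
      [|exact Hex]. intros n; apply re_le_Cmod. }
  assert (H2 : ex_series (fun n => Im (a n))).
  { apply (ex_series_le (K := R_AbsRing) (V := R_CompleteNormedModule) _ (fun n => Cmod (a n)));
      [|exact Hex]. intros n; apply im_le_Cmod. }
  assert (He : 0 < eps / 2) by (pose proof (cond_pos eps); lra).
  destruct (ex_series_Rsum_lim _ (mkposreal _ He) H1) as [N1 HN1].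
  destruct (ex_series_Rsum_lim _ (mkposreal _ He) H2) as [N2 HN2]. simpl in HN1, HN2.
  exists (max N1 N2). intros N HN.
  specialize (HN1 N ltac:(lia)). specialize (HN2 N ltac:(lia)).
  eapply Rle_lt_trans; [apply Cmod_le_abs_sum|].
  rewrite Csum_parts. unfold C_series. simpl. unfold Rminus in HN1, HN2. lra.
Qed.

Lemma C_sums_bound (a : nat -> C) (s u : C) (B : R) (N0 : nat) :
  C_sums a s -> (forall N, (N0 <= N)%nat -> Cmod (Csum a N - u) <= B) -> Cmod (s - u) <= B.
Proof.
  intros H HB. apply Rnot_lt_le. intros Hlt.
  assert (He : 0 < Cmod (s - u) - B) by lra.
  destruct (H (mkposreal _ He)) as [N HN]; simpl in HN.
  specialize (HN (max N0 N) ltac:(lia)). specialize (HB (max N0 N) ltac:(lia)).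
  replace (s - u)%C with ((Csum a (max N0 N) - u) + - (Csum a (max N0 N) - s))%C in HN, Hlt by ring.
  pose proof (Cmod_triangle (Csum a (max N0 N) - u) (- (Csum a (max N0 N) - s))) as T.
  rewrite Cmod_opp in T. lra.
Qed.

Lemma C_sums_unique (a : nat -> C) (s s' : C) : C_sums a s -> C_sums a s' -> s = s'.
Proof.
  intros H H'. apply Cmod_small_eq. intros eps.
  destruct (H' eps) as [N0 HN].
  apply (C_sums_bound a s s' eps N0 H). intros N HNN. left. apply HN, HNN.
Qed.

Lemma pow_difference_bound (z w : C) (r : R) (n : nat) :
  Cmod z <= r -> Cmod w <= r ->
  Cmod (w ^ n - z ^ n) <= INR n * r ^ pred n * Cmod (w - z).
Proof.
  intros Hz Hw. induction n as [|n IH].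
  - simpl. replace (1 - 1)%C with (RtoC 0) by ring. rewrite Cmod_0. lra.
  - replace (w ^ S n - z ^ S n)%C with (w * (w ^ n - z ^ n) + z ^ n * (w - z))%C
      by (simpl; ring).
    eapply Rle_trans; [apply Cmod_triangle|]. rewrite !Cmod_mult, Cmod_pow, S_INR.
    pose proof (Cmod_ge_0 (w - z)). pose proof (Cmod_ge_0 z). pose proof (Cmod_ge_0 w).
    assert (Cmod z ^ n <= r ^ n) by (apply pow_incr; lra).
    assert (K1 : Cmod w * Cmod (w ^ n - z ^ n) <= r * (INR n * r ^ pred n * Cmod (w - z))).
    { apply Rmult_le_compat; try apply Cmod_ge_0; assumption. }
    assert (K2 : Cmod z ^ n * Cmod (w - z) <= r ^ n * Cmod (w - z))
      by (apply Rmult_le_compat_r; assumption).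
    assert (E : r * (INR n * r ^ pred n) = INR n * r ^ n).
    { destruct n as [|n]; simpl; ring. }
    simpl pred.
    replace (r * (INR n * r ^ pred n * Cmod (w - z))) with (INR n * r ^ n * Cmod (w - z)) in K1
      by (rewrite <- E; ring).
    lra.
Qed.

(** The remainder of order n + 2 is (w^(n+1) - z^(n+1)) (w - z) plus z times the previous remainder.
    The usual factor 1/2 is given up, so that the bounds are exactly the coefficients of the twice
    derived series. *)
Lemma pow_taylor_bound (z w : C) (r : R) (n : nat) :
  Cmod z <= r -> Cmod w <= r ->
  Cmod (w ^ S n - z ^ S n - RtoC (INR (S n)) * z ^ n * (w - z)) <=
    INR (S n) * INR n * r ^ pred n * (Cmod (w - z) * Cmod (w - z)).
Proof.
  intros Hz Hw. pose proof (Cmod_ge_0 (w - z)). pose proof (Cmod_ge_0 z).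
  induction n as [|n IH].
  - replace (_ - _ - _)%C with (RtoC 0) by (simpl; ring). rewrite Cmod_0. simpl. lra.
  - replace (w ^ S (S n) - z ^ S (S n) - RtoC (INR (S (S n))) * z ^ S n * (w - z))%C
      with (w ^ S n * (w - z) - z ^ S n * (w - z) +
        z * (w ^ S n - z ^ S n - RtoC (INR (S n)) * z ^ n * (w - z)))%C
      by (rewrite (S_INR (S n)), RtoC_plus; simpl; ring).
    eapply Rle_trans; [apply Cmod_triangle|].
    replace (w ^ S n * (w - z) - z ^ S n * (w - z))%C with ((w ^ S n - z ^ S n) * (w - z))%C by ring.
    rewrite !Cmod_mult.
    assert (B := pow_difference_bound z w r (S n) Hz Hw). simpl pred in *.
    assert (K1 : Cmod (w ^ S n - z ^ S n) * Cmod (w - z) <=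
      INR (S n) * r ^ n * Cmod (w - z) * Cmod (w - z)) by (apply Rmult_le_compat_r; assumption).
    assert (K2 := Rmult_le_compat _ _ _ _ (Cmod_ge_0 z) (Cmod_ge_0 _) Hz IH).
    assert (E : r * (INR n * r ^ pred n) = INR n * r ^ n).
    { destruct n as [|n]; simpl; ring. }
    replace (r * (INR (S n) * INR n * r ^ pred n * (Cmod (w - z) * Cmod (w - z))))
      with (INR (S n) * (INR n * r ^ n) * (Cmod (w - z) * Cmod (w - z))) in K2
      by (rewrite <- E; ring).
    assert (Hr : 0 <= r ^ n * (Cmod (w - z) * Cmod (w - z))).
    { apply Rmult_le_pos; [apply pow_le; lra|]. apply Rmult_le_pos; assumption. }
    assert (Hn1 := pos_INR n). rewrite !S_INR in *.
    nra.
Qed.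

Definition unit_radius (c : nat -> C) : Prop :=
  forall r, 0 <= r < 1 -> ex_series (fun n => Cmod (c n) * r ^ n).

Definition power_series (c : nat -> C) (z : C) : C := C_series (fun n => c n * z ^ n)%C.

Definition coef_derive (c : nat -> C) (n : nat) : C := (RtoC (INR (S n)) * c (S n))%C.

Lemma bounded_unit_radius (c : nat -> C) (M : R) :
  (forall n, Cmod (c n) <= M) -> unit_radius c.
Proof.
  intros HM r Hr.
  apply (ex_series_le (K := R_AbsRing) (V := R_CompleteNormedModule) _ (fun n => M * r ^ n)).
  - intros n. change (Rabs (Cmod (c n) * r ^ n) <= M * r ^ n).
    assert (0 <= r ^ n) by (apply pow_le; lra).
    rewrite Rabs_pos_eq by (apply Rmult_le_pos; [apply Cmod_ge_0|assumption]).
    apply Rmult_le_compat_r; [assumption|apply HM].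
  - apply (ex_series_scal_l (V := R_NormedModule)). apply ex_series_geom.
    rewrite Rabs_pos_eq; lra.
Qed.

Lemma unit_radius_CV_radius (c : nat -> C) (r : R) :
  unit_radius c -> 0 <= r < 1 -> Rbar_le r (CV_radius (fun n => Cmod (c n))).
Proof.
  intros H Hr. apply Lub_Rbar_correct. unfold CV_disk.
  eapply ex_series_ext; [|apply (H r Hr)].
  intros n; simpl. rewrite Rabs_pos_eq; [reflexivity|].
  apply Rmult_le_pos; [apply Cmod_ge_0|apply pow_le; lra].
Qed.

(** The moduli form a real power series, whose radius of convergence is unchanged by derivation; the
    midpoint (1 + r) / 2 makes the inequality strict. *)
Lemma unit_radius_derive (c : nat -> C) : unit_radius c -> unit_radius (coef_derive c).
Proof.
  intros H r Hr.
  assert (HR : Rbar_lt (Rabs r) (CV_radius (PS_derive (fun n => Cmod (c n))))).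
  { rewrite CV_radius_derive, Rabs_pos_eq by lra.
    eapply Rbar_lt_le_trans; [|apply (unit_radius_CV_radius c ((1 + r) / 2) H); lra].
    simpl. lra. }
  apply CV_disk_inside in HR.
  eapply ex_series_ext; [|exact HR].
  intros n; cbv beta. unfold coef_derive, PS_derive.
  rewrite Cmod_mult, Cmod_R, (Rabs_pos_eq (INR (S n))) by apply pos_INR.
  rewrite Rabs_pos_eq; [reflexivity|].
  apply Rmult_le_pos; [apply Rmult_le_pos; [apply pos_INR|apply Cmod_ge_0]|apply pow_le; lra].
Qed.

Lemma power_series_sums (c : nat -> C) (z : C) :
  unit_radius c -> Cmod z < 1 -> C_sums (fun n => c n * z ^ n)%C (power_series c z).
Proof.
  intros Hc Hz. apply C_series_sums.
  eapply ex_series_ext; [|apply (Hc (Cmod z)); split; [apply Cmod_ge_0|exact Hz]].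
  intros n. cbv beta. rewrite Cmod_mult, Cmod_pow. reflexivity.
Qed.

Lemma Csum_taylor (c : nat -> C) (z w : C) (N : nat) :
  (Csum (fun n => c n * w ^ n) (S N) - Csum (fun n => c n * z ^ n) (S N)
   - Csum (fun n => coef_derive c n * z ^ n) N * (w - z) =
  Csum (fun n => c (S n) * (w ^ S n - z ^ S n - RtoC (INR (S n)) * z ^ n * (w - z))) N)%C.
Proof.
  induction N as [|N IH].
  - simpl. ring.
  - transitivity ((Csum (fun n => c n * w ^ n) (S N) - Csum (fun n => c n * z ^ n) (S N)
       - Csum (fun n => coef_derive c n * z ^ n) N * (w - z)) +
      (c (S N) * w ^ S N - c (S N) * z ^ S N - coef_derive c N * z ^ N * (w - z)))%C.
    + change (Csum (fun n => c n * w ^ n)%C (S (S N))) with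
        (Csum (fun n => c n * w ^ n) (S N) + c (S N) * w ^ S N)%C.
      change (Csum (fun n => c n * z ^ n)%C (S (S N))) with
        (Csum (fun n => c n * z ^ n) (S N) + c (S N) * z ^ S N)%C.
      change (Csum (fun n => coef_derive c n * z ^ n)%C (S N)) with
        (Csum (fun n => coef_derive c n * z ^ n) N + coef_derive c N * z ^ N)%C.
      ring.
    + rewrite IH. unfold coef_derive.
      change (Csum (fun n => c (S n) * (w ^ S n - z ^ S n - RtoC (INR (S n)) * z ^ n * (w - z)))%C (S N))
        with (Csum (fun n => c (S n) * (w ^ S n - z ^ S n - RtoC (INR (S n)) * z ^ n * (w - z))) N +
          c (S N) * (w ^ S N - z ^ S N - RtoC (INR (S N)) * z ^ N * (w - z)))%C.
      ring.
Qed.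

(** On the disc of radius r, midway between |z| and 1, the first-order remainder is at most B |w -
    z|^2, where B is the sum of the twice derived series of moduli at r. *)
Lemma power_series_C_diff_at (c : nat -> C) (z : C) :
  unit_radius c -> Cmod z < 1 ->
  C_diff_at (power_series c) z (power_series (coef_derive c) z).
Proof.
  intros Hc Hz.
  assert (Hc1 := unit_radius_derive c Hc). assert (Hc2 := unit_radius_derive _ Hc1).
  set (r := (1 + Cmod z) / 2).
  assert (Hr : 0 <= r < 1) by (unfold r; pose proof (Cmod_ge_0 z); lra).
  set (e := fun n => Cmod (coef_derive (coef_derive c) n) * r ^ n).
  assert (He0 : forall n, 0 <= e n).
  { intros n. apply Rmult_le_pos; [apply Cmod_ge_0|apply pow_le; lra]. }
  set (B := Series e).
  assert (HB : forall N, Rsum e N <= B).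
  { intros N. apply Rsum_le_Series; [exact He0|apply (Hc2 r Hr)]. }
  assert (HB0 : 0 <= B) by exact (HB 0%nat).
  assert (Hmain : forall w, Cmod w <= r ->
    Cmod (power_series c w - power_series c z - power_series (coef_derive c) z * (w - z))
      <= B * (Cmod (w - z) * Cmod (w - z))).
  { intros w Hw. apply Rnot_lt_le. intros Hlt.
    set (gap := Cmod (power_series c w - power_series c z - power_series (coef_derive c) z * (w - z))
       - B * (Cmod (w - z) * Cmod (w - z))) in *.
    (* Passing from partial sums to limits costs less than (2 + |w - z|) times this tolerance, which
       is less than the supposed violation [gap]. *)
    assert (Hgap : 0 < gap / (3 + Cmod (w - z))).
    { apply Rdiv_lt_0_compat; [unfold gap; lra|pose proof (Cmod_ge_0 (w - z)); lra]. }
    assert (S1 := power_series_sums c w Hc ltac:(lra)).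
    assert (S2 := power_series_sums c z Hc Hz).
    assert (S3 := power_series_sums _ z Hc1 Hz).
    destruct (S1 (mkposreal _ Hgap)) as [N1 HN1].
    destruct (S2 (mkposreal _ Hgap)) as [N2 HN2].
    destruct (S3 (mkposreal _ Hgap)) as [N3 HN3]. simpl in HN1, HN2, HN3.
    set (N := max N1 (max N2 N3)).
    specialize (HN1 (S N) ltac:(lia)). specialize (HN2 (S N) ltac:(lia)).
    specialize (HN3 N ltac:(lia)).
    assert (HT : Cmod (Csum (fun n => c n * w ^ n)%C (S N) - Csum (fun n => c n * z ^ n)%C (S N)
       - Csum (fun n => coef_derive c n * z ^ n)%C N * (w - z)) <= B * (Cmod (w - z) * Cmod (w - z))).
    { rewrite Csum_taylor.
      eapply Rle_trans; [apply (Cmod_Csum_le _ (fun n =>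
        Cmod (c (S n)) * (INR (S n) * INR n * r ^ pred n) * (Cmod (w - z) * Cmod (w - z))))|].
      - intros n _. rewrite Cmod_mult.
        rewrite Rmult_assoc. apply Rmult_le_compat_l; [apply Cmod_ge_0|].
        apply pow_taylor_bound; [unfold r; lra|exact Hw].
      (* The term of index 0 vanishes because of [INR 0], hence the shift from S N to N. *)
      - assert (Hs : forall N, Rsum (fun n =>
          Cmod (c (S n)) * (INR (S n) * INR n * r ^ pred n) * (Cmod (w - z) * Cmod (w - z))) (S N) =
          Rsum e N * (Cmod (w - z) * Cmod (w - z))).
        { clear. induction N as [|N IH].
          - simpl. ring.
          - change (Rsum (fun n => Cmod (c (S n)) * (INR (S n) * INR n * r ^ pred n) *
              (Cmod (w - z) * Cmod (w - z))) (S N) +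
              Cmod (c (S (S N))) * (INR (S (S N)) * INR (S N) * r ^ N) *
              (Cmod (w - z) * Cmod (w - z)) =
              (Rsum e N + e N) * (Cmod (w - z) * Cmod (w - z))).
            rewrite IH. unfold e, coef_derive. rewrite !Cmod_mult, !Cmod_R, !Rabs_pos_eq by apply pos_INR.
            ring. }
        apply Rle_trans with (Rsum e N * (Cmod (w - z) * Cmod (w - z))).
        + rewrite <- Hs. change (Rsum ?f (S N)) with (Rsum f N + f N).
          assert (0 <= Cmod (c (S N)) * (INR (S N) * INR N * r ^ pred N) *
            (Cmod (w - z) * Cmod (w - z))); [|lra].
          repeat apply Rmult_le_pos; try apply Cmod_ge_0; try apply pos_INR. apply pow_le; lra.
        + apply Rmult_le_compat_r; [|apply HB].
          apply Rmult_le_pos; apply Cmod_ge_0. }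
    set (s1 := Csum (fun n => c n * w ^ n)%C (S N)) in *.
    set (s2 := Csum (fun n => c n * z ^ n)%C (S N)) in *.
    set (s3 := Csum (fun n => coef_derive c n * z ^ n)%C N) in *.
    set (p1 := power_series c w) in *. set (p2 := power_series c z) in *.
    set (p3 := power_series (coef_derive c) z) in *.
    assert (T : Cmod (p1 - p2 - p3 * (w - z)) <= Cmod (s1 - s2 - s3 * (w - z)) +
      (Cmod (s1 - p1) + Cmod (s2 - p2) + Cmod (s3 - p3) * Cmod (w - z))).
    { replace (p1 - p2 - p3 * (w - z))%C with ((s1 - s2 - s3 * (w - z)) +
        (- (s1 - p1) + (s2 - p2) + (s3 - p3) * (w - z)))%C by ring.
      eapply Rle_trans; [apply Cmod_triangle|]. apply Rplus_le_compat_l.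
      eapply Rle_trans; [apply Cmod_triangle|]. rewrite Cmod_mult. apply Rplus_le_compat_r.
      eapply Rle_trans; [apply Cmod_triangle|]. rewrite Cmod_opp. lra. }
    assert (Hw0 := Cmod_ge_0 (w - z)).
    assert (E : gap = gap / (3 + Cmod (w - z)) * (3 + Cmod (w - z))) by (field; lra).
    assert (Cmod (s3 - p3) * Cmod (w - z) <= gap / (3 + Cmod (w - z)) * Cmod (w - z))
      by (apply Rmult_le_compat_r; lra).
    assert (gap <= Cmod (s1 - p1) + Cmod (s2 - p2) + Cmod (s3 - p3) * Cmod (w - z))
      by (unfold gap at 1; lra).
    lra. }
  intros eps.
  assert (Hd : 0 < Rmin (r - Cmod z) (eps / (B + 1))).
  { apply Rmin_glb_lt; [unfold r; lra|].
    apply Rdiv_lt_0_compat; [apply cond_pos|lra]. }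
  exists (mkposreal _ Hd); simpl. intros w Hw.
  assert (H1 : Cmod (w - z) < r - Cmod z) by (eapply Rlt_le_trans; [exact Hw|apply Rmin_l]).
  assert (H2 : Cmod (w - z) < eps / (B + 1)) by (eapply Rlt_le_trans; [exact Hw|apply Rmin_r]).
  eapply Rle_trans; [apply Hmain|].
  - pose proof (Cmod_triangle (w - z) z) as T. replace (w - z + z)%C with w in T by ring. lra.
  - rewrite <- Rmult_assoc. apply Rmult_le_compat_r; [apply Cmod_ge_0|].
    apply Rlt_div_r in H2; [|lra]. pose proof (Cmod_ge_0 (w - z)). nra.
Qed.

(** * Real partial derivatives of holomorphic functions *)

(** This family, which contains [Re] as [lin 1 0], is stable under both partial derivatives: along
    x, [lin a b f] becomes [lin a b f'], and along y it becomes [lin b (- a) f']. Inductions on the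
    order of differentiation need this stability. *)
Definition lin (a b : R) (w : C) : R := a * Re w + b * Im w.

Lemma lin_bound (a b : R) (w : C) : Rabs (lin a b w) <= (Rabs a + Rabs b) * Cmod w.
Proof.
  unfold lin. eapply Rle_trans; [apply Rabs_triang|]. rewrite !Rabs_mult.
  pose proof (re_le_Cmod w). pose proof (im_le_Cmod w).
  pose proof (Rabs_pos a). pose proof (Rabs_pos b). nra.
Qed.

(** One computation for both axes, with [v] equal to 1 or [Ci]. *)
Lemma C_diff_at_directional (f : C -> C) (z l v : C) (a b : R) (p : R -> C) (x : R) :
  C_diff_at f z l -> Cmod v = 1 ->
  (forall s, p s = z + RtoC (s - x) * v)%C ->
  is_derive (fun s => lin a b (f (p s))) x (lin a b (l * v)).
Proof.
  intros H Hv Hp. apply is_derive_Reals. intros eps Heps.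
  set (K := Rabs a + Rabs b + 1).
  assert (HK : 0 < K) by (unfold K; pose proof (Rabs_pos a); pose proof (Rabs_pos b); lra).
  assert (He : 0 < eps / (2 * K)) by (apply Rdiv_lt_0_compat; lra).
  destruct (H (mkposreal _ He)) as [d Hd]; simpl in Hd.
  exists d. intros h Hh Hhd.
  assert (Ep : p (x + h) = (z + RtoC h * v)%C).
  { rewrite Hp. do 3 f_equal. ring. }
  assert (E0 : p x = z) by (rewrite Hp, Rminus_eq_0; ring).
  specialize (Hd (z + RtoC h * v)%C).
  replace (z + RtoC h * v - z)%C with (RtoC h * v)%C in Hd by ring.
  rewrite Cmod_mult, Cmod_R, Hv, Rmult_1_r in Hd. specialize (Hd Hhd).
  rewrite Ep, E0.
  replace (_ - _) with (lin a b (f (z + RtoC h * v) - f z - l * (RtoC h * v))%C / h)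
    by (unfold lin; simpl; unfold Re, Im; field; exact Hh).
  unfold Rdiv. rewrite Rabs_mult, Rabs_inv.
  assert (Hah : 0 < Rabs h) by (apply Rabs_pos_lt, Hh).
  apply (Rmult_lt_reg_r (Rabs h)); [exact Hah|].
  rewrite Rmult_assoc, Rinv_l, Rmult_1_r by lra.
  eapply Rle_lt_trans; [apply lin_bound|].
  assert (B : (Rabs a + Rabs b) * Cmod (f (z + RtoC h * v) - f z - l * (RtoC h * v))%C <=
    K * (eps / (2 * K) * Rabs h)).
  { apply Rmult_le_compat; [pose proof (Rabs_pos a); pose proof (Rabs_pos b); lra
      |apply Cmod_ge_0|unfold K; lra|exact Hd]. }
  replace (K * (eps / (2 * K) * Rabs h)) with (eps * Rabs h / 2) in B by (field; lra).
  nra.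
Qed.

Lemma C_diff_at_is_derive_x (f : C -> C) (x y a b : R) (l : C) :
  C_diff_at f (x, y) l -> is_derive (fun s => lin a b (f (s, y))) x (lin a b l).
Proof.
  intros H. rewrite <- (Cmult_1_r l).
  apply (C_diff_at_directional f (x, y) l (RtoC 1) a b (fun s => (s, y)) x H);
    [apply Cmod_1|].
  intros s. apply injective_projections; simpl; ring.
Qed.

Lemma C_diff_at_is_derive_y (f : C -> C) (x y a b : R) (l : C) :
  C_diff_at f (x, y) l -> is_derive (fun t => lin a b (f (x, t))) y (lin b (- a) l).
Proof.
  intros H. replace (lin b (- a) l) with (lin a b (l * Ci)%C)
    by (unfold lin; simpl; unfold Re, Im; ring).
  apply (C_diff_at_directional f (x, y) l Ci a b (fun s => (x, s)) y H);
    [apply Cmod_Ci|].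
  intros s. apply injective_projections; simpl; ring.
Qed.

Lemma C_diff_at_continuity_2d (f : C -> C) (x y a b : R) (l : C) :
  C_diff_at f (x, y) l -> continuity_2d_pt (fun s t => lin a b (f (s, t))) x y.
Proof.
  intros H eps.
  set (K := Rabs a + Rabs b + 1).
  assert (HK : 0 < K) by (unfold K; pose proof (Rabs_pos a); pose proof (Rabs_pos b); lra).
  assert (He : 0 < eps / K) by (apply Rdiv_lt_0_compat; [apply cond_pos|lra]).
  destruct (C_diff_at_continuous f _ _ H (mkposreal _ He)) as [d Hd]; simpl in Hd.
  assert (Hd2 : 0 < d / 2) by (pose proof (cond_pos d); lra).
  exists (mkposreal _ Hd2); simpl. intros u v Hu Hv.
  assert (Hw : Cmod ((u, v) - (x, y)) < d).
  { eapply Rle_lt_trans; [apply Cmod_le_abs_sum|]. simpl. unfold Rminus in Hu, Hv. lra. }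
  specialize (Hd _ Hw).
  replace (_ - _) with (lin a b (f (u, v) - f (x, y))%C)
    by (unfold lin; simpl; unfold Re, Im; ring).
  eapply Rle_lt_trans; [apply lin_bound|].
  apply Rlt_div_r in Hd; [|exact HK].
  pose proof (Cmod_ge_0 (f (u, v) - f (x, y))). unfold K in Hd.
  pose proof (Rabs_pos a). pose proof (Rabs_pos b). nra.
Qed.

(** The successive derivatives are given as witnesses, which power series supply explicitly by
    [coef_derive]. *)
Fixpoint holomorphic_n (n : nat) (f : C -> C) : Prop :=
  match n with
  | O => holomorphic_within 1 f
  | S m => exists f1, (forall z, Cmod z < 1 -> C_diff_at f z (f1 z)) /\ holomorphic_n m f1
  end.

Lemma holomorphic_n_ex_diff_n (n : nat) (f : C -> C) (a b x y : R) :
  holomorphic_n n f -> in_disc x y ->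
  ex_diff_n (fun s t => lin a b (f (s, t))) n x y.
Proof.
  revert f a b x y. induction n as [|n IH]; intros f a b x y Hf Hxy;
    assert (Hz : Cmod (x, y) < 1) by (apply (unit_disc_in_disc (x, y)), Hxy).
  - destruct (Hf (x, y) Hz) as [l Hl]. split; [|exact I].
    exact (C_diff_at_continuity_2d f x y a b l Hl).
  - destruct Hf as [f1 [H1 Hf1]].
    destruct (in_disc_open x y Hxy) as [d Hd].
    split; [|split; [|split; [|split]]].
    + exact (C_diff_at_continuity_2d f x y a b _ (H1 _ Hz)).
    + eexists. exact (C_diff_at_is_derive_x f x y a b _ (H1 _ Hz)).
    + eexists. exact (C_diff_at_is_derive_y f x y a b _ (H1 _ Hz)).
    + apply (ex_diff_n_ext_loc (fun s t => lin a b (f1 (s, t)))); [|apply IH; assumption].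
      exists d. intros u v Hu Hv. symmetry. apply is_derive_unique.
      apply C_diff_at_is_derive_x, H1, (unit_disc_in_disc (u, v)), Hd; assumption.
    + apply (ex_diff_n_ext_loc (fun s t => lin b (- a) (f1 (s, t)))); [|apply IH; assumption].
      exists d. intros u v Hu Hv. symmetry. apply is_derive_unique.
      apply C_diff_at_is_derive_y, H1, (unit_disc_in_disc (u, v)), Hd; assumption.
Qed.

Lemma Derive_n_2_locally (g g1 : R -> R) (x l : R) :
  locally x (fun s => is_derive g s (g1 s)) -> is_derive g1 x l -> Derive_n g 2 x = l.
Proof.
  intros Hg Hg1. simpl. rewrite (Derive_ext_loc _ g1).
  - apply is_derive_unique, Hg1.
  - apply (filter_imp (fun s => is_derive g s (g1 s))); [|exact Hg].
    intros s Hs. apply is_derive_unique, Hs.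
Qed.

(** Two derivatives along y turn (a, b) into (b, -a) and then (-a, -b), which cancels the second
    derivative along x. *)
Lemma harmonic_lin (f : C -> C) (a b : R) :
  holomorphic_n 2 f -> harmonic_on_disc (fun z => lin a b (f z)).
Proof.
  intros Hf x y Hxy. apply unit_disc_in_disc in Hxy. simpl in Hxy.
  split; [exact (holomorphic_n_ex_diff_n 2 f a b x y Hf Hxy)|].
  destruct Hf as [f1 [H1 [f2 [H2 _]]]].
  destruct (in_disc_open x y Hxy) as [d Hd].
  assert (Hz : Cmod (x, y) < 1) by (apply (unit_disc_in_disc (x, y)), Hxy).
  assert (Ex : partial_derive 2 0 (fun s t => lin a b (f (s, t))) x y = lin a b (f2 (x, y))).
  { apply (Derive_n_2_locally (fun s => lin a b (f (s, y))) (fun s => lin a b (f1 (s, y)))).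
    - exists d. intros s Hs. apply C_diff_at_is_derive_x, H1, (unit_disc_in_disc (s, y)), Hd.
      + exact Hs.
      + rewrite Rminus_eq_0, Rabs_R0. apply cond_pos.
    - apply C_diff_at_is_derive_x, H2, Hz. }
  assert (Ey : partial_derive 0 2 (fun s t => lin a b (f (s, t))) x y = lin (- a) (- b) (f2 (x, y))).
  { apply (Derive_n_2_locally (fun t => lin a b (f (x, t))) (fun t => lin b (- a) (f1 (x, t)))).
    - exists d. intros t Ht. apply C_diff_at_is_derive_y, H1, (unit_disc_in_disc (x, t)), Hd.
      + rewrite Rminus_eq_0, Rabs_R0. apply cond_pos.
      + exact Ht.
    - apply C_diff_at_is_derive_y, H2, Hz. }
  rewrite Ex, Ey. unfold lin. ring.
Qed.

Lemma power_series_holomorphic_n (n : nat) (c : nat -> C) :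
  unit_radius c -> holomorphic_n n (power_series c).
Proof.
  revert c. induction n as [|n IH]; intros c Hc.
  - intros z Hz. eexists. apply power_series_C_diff_at; assumption.
  - exists (power_series (coef_derive c)). split.
    + intros z Hz. apply power_series_C_diff_at; assumption.
    + apply IH, unit_radius_derive, Hc.
Qed.

(** * Simultaneous cluster points of bounded sequences *)

(** The first N coordinates return jointly and arbitrarily late to L. Put this way, the diagonal
    argument composes no subsequences. *)
Definition adherent (x : nat -> nat -> R) (L : nat -> R) (N : nat) : Prop :=
  forall (eps : posreal) (m : nat), exists k, (m <= k)%nat /\
    forall j, (j < N)%nat -> Rabs (x k j - L j) < eps.

(** Indices k_m >= m are chosen with the first N coordinates within 1 / (m + 1) of their limits;
    Bolzano-Weierstrass along k_m then gives the next coordinate. *)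
Lemma adherent_extend (x : nat -> nat -> R) (M : R) (L : nat -> R) (N : nat) :
  (forall k j, Rabs (x k j) <= M) -> adherent x L N ->
  exists L', (forall j, (j < N)%nat -> L' j = L j) /\ adherent x L' (S N).
Proof.
  intros HM HL.
  assert (Hpos : forall m, 0 < / (INR m + 1)).
  { intros m. apply Rinv_0_lt_compat. pose proof (pos_INR m). lra. }
  destruct (choice (fun (m : nat) (k : nat) => (m <= k)%nat /\
      forall j, (j < N)%nat -> Rabs (x k j - L j) < / (INR m + 1))) as [k Hk].
  { intros m. exact (HL (mkposreal _ (Hpos m)) m). }
  destruct (Bolzano_Weierstrass (fun m => x (k m) N) (fun r => - M <= r <= M)) as [l Hl].
  { apply compact_P3. }
  { intros m. apply Rabs_le_between, HM. }
  exists (fun j => if Nat.eqb j N then l else L j). split.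
  - intros j Hj. destruct (Nat.eqb_spec j N); [lia|reflexivity].
  - intros eps m.
    destruct (archimed_cor1 eps (cond_pos eps)) as [n0 [Hn0 Hn0p]].
    destruct (Hl (disc l eps) (max m n0)) as [p [Hp Hd]].
    { exists eps. intros r Hr; exact Hr. }
    exists (k p). destruct (Hk p) as [Hkp Hkj]. split; [lia|].
    intros j Hj. destruct (Nat.eqb_spec j N) as [->|Hne]; [exact Hd|].
    eapply Rlt_trans; [apply Hkj; lia|].
    eapply Rlt_trans; [|exact Hn0].
    apply Rinv_lt_contravar.
    + apply Rmult_lt_0_compat; [apply lt_0_INR; lia|]. pose proof (pos_INR p). lra.
    + assert (INR n0 <= INR p) by (apply le_INR; lia). lra.
Qed.

Lemma adherent_sequence (x : nat -> nat -> R) (M : R) :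
  (forall k j, Rabs (x k j) <= M) -> exists L, forall N, adherent x L N.
Proof.
  intros HM.
  destruct (dependent_choice (nat -> R) (fun n L => adherent x L n)
     (fun n L L' => forall j, (j < n)%nat -> L' j = L j) (fun _ => 0)) as [s [_ Hs]].
  - intros eps m. exists m. split; [lia|]. intros j Hj. lia.
  - intros n L HL. destruct (adherent_extend x M L n HM HL) as [L' [H1 H2]].
    exists L'. split; assumption.
  (* Coordinate j is first fixed at stage j + 1 and never changes afterwards. *)
  - exists (fun j => s (S j) j). intros N eps m.
    destruct (Hs N) as [HN _]. destruct (HN eps m) as [k [Hk Hj]].
    exists k. split; [exact Hk|]. intros j HjN.
    assert (E : forall i, s (S j + i)%nat j = s (S j) j).
    { induction i as [|i IHi]; [rewrite Nat.add_0_r; reflexivity|].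
      rewrite Nat.add_succ_r. rewrite (proj2 (Hs (S j + i)%nat) j) by lia. exact IHi. }
    specialize (E (N - S j)%nat). replace (S j + (N - S j))%nat with N in E by lia.
    rewrite <- E. apply Hj, HjN.
Qed.

(** * Maximum principle and compactness *)

Lemma mobius_denominator (z0 w : C) :
  Cmod z0 < 1 -> Cmod w < 1 -> (1 + Cconj z0 * w)%C <> RtoC 0.
Proof.
  intros Hz Hw E.
  assert (H : Cmod (Cconj z0 * w) < 1).
  { rewrite Cmod_mult, Cmod_conj. pose proof (Cmod_ge_0 z0). pose proof (Cmod_ge_0 w). nra. }
  replace (Cconj z0 * w)%C with (1 + Cconj z0 * w - 1)%C in H by ring.
  rewrite E in H. replace (RtoC 0 - RtoC 1)%C with (- RtoC 1)%C in H by ring.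
  rewrite Cmod_opp, Cmod_1 in H. lra.
Qed.

Lemma mobius_in_disc (z0 w : C) :
  Cmod z0 < 1 -> Cmod w < 1 -> Cmod ((w + z0) / (1 + Cconj z0 * w)) < 1.
Proof.
  intros Hz Hw. assert (Hn := mobius_denominator z0 w Hz Hw).
  rewrite Cmod_div by exact Hn.
  assert (Hp : 0 < Cmod (1 + Cconj z0 * w)) by (apply Cmod_gt_0; exact Hn).
  apply Rlt_div_l; [exact Hp|]. rewrite Rmult_1_l.
  assert (E : Cmod (1 + Cconj z0 * w) ^ 2 - Cmod (w + z0) ^ 2 =
    (1 - Cmod w ^ 2) * (1 - Cmod z0 ^ 2)).
  { rewrite !Cmod2_alt. simpl. unfold Re, Im. ring. }
  pose proof (Cmod_ge_0 z0). pose proof (Cmod_ge_0 w). pose proof (Cmod_ge_0 (w + z0)).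
  assert (0 < (1 - Cmod w ^ 2) * (1 - Cmod z0 ^ 2)) by (apply Rmult_lt_0_compat; nra).
  nra.
Qed.

Lemma C_diff_at_affine (a b z : C) : C_diff_at (fun w => a + b * w)%C z b.
Proof.
  assert (H := C_diff_at_plus (fun _ => a) (fun w => b * w)%C z _ _ (C_diff_at_const a z)
    (C_diff_at_mult (fun _ => b) (fun w => w) z _ _ (C_diff_at_const b z) (C_diff_at_id z))).
  cbv beta in H. replace (_ + (_ * z + _))%C with b in H by ring. exact H.
Qed.

(** A disc automorphism moves z0 to the centre, where 1 - Re vanishes and the coefficient estimate
    kills every coefficient of index n >= 1. The composite is therefore constant on the unit
    disc. *)
Lemma re_maximum_principle (h : C -> C) (z0 : C) :
  holomorphic_within 1 h -> (forall z, Cmod z < 1 -> Re (h z) <= 1) ->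
  Cmod z0 < 1 -> Re (h z0) = 1 -> h (RtoC 0) = h z0.
Proof.
  intros Hh Hre Hz0 Hmax.
  (* Precomposing with w -> r w makes the composite holomorphic on the radius 1 / r > 1; r > |z0|
     keeps 0 among its arguments. *)
  set (r := (1 + Cmod z0) / 2). assert (Hzp := Cmod_ge_0 z0).
  assert (Hr : Cmod z0 < r < 1) by (unfold r; lra).
  assert (Hr0 : RtoC r <> RtoC 0) by (intros E; apply RtoC_inj in E; lra).
  set (phi := fun w => ((z0 + RtoC r * w) / (1 + (Cconj z0 * RtoC r) * w))%C).
  assert (Hmod : forall w, Cmod w < / r -> Cmod (RtoC r * w) < 1).
  { intros w Hw. rewrite Cmod_mult, Cmod_R, Rabs_pos_eq by lra.
    apply (Rmult_lt_compat_l r) in Hw; [|lra]. rewrite Rinv_r in Hw; lra. }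
  assert (Hphi : forall w, Cmod w < / r -> Cmod (phi w) < 1).
  { intros w Hw. unfold phi. rewrite <- Cmult_assoc, (Cplus_comm z0).
    apply mobius_in_disc; [exact Hz0|apply Hmod, Hw]. }
  assert (HG : holomorphic_within (/ r) (fun w => h (phi w))).
  { intros w Hw. destruct (Hh (phi w) (Hphi w Hw)) as [l Hl].
    eexists. apply (C_diff_at_comp h phi); [exact Hl|].
    apply (C_diff_at_mult (fun w => z0 + RtoC r * w)%C (fun w => / (1 + (Cconj z0 * RtoC r) * w))%C);
      [apply C_diff_at_affine|].
    apply (C_diff_at_comp Cinv); [|apply C_diff_at_affine].
    apply C_diff_at_inv. rewrite <- Cmult_assoc.
    apply mobius_denominator; [exact Hz0|apply Hmod, Hw]. }
  assert (Hphi0 : phi (RtoC 0) = z0).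
  { unfold phi. rewrite !Cmult_0_r, !Cplus_0_r. field. }
  destruct (taylor_expansion (/ r) (fun w => h (phi w)) HG) as [c [Hc0 [Hcn [M [HM0 HM]]]]].
  - rewrite <- Rinv_1. apply Rinv_lt_contravar; lra.
  - intros w Hw. apply Hre, Hphi, Hw.
  - rewrite Hphi0 in Hc0, Hcn. rewrite Hmax in Hcn.
    assert (Hs : forall w N, Csum (fun n => c n * w ^ n)%C (S N) = h z0).
    { intros w N. induction N as [|N IH].
      - simpl. rewrite Hc0. ring.
      - change (Csum (fun n => c n * w ^ n) (S N) + c (S N) * w ^ S N = h z0)%C.
        rewrite IH. replace (c (S N)) with (RtoC 0); [ring|].
        symmetry. apply Cmod_eq_0. apply Rle_antisym; [|apply Cmod_ge_0].
        specialize (Hcn (S N) ltac:(lia)). lra. }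
    (* The point that [phi] sends to 0. *)
    set (w := (- z0 / RtoC r)%C).
    assert (Hw : Cmod w < 1).
    { unfold w. rewrite Cmod_div, Cmod_opp, Cmod_R, Rabs_pos_eq by (try exact Hr0; lra).
      apply Rlt_div_l; lra. }
    assert (Hphiw : phi w = RtoC 0).
    { unfold phi, w. replace (z0 + RtoC r * (- z0 / RtoC r))%C with (RtoC 0) by (field; exact Hr0).
      unfold Cdiv. ring. }
    rewrite <- Hphiw. apply Cmod_small_eq. intros eps.
    destruct (pow_lt_eps (Cmod w) (M / (1 - Cmod w)) eps) as [N HN].
    { split; [apply Cmod_ge_0|exact Hw]. }
    specialize (HM w (S N) Hw). rewrite Hs in HM.
    left. eapply Rle_lt_trans; [exact HM|apply HN; lia].
Qed.

Lemma C_diff_at_unique (f : C -> C) (z l l' : C) :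
  C_diff_at f z l -> C_diff_at f z l' -> l = l'.
Proof.
  intros H H'. apply Cmod_small_eq. intros eps.
  assert (He : 0 < eps / 2) by (pose proof (cond_pos eps); lra).
  destruct (H (mkposreal _ He)) as [d Hd]. destruct (H' (mkposreal _ He)) as [d' Hd'].
  simpl in Hd, Hd'.
  set (h := Rmin d d' / 2).
  assert (Hm : 0 < Rmin d d') by (apply Rmin_glb_lt; apply cond_pos).
  assert (Hh : 0 < h /\ h < d /\ h < d').
  { unfold h. pose proof (Rmin_l d d'). pose proof (Rmin_r d d'). lra. }
  assert (E : (z + RtoC h - z)%C = RtoC h) by ring.
  specialize (Hd (z + RtoC h)%C). specialize (Hd' (z + RtoC h)%C).
  rewrite E, Cmod_R, Rabs_pos_eq in Hd, Hd' by lra.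
  specialize (Hd ltac:(lra)). specialize (Hd' ltac:(lra)).
  apply (Rmult_le_reg_r h); [lra|].
  replace (Cmod (l - l') * h) with (Cmod ((l - l') * RtoC h))
    by (rewrite Cmod_mult, Cmod_R, Rabs_pos_eq by lra; reflexivity).
  replace ((l - l') * RtoC h)%C with
    ((f (z + RtoC h) - f z - l' * RtoC h) + - (f (z + RtoC h) - f z - l * RtoC h))%C by ring.
  eapply Rle_trans; [apply Cmod_triangle|]. rewrite Cmod_opp. lra.
Qed.

Lemma C_diff_at_ext_within (rho : R) (f g : C -> C) (z l : C) :
  Cmod z < rho -> (forall w, Cmod w < rho -> f w = g w) ->
  C_diff_at f z l -> C_diff_at g z l.
Proof.
  intros Hz Hfg H eps. destruct (H eps) as [d Hd].
  assert (Hd' : 0 < Rmin d (rho - Cmod z)) by (apply Rmin_glb_lt; [apply cond_pos|lra]).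
  exists (mkposreal _ Hd'); simpl. intros w Hw.
  assert (H1 : Cmod (w - z) < d) by (eapply Rlt_le_trans; [exact Hw|apply Rmin_l]).
  assert (H2 : Cmod (w - z) < rho - Cmod z) by (eapply Rlt_le_trans; [exact Hw|apply Rmin_r]).
  rewrite <- (Hfg z Hz), <- (Hfg w); [apply Hd, H1|].
  pose proof (Cmod_triangle (w - z) z) as T. replace (w - z + z)%C with w in T by ring. lra.
Qed.

Lemma power_series_0 (c : nat -> C) : unit_radius c -> power_series c (RtoC 0) = c 0%nat.
Proof.
  intros Hc. eapply C_sums_unique.
  - apply power_series_sums; [exact Hc|rewrite Cmod_0; lra].
  - intros eps. exists 1%nat. intros [|N] HN; [lia|].
    replace (Csum (fun n => c n * RtoC 0 ^ n)%C (S N)) with (c 0%nat).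
    + replace (c 0%nat - c 0%nat)%C with (RtoC 0) by ring. rewrite Cmod_0. apply cond_pos.
    + clear. induction N as [|N IH]; [simpl; ring|].
      change (c 0%nat = Csum (fun n => c n * RtoC 0 ^ n) (S N) + c (S N) * RtoC 0 ^ S N)%C.
      rewrite <- IH, C0_pow by lia. ring.
Qed.

(** With f(0) = 0 the estimate 4 (1 - Re f(0)) becomes a constant common to all such f, as
    compactness requires. *)
Lemma taylor_power_series (rho : R) (f : C -> C) (l : C) :
  holomorphic_within rho f -> 1 < rho -> (forall z, Cmod z < rho -> Re (f z) <= 1) ->
  f (RtoC 0) = RtoC 0 -> C_diff_at f (RtoC 0) l ->
  exists c : nat -> C, c 0%nat = RtoC 0 /\ c 1%nat = l /\
    (forall n, Cmod (c n) <= 4) /\ forall z, Cmod z < 1 -> f z = power_series c z.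
Proof.
  intros Hf Hrho Hre Hf0 Hl.
  destruct (taylor_expansion rho f Hf Hrho Hre) as [c [Hc0 [Hcn [M [HM0 HM]]]]].
  rewrite Hf0 in Hc0, Hcn.
  assert (Hb : forall n, Cmod (c n) <= 4).
  { intros [|n]; [rewrite Hc0, Cmod_0; lra|]. specialize (Hcn (S n) ltac:(lia)).
    simpl in Hcn. lra. }
  assert (Hc := bounded_unit_radius c 4 Hb).
  assert (Hps : forall z, Cmod z < 1 -> f z = power_series c z).
  { intros z Hz. eapply C_sums_unique; [|apply power_series_sums; assumption].
    intros eps. destruct (pow_lt_eps (Cmod z) (M / (1 - Cmod z)) eps) as [N0 HN0].
    { split; [apply Cmod_ge_0|exact Hz]. }
    exists N0. intros N HN. eapply Rle_lt_trans; [|apply (HN0 N HN)].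
    rewrite <- Cmod_opp.
    replace (- (Csum (fun n => c n * z ^ n) N - f z))%C
      with (f z - Csum (fun n => c n * z ^ n) N)%C by ring.
    apply HM, Hz. }
  exists c. repeat split; try assumption.
  assert (H01 : Cmod (RtoC 0) < 1) by (rewrite Cmod_0; lra).
  assert (D := power_series_C_diff_at c (RtoC 0) Hc H01).
  rewrite power_series_0 in D by (apply unit_radius_derive, Hc).
  apply (C_diff_at_ext_within 1 (power_series c) f) in D;
    [|exact H01|intros w Hw; symmetry; apply Hps, Hw].
  rewrite <- (C_diff_at_unique f _ _ _ D Hl).
  unfold coef_derive. simpl. ring.
Qed.

Lemma Rsum_const (e : R) (N : nat) : Rsum (fun _ => e) N = INR N * e.
Proof.
  induction N as [|N IH]; [simpl; ring|]. rewrite S_INR. simpl. rewrite IH. ring.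
Qed.

Lemma Rsum_geom (M r : R) (N k : nat) :
  0 <= M -> 0 <= r < 1 -> Rsum (fun n => M * r ^ (N + n)) k <= M / (1 - r) * r ^ N.
Proof.
  intros HM Hr.
  assert (E : Rsum (fun n => M * r ^ (N + n)) k = M / (1 - r) * r ^ N * (1 - r ^ k)).
  { induction k as [|k IH]; simpl; [ring|]. rewrite IH, pow_add. field. lra. }
  rewrite E. rewrite <- Rmult_1_r. apply Rmult_le_compat_l.
  - apply Rmult_le_pos; [|apply pow_le; lra].
    apply Rmult_le_pos; [lra|left; apply Rinv_0_lt_compat; lra].
  - pose proof (pow_le r k ltac:(lra)). lra.
Qed.

Lemma power_series_tail (c : nat -> C) (M : R) (z : C) (N : nat) :
  (forall n, Cmod (c n) <= M) -> Cmod z < 1 ->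
  Cmod (power_series c z - Csum (fun n => c n * z ^ n)%C N) <= M / (1 - Cmod z) * Cmod z ^ N.
Proof.
  intros HM Hz.
  apply (C_sums_bound (fun n => c n * z ^ n)%C _ _ _ N).
  - apply power_series_sums; [apply (bounded_unit_radius c M HM)|exact Hz].
  - intros K HK.
    replace K with (N + (K - N))%nat by lia. set (k := (K - N)%nat).
    assert (E : Csum (fun n => c n * z ^ n)%C (N + k) =
      (Csum (fun n => c n * z ^ n) N + Csum (fun n => c (N + n)%nat * z ^ (N + n)) k)%C).
    { clearbody k. induction k as [|k IH]; [rewrite Nat.add_0_r; simpl; ring|].
      rewrite Nat.add_succ_r. simpl. rewrite IH. ring. }
    rewrite E.
    replace (_ - _)%C with (Csum (fun n => c (N + n)%nat * z ^ (N + n)) k)%C by ring.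
    eapply Rle_trans; [apply (Cmod_Csum_le _ (fun n => M * Cmod z ^ (N + n)))|].
    + intros n _. rewrite Cmod_mult, Cmod_pow.
      apply Rmult_le_compat_r; [apply pow_le, Cmod_ge_0|apply HM].
    + apply Rsum_geom; [|split; [apply Cmod_ge_0|exact Hz]].
      pose proof (HM 0%nat). pose proof (Cmod_ge_0 (c 0%nat)). lra.
Qed.

(** [N] and [eta] do not depend on c and d: evaluation at a point is continuous for coefficientwise
    convergence under a common bound, because the tails are dominated by one geometric series. *)
Lemma power_series_close (M : R) (z : C) (eps : posreal) :
  0 <= M -> Cmod z < 1 -> exists (N : nat) (eta : posreal), forall c d : nat -> C,
    (forall n, Cmod (c n) <= M) -> (forall n, Cmod (d n) <= M) ->
    (forall n, (n < N)%nat -> Cmod (c n - d n) < eta) ->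
    Cmod (power_series c z - power_series d z) < eps.
Proof.
  intros HM Hz. assert (Hz0 := Cmod_ge_0 z).
  assert (He : 0 < eps / 3) by (pose proof (cond_pos eps); lra).
  destruct (pow_lt_eps (Cmod z) (M / (1 - Cmod z)) (mkposreal _ He)) as [N HN];
    [lra|]. specialize (HN N (Nat.le_refl N)). simpl in HN.
  assert (Heta : 0 < eps / 3 / (INR N + 1)).
  { apply Rdiv_lt_0_compat; [lra|]. pose proof (pos_INR N). lra. }
  exists N, (mkposreal _ Heta). simpl. intros c d Hc Hd Hcd.
  assert (Tc := power_series_tail c M z N Hc Hz).
  assert (Td := power_series_tail d M z N Hd Hz).
  set (eta := eps / 3 / (INR N + 1)) in *.
  assert (HS : Cmod (Csum (fun n => c n * z ^ n)%C N - Csum (fun n => d n * z ^ n)%C N) <= INR N * eta).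
  { assert (E : (Csum (fun n => c n * z ^ n) N - Csum (fun n => d n * z ^ n) N =
      Csum (fun n => (c n - d n) * z ^ n) N)%C).
    { clear. induction N as [|N IH]; simpl; [ring|]. rewrite <- IH. ring. }
    rewrite E. eapply Rle_trans; [apply (Cmod_Csum_le _ (fun _ => eta))|].
    - intros n Hn. rewrite Cmod_mult, Cmod_pow.
      assert (Cmod z ^ n <= 1) by (rewrite <- (pow1 n); apply pow_incr; lra).
      assert (0 <= Cmod z ^ n) by (apply pow_le; lra).
      specialize (Hcd n Hn). pose proof (Cmod_ge_0 (c n - d n)). nra.
    - right. apply Rsum_const. }
  assert (Heq : INR N * eta <= eps / 3).
  { assert (E : eta * (INR N + 1) = eps / 3) by (unfold eta; field; pose proof (pos_INR N); lra).
    lra. }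
  replace (_ - _)%C with ((power_series c z - Csum (fun n => c n * z ^ n)%C N) +
    (Csum (fun n => c n * z ^ n)%C N - Csum (fun n => d n * z ^ n)%C N) +
    - (power_series d z - Csum (fun n => d n * z ^ n)%C N))%C by ring.
  eapply Rle_lt_trans; [apply Cmod_triangle|]. rewrite Cmod_opp.
  pose proof (Cmod_triangle (power_series c z - Csum (fun n => c n * z ^ n)%C N)
    (Csum (fun n => c n * z ^ n)%C N - Csum (fun n => d n * z ^ n)%C N)). lra.
Qed.

(** The four real sequences of parts are interleaved by residues modulo 4, so that one extraction
    serves them all with the same indices k. *)
Lemma adherent_pair_sequence (c1 c2 : nat -> nat -> C) (M : R) :
  (forall k n, Cmod (c1 k n) <= M) -> (forall k n, Cmod (c2 k n) <= M) ->
  exists d1 d2 : nat -> C, forall (N m : nat) (eps : posreal),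
    exists k, (m <= k)%nat /\ forall n, (n < N)%nat ->
      Cmod (c1 k n - d1 n) < eps /\ Cmod (c2 k n - d2 n) < eps.
Proof.
  intros H1 H2.
  set (x := fun k j : nat => match (j mod 4)%nat with
    | 0%nat => Re (c1 k (j / 4)%nat) | 1%nat => Im (c1 k (j / 4)%nat)
    | 2%nat => Re (c2 k (j / 4)%nat) | _ => Im (c2 k (j / 4)%nat) end).
  destruct (adherent_sequence x M) as [L HL].
  { intros k j. unfold x. destruct (j mod 4)%nat as [|[|[|n]]];
    (eapply Rle_trans; [first [apply re_le_Cmod|apply im_le_Cmod]|first [apply H1|apply H2]]). }
  assert (Hx : forall k n i, (i < 4)%nat -> x k (4 * n + i)%nat = match i with
    | 0%nat => Re (c1 k n) | 1%nat => Im (c1 k n)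
    | 2%nat => Re (c2 k n) | _ => Im (c2 k n) end).
  { intros k n i Hi. unfold x.
    rewrite <- (Nat.mod_unique (4 * n + i) 4 n i), <- (Nat.div_unique (4 * n + i) 4 n i) by lia.
    reflexivity. }
  exists (fun n => (L (4 * n + 0)%nat, L (4 * n + 1)%nat)),
    (fun n => (L (4 * n + 2)%nat, L (4 * n + 3)%nat)).
  intros N m eps.
  assert (He : 0 < eps / 2) by (pose proof (cond_pos eps); lra).
  destruct (HL (4 * N)%nat (mkposreal _ He) m) as [k [Hk Hj]]; simpl in Hj.
  exists k. split; [exact Hk|]. intros n Hn.
  assert (J : forall i, (i < 4)%nat -> Rabs (x k (4 * n + i)%nat - L (4 * n + i)%nat) < eps / 2).
  { intros i Hi. apply Hj. lia. }
  assert (J0 := J 0%nat ltac:(lia)). assert (J1 := J 1%nat ltac:(lia)).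
  assert (J2 := J 2%nat ltac:(lia)). assert (J3 := J 3%nat ltac:(lia)).
  rewrite Hx in J0, J1, J2, J3 by lia.
  split.
  - eapply Rle_lt_trans; [apply Cmod_le_abs_sum|].
    change (Rabs (Re (c1 k n) - L (4 * n + 0)%nat) + Rabs (Im (c1 k n) - L (4 * n + 1)%nat) < eps). lra.
  - eapply Rle_lt_trans; [apply Cmod_le_abs_sum|].
    change (Rabs (Re (c2 k n) - L (4 * n + 2)%nat) + Rabs (Im (c2 k n) - L (4 * n + 3)%nat) < eps). lra.
Qed.

(** * Holomorphic discs in the tube *)

(** The radius is a parameter: [rho] = 1 fits competitors for [kobayashi], and [rho] > 1 is what the
    coefficient estimates need. *)
Definition tube_disc (rho : R) (f1 f2 : C -> C) (l1 l2 : C) : Prop :=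
  holomorphic_within rho f1 /\ holomorphic_within rho f2 /\
  (forall z, Cmod z < rho -> ball2 (Re (f1 z), Re (f2 z))) /\
  (f1 (RtoC 0) = RtoC 0 /\ f2 (RtoC 0) = RtoC 0) /\
  C_diff_at f1 (RtoC 0) l1 /\ C_diff_at f2 (RtoC 0) l2.

Lemma ball2_lt_1 (p : R * R) : ball2 p -> fst p <= 1 /\ snd p <= 1.
Proof. unfold ball2. intros H. split; nra. Qed.

Lemma tube_disc_coefficients (rho : R) (f1 f2 : C -> C) (l1 l2 : C) :
  1 < rho -> tube_disc rho f1 f2 l1 l2 ->
  exists c1 c2 : nat -> C,
    (c1 0%nat = RtoC 0 /\ c2 0%nat = RtoC 0) /\ (c1 1%nat = l1 /\ c2 1%nat = l2) /\
    (forall n, Cmod (c1 n) <= 4 /\ Cmod (c2 n) <= 4) /\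
    forall z, Cmod z < 1 -> ball2 (Re (power_series c1 z), Re (power_series c2 z)).
Proof.
  intros Hrho [H1 [H2 [HB [[Z1 Z2] [D1 D2]]]]].
  destruct (taylor_power_series rho f1 l1) as [c1 [A1 [B1 [M1 P1]]]]; try assumption.
  { intros z Hz. apply (ball2_lt_1 _ (HB z Hz)). }
  destruct (taylor_power_series rho f2 l2) as [c2 [A2 [B2 [M2 P2]]]]; try assumption.
  { intros z Hz. apply (ball2_lt_1 _ (HB z Hz)). }
  exists c1, c2. repeat split; try assumption; try apply M1; try apply M2.
  intros z Hz. rewrite <- P1, <- P2 by exact Hz. apply HB. lra.
Qed.

(** The closed ball is given by its supporting half-planes, and such linear inequalities pass to
    limits. If the boundary were reached at z, the combination of f1 and f2 in that direction would
    have real part 1 there, hence also at 0, where it is 0. *)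
Lemma ball2_strict (f1 f2 : C -> C) :
  holomorphic_within 1 f1 -> holomorphic_within 1 f2 ->
  f1 (RtoC 0) = RtoC 0 -> f2 (RtoC 0) = RtoC 0 ->
  (forall p q z, p ^ 2 + q ^ 2 = 1 -> Cmod z < 1 -> p * Re (f1 z) + q * Re (f2 z) <= 1) ->
  forall z, Cmod z < 1 -> ball2 (Re (f1 z), Re (f2 z)).
Proof.
  intros H1 H2 Z1 Z2 Hle z Hz. unfold ball2; simpl fst; simpl snd.
  apply Rnot_le_lt. intros Hge.
  set (x := Re (f1 z)) in *. set (y := Re (f2 z)) in *.
  set (r := sqrt (x ^ 2 + y ^ 2)).
  assert (Hr2 : r * r = x ^ 2 + y ^ 2) by (apply sqrt_sqrt; lra).
  assert (Hr : 1 <= r) by (rewrite <- sqrt_1; apply sqrt_le_1_alt; exact Hge).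
  assert (Hpq : (x / r) ^ 2 + (y / r) ^ 2 = 1).
  { replace ((x / r) ^ 2 + (y / r) ^ 2) with ((x ^ 2 + y ^ 2) / (r * r)) by (field; lra).
    rewrite Hr2. field. lra. }
  assert (Hxy : x / r * x + y / r * y = r).
  { replace (x / r * x + y / r * y) with ((x ^ 2 + y ^ 2) / r) by (field; lra).
    rewrite <- Hr2. field. lra. }
  assert (Hr1 : r = 1).
  { apply Rle_antisym; [|exact Hr]. rewrite <- Hxy. exact (Hle _ _ z Hpq Hz). }
  set (h := fun w => (RtoC (x / r) * f1 w + RtoC (y / r) * f2 w)%C).
  assert (Hre : forall w, Re (h w) = x / r * Re (f1 w) + y / r * Re (f2 w)).
  { intros w. unfold h. simpl. unfold Re, Im. ring. }
  assert (E : h (RtoC 0) = h z).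
  { apply re_maximum_principle; [| |exact Hz|].
    - intros w Hw. destruct (H1 w Hw) as [l1 L1], (H2 w Hw) as [l2 L2]. eexists.
      apply (C_diff_at_plus (fun w => RtoC (x / r) * f1 w)%C (fun w => RtoC (y / r) * f2 w)%C).
      + apply (C_diff_at_mult (fun _ => RtoC (x / r)) f1); [apply C_diff_at_const|exact L1].
      + apply (C_diff_at_mult (fun _ => RtoC (y / r)) f2); [apply C_diff_at_const|exact L2].
    - intros w Hw. rewrite Hre. apply Hle; assumption.
    - rewrite Hre. fold x y. lra. }
  apply (f_equal Re) in E. rewrite !Hre, Z1, Z2 in E. fold x y in E. simpl in E. lra.
Qed.

(* A normal-families argument on Taylor coefficients, which are bounded by 4. *)
Lemma tube_disc_limit (l1 l2 : C) :
  (forall s, 0 < s < 1 -> exists rho f1 f2,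
     1 < rho /\ tube_disc rho f1 f2 (RtoC s * l1)%C (RtoC s * l2)%C) ->
  exists d1 d2 : nat -> C,
    (unit_radius d1 /\ unit_radius d2) /\
    (d1 0%nat = RtoC 0 /\ d2 0%nat = RtoC 0) /\ (d1 1%nat = l1 /\ d2 1%nat = l2) /\
    forall z, Cmod z < 1 -> ball2 (Re (power_series d1 z), Re (power_series d2 z)).
Proof.
  intros H.
  (* The 2 keeps every factor, including the one for k = 0, strictly between 0 and 1. *)
  set (s := fun k => 1 - / (INR k + 2)).
  assert (Hk : forall k, 0 < / (INR k + 2) < 1).
  { intros k. pose proof (pos_INR k). split; [apply Rinv_0_lt_compat; lra|].
    rewrite <- Rinv_1. apply Rinv_lt_contravar; lra. }
  destruct (choice (fun (k : nat) (c : (nat -> C) * (nat -> C)) =>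
    (fst c 0%nat = RtoC 0 /\ snd c 0%nat = RtoC 0) /\
    (fst c 1%nat = (RtoC (s k) * l1)%C /\ snd c 1%nat = (RtoC (s k) * l2)%C) /\
    (forall n, Cmod (fst c n) <= 4 /\ Cmod (snd c n) <= 4) /\
    forall z, Cmod z < 1 -> ball2 (Re (power_series (fst c) z), Re (power_series (snd c) z))))
    as [c Hc].
  { intros k. destruct (H (s k)) as [rho [f1 [f2 [Hrho Hf]]]].
    { unfold s. specialize (Hk k). lra. }
    destruct (tube_disc_coefficients _ _ _ _ _ Hrho Hf) as [c1 [c2 Hc]].
    exists (c1, c2). exact Hc. }
  destruct (adherent_pair_sequence (fun k => fst (c k)) (fun k => snd (c k)) 4) as [d1 [d2 Hd]].
  { intros k n. apply (Hc k). }
  { intros k n. apply (Hc k). }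
  (* Each limit coefficient is within 1 of one bounded by 4; the crude 5 serves both sequences
     below. *)
  assert (Hd5 : forall n, Cmod (d1 n) <= 5 /\ Cmod (d2 n) <= 5).
  { intros n. destruct (Hd (S n) 0%nat (mkposreal 1 Rlt_0_1)) as [k [_ Hn]].
    destruct (Hn n ltac:(lia)) as [N1 N2]; simpl in N1, N2.
    destruct (Hc k) as [_ [_ [Hb _]]]. destruct (Hb n) as [b1 b2].
    split.
    - pose proof (Cmod_triangle (- (fst (c k) n - d1 n)) (fst (c k) n)) as T.
      rewrite Cmod_opp in T.
      replace (- (fst (c k) n - d1 n) + fst (c k) n)%C with (d1 n) in T by ring. lra.
    - pose proof (Cmod_triangle (- (snd (c k) n - d2 n)) (snd (c k) n)) as T.
      rewrite Cmod_opp in T.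
      replace (- (snd (c k) n - d2 n) + snd (c k) n)%C with (d2 n) in T by ring. lra. }
  assert (U1 : unit_radius d1) by (apply (bounded_unit_radius d1 5); intros n; apply Hd5).
  assert (U2 : unit_radius d2) by (apply (bounded_unit_radius d2 5); intros n; apply Hd5).
  assert (E0 : d1 0%nat = RtoC 0 /\ d2 0%nat = RtoC 0).
  { split; symmetry; apply Cmod_small_eq; intros eps;
      destruct (Hd 1%nat 0%nat eps) as [k [_ Hn]]; destruct (Hn 0%nat ltac:(lia)) as [N1 N2];
      destruct (Hc k) as [[A1 A2] _].
    - cbv beta in N1. rewrite A1 in N1. lra.
    - cbv beta in N2. rewrite A2 in N2. lra. }
  assert (E1 : d1 1%nat = l1 /\ d2 1%nat = l2).
  (* Closeness at arbitrarily late k is essential: [s k] has to be near 1. *)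
  { assert (Hlim : forall (l d : C), (forall (m : nat) (eps : posreal), exists k, (m <= k)%nat /\
        Cmod (RtoC (s k) * l - d) < eps) -> d = l).
    { intros l d HH. symmetry. apply Cmod_small_eq. intros eps.
      assert (He : 0 < eps / 2) by (pose proof (cond_pos eps); lra).
      assert (He' : 0 < eps / 2 / (Cmod l + 1)).
      { apply Rdiv_lt_0_compat; [lra|]. pose proof (Cmod_ge_0 l); lra. }
      destruct (archimed_cor1 _ He') as [m [Hm Hmp]].
      destruct (HH m (mkposreal _ He)) as [k [Hmk Hkl]]; simpl in Hkl.
      replace (l - d)%C with ((RtoC (s k) * l - d) + RtoC (/ (INR k + 2)) * l)%C
        by (unfold s; rewrite RtoC_minus; ring).
      eapply Rle_trans; [apply Cmod_triangle|].
      rewrite Cmod_mult, Cmod_R, (Rabs_pos_eq (/ (INR k + 2))) by (specialize (Hk k); lra).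
      assert (Hi : / (INR k + 2) <= / INR m).
      { apply Rinv_le_contravar; [apply lt_0_INR; lia|].
        assert (INR m <= INR k) by (apply le_INR; lia). lra. }
      apply Rlt_div_r in Hm; [|pose proof (Cmod_ge_0 l); lra].
      pose proof (Cmod_ge_0 l). specialize (Hk k). nra. }
    split; apply Hlim; intros m eps; destruct (Hd 2%nat m eps) as [k [Hmk Hn]];
      exists k; (split; [exact Hmk|]); destruct (Hn 1%nat ltac:(lia)) as [N1 N2];
      destruct (Hc k) as [_ [[A1 A2] _]]; cbv beta in N1, N2.
    - rewrite A1 in N1. exact N1.
    - rewrite A2 in N2. exact N2. }
  exists d1, d2. repeat split; try assumption; try apply E0; try apply E1.
  apply ball2_strict.
  - exact (power_series_holomorphic_n 0 d1 U1).
  - exact (power_series_holomorphic_n 0 d2 U2).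
  - rewrite power_series_0 by exact U1. apply E0.
  - rewrite power_series_0 by exact U2. apply E0.
  - intros p q z Hpq Hz. apply Rnot_lt_le. intros Hgt.
    set (x := Re (power_series d1 z)) in *. set (y := Re (power_series d2 z)) in *.
    (* Each of the two coordinates loses at most a third of the excess, so the approximating disc
       would still exceed 1. *)
    assert (He : 0 < (p * x + q * y - 1) / 3) by lra.
    destruct (power_series_close 5 z (mkposreal _ He)) as [N [eta Hclose]]; [lra|exact Hz|].
    destruct (Hd N 0%nat eta) as [k [_ Hn]].
    destruct (Hc k) as [_ [_ [Hb HB]]].
    assert (Hb5 : forall n, Cmod (fst (c k) n) <= 5 /\ Cmod (snd (c k) n) <= 5)
      by (intros n; specialize (Hb n); lra).
    assert (C1 := Hclose (fst (c k)) d1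
      (fun n => proj1 (Hb5 n))
      (fun n => proj1 (Hd5 n)) (fun n Hlt => proj1 (Hn n Hlt))).
    assert (C2 := Hclose (snd (c k)) d2
      (fun n => proj2 (Hb5 n))
      (fun n => proj2 (Hd5 n)) (fun n Hlt => proj2 (Hn n Hlt))).
    simpl in C1, C2. specialize (HB z Hz).
    change (Re (power_series (fst (c k)) z) ^ 2 + Re (power_series (snd (c k)) z) ^ 2 < 1) in HB.
    assert (R1 := Rle_lt_trans _ _ _ (re_le_Cmod _) C1).
    assert (R2 := Rle_lt_trans _ _ _ (re_le_Cmod _) C2).
    set (x' := Re (power_series (fst (c k)) z)) in *.
    set (y' := Re (power_series (snd (c k)) z)) in *.
    change (Re (power_series (fst (c k)) z - power_series d1 z)) with (x' - x) in R1.
    change (Re (power_series (snd (c k)) z - power_series d2 z)) with (y' - y) in R2.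
    clearbody x' y'.
    (* From 2 (p x' + q y') <= p^2 + q^2 + x'^2 + y'^2. *)
    assert (K1 : p * x' + q * y' <= 1).
    { pose proof (pow2_ge_0 (p - x')). pose proof (pow2_ge_0 (q - y')). lra. }
    assert (Hprod : forall u v e, u ^ 2 <= 1 -> Rabs v < e -> - e <= u * v).
    { intros u v e0 Hu Hv. assert (Rabs u <= 1).
      { apply Rabs_le. split; nra. }
      pose proof (Rabs_pos u). pose proof (Rabs_pos v).
      assert (Huv : Rabs (u * v) <= e0) by (rewrite Rabs_mult; nra).
      apply Rabs_le_between in Huv. lra. }
    assert (K2 := Hprod p _ _ ltac:(pose proof (pow2_ge_0 q); lra) R1).
    assert (K3 := Hprod q _ _ ltac:(pose proof (pow2_ge_0 p); lra) R2).
    lra.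
Qed.

(** * Rotations and the Kobayashi metric of the tube *)

Lemma tube_disc_scale (f1 f2 : C -> C) (l1 l2 : C) (sigma : R) :
  0 < sigma -> tube_disc 1 f1 f2 l1 l2 ->
  tube_disc (/ sigma) (fun z => f1 (RtoC sigma * z)%C) (fun z => f2 (RtoC sigma * z)%C)
    (RtoC sigma * l1)%C (RtoC sigma * l2)%C.
Proof.
  intros Hs [H1 [H2 [HB [[Z1 Z2] [D1 D2]]]]].
  assert (Hmod : forall z, Cmod z < / sigma -> Cmod (RtoC sigma * z) < 1).
  { intros z Hz. rewrite Cmod_mult, Cmod_R, Rabs_pos_eq by lra.
    apply (Rmult_lt_compat_l sigma) in Hz; [|lra]. rewrite Rinv_r in Hz; lra. }
  assert (Hlin : forall z, C_diff_at (fun w => RtoC sigma * w)%C z (RtoC sigma)).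
  { intros z. apply (C_diff_at_ext_within (Cmod z + 1) (fun w => RtoC 0 + RtoC sigma * w)%C);
      [lra|intros w _; ring|apply C_diff_at_affine]. }
  assert (E0 : (RtoC sigma * RtoC 0)%C = RtoC 0) by ring.
  unfold tube_disc. rewrite E0.
  split; [|split; [|split; [|split; [|split]]]].
  - intros z Hz. destruct (H1 _ (Hmod z Hz)) as [l Hl]. eexists.
    apply (C_diff_at_comp f1 (fun w => RtoC sigma * w)%C); [exact Hl|apply Hlin].
  - intros z Hz. destruct (H2 _ (Hmod z Hz)) as [l Hl]. eexists.
    apply (C_diff_at_comp f2 (fun w => RtoC sigma * w)%C); [exact Hl|apply Hlin].
  - intros z Hz. apply HB, Hmod, Hz.
  - split; assumption.
  - apply (C_diff_at_comp f1 (fun w => RtoC sigma * w)%C); [rewrite E0; exact D1|apply Hlin].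
  - apply (C_diff_at_comp f2 (fun w => RtoC sigma * w)%C); [rewrite E0; exact D2|apply Hlin].
Qed.

(** The target is rotated by a real matrix, which acts on real parts alone and so preserves the tube
    over a round disc. *)
Lemma tube_disc_rotate (rho : R) (f1 f2 : C -> C) (l1 l2 e : C) (c s : R) :
  tube_disc rho f1 f2 l1 l2 -> Cmod e = 1 -> c ^ 2 + s ^ 2 = 1 ->
  exists g1 g2, tube_disc rho g1 g2
    (e * (RtoC c * l1 - RtoC s * l2))%C (e * (RtoC s * l1 + RtoC c * l2))%C.
Proof.
  intros [H1 [H2 [HB [[Z1 Z2] [D1 D2]]]]] He Hcs.
  assert (Hcomb : forall (p q : R) z m1 m2,
    C_diff_at f1 (e * z)%C m1 -> C_diff_at f2 (e * z)%C m2 ->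
    C_diff_at (fun w => RtoC p * f1 (e * w) + RtoC q * f2 (e * w))%C z
      (e * (RtoC p * m1 + RtoC q * m2))%C).
  { intros p q z m1 m2 M1 M2.
    assert (Hlin : C_diff_at (fun w => e * w)%C z e).
    { apply (C_diff_at_ext_within (Cmod z + 1) (fun w => RtoC 0 + e * w)%C);
        [lra|intros w _; ring|apply C_diff_at_affine]. }
    assert (K1 := C_diff_at_mult (fun _ => RtoC p) (fun w => f1 (e * w)%C) z _ _
      (C_diff_at_const (RtoC p) z) (C_diff_at_comp f1 (fun w => e * w)%C z _ _ M1 Hlin)).
    assert (K2 := C_diff_at_mult (fun _ => RtoC q) (fun w => f2 (e * w)%C) z _ _
      (C_diff_at_const (RtoC q) z) (C_diff_at_comp f2 (fun w => e * w)%C z _ _ M2 Hlin)).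
    assert (K := C_diff_at_plus _ _ z _ _ K1 K2). cbv beta in K.
    match type of K with C_diff_at _ _ ?l =>
      replace l with (e * (RtoC p * m1 + RtoC q * m2))%C in K by ring end.
    exact K. }
  assert (Hmod : forall z, Cmod (e * z) = Cmod z) by (intros z; rewrite Cmod_mult, He; ring).
  assert (E0 : (e * RtoC 0)%C = RtoC 0) by ring.
  exists (fun w => RtoC c * f1 (e * w) + RtoC (- s) * f2 (e * w))%C,
    (fun w => RtoC s * f1 (e * w) + RtoC c * f2 (e * w))%C.
  split; [|split; [|split; [|split; [|split]]]].
  - intros z Hz. rewrite <- Hmod in Hz. destruct (H1 _ Hz) as [m1 M1], (H2 _ Hz) as [m2 M2].
    eexists. apply Hcomb; eassumption.
  - intros z Hz. rewrite <- Hmod in Hz. destruct (H1 _ Hz) as [m1 M1], (H2 _ Hz) as [m2 M2].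
    eexists. apply Hcomb; eassumption.
  - intros z Hz. rewrite <- Hmod in Hz. specialize (HB _ Hz).
    change (Re (f1 (e * z)%C) ^ 2 + Re (f2 (e * z)%C) ^ 2 < 1) in HB.
    change (Re (RtoC c * f1 (e * z) + RtoC (- s) * f2 (e * z))%C ^ 2 +
      Re (RtoC s * f1 (e * z) + RtoC c * f2 (e * z))%C ^ 2 < 1).
    set (x := Re (f1 (e * z)%C)) in *. set (y := Re (f2 (e * z)%C)) in *.
    replace (Re (RtoC c * f1 (e * z) + RtoC (- s) * f2 (e * z))%C) with (c * x - s * y)
      by (simpl; unfold x, y, Re, Im; ring).
    replace (Re (RtoC s * f1 (e * z) + RtoC c * f2 (e * z))%C) with (s * x + c * y)
      by (simpl; unfold x, y, Re, Im; ring).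
    replace ((c * x - s * y) ^ 2 + (s * x + c * y) ^ 2) with ((c ^ 2 + s ^ 2) * (x ^ 2 + y ^ 2)) by ring.
    rewrite Hcs. lra.
  - rewrite E0, Z1, Z2. split; ring.
  - replace (e * (RtoC c * l1 - RtoC s * l2))%C with (e * (RtoC c * l1 + RtoC (- s) * l2))%C
      by (rewrite RtoC_opp; ring).
    apply Hcomb; rewrite E0; assumption.
  - apply Hcomb; rewrite E0; assumption.
Qed.

(** Half-angle formulas; the sign of y decides the sign of the imaginary part. *)
Lemma unit_square_root (p : C) : Cmod p = 1 -> exists w : C, (w * w = p)%C /\ Cmod w = 1.
Proof.
  intros Hp. destruct p as [x y].
  assert (Hxy : x ^ 2 + y ^ 2 = 1).
  { assert (E := Cmod2_alt (x, y)). rewrite Hp in E. simpl in E |- *. lra. }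
  assert (Hx : -1 <= x <= 1) by (split; nra).
  assert (S1 := sqrt_sqrt ((1 + x) / 2) ltac:(lra)).
  assert (S2 := sqrt_sqrt ((1 - x) / 2) ltac:(lra)).
  set (c := sqrt ((1 + x) / 2)) in *. set (s := sqrt ((1 - x) / 2)) in *.
  assert (Hcs : c * s = Rabs y / 2).
  { unfold c, s. rewrite <- sqrt_mult_alt by lra.
    replace ((1 + x) / 2 * ((1 - x) / 2)) with (Rsqr (y / 2)).
    - rewrite sqrt_Rsqr_abs. unfold Rdiv. rewrite Rabs_mult, (Rabs_pos_eq (/ 2)); lra.
    - unfold Rsqr. replace (y / 2 * (y / 2)) with (y ^ 2 / 4) by field.
      replace (y ^ 2) with (1 - x ^ 2) by lra. field. }
  assert (HW : exists w : C, (w * w = (x, y))%C).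
  { destruct (Rle_dec 0 y) as [Hy|Hy].
    - rewrite Rabs_pos_eq in Hcs by lra. exists (c, s).
      apply injective_projections; simpl; lra.
    - rewrite Rabs_left in Hcs by lra. exists (c, - s).
      apply injective_projections; simpl; lra. }
  destruct HW as [w Hw]. exists w. split; [exact Hw|].
  apply (f_equal Cmod) in Hw. rewrite Cmod_mult, Hp in Hw.
  pose proof (Cmod_ge_0 w). nra.
Qed.

Lemma unit_phase (a : C) : exists q : C, Cmod q = 1 /\ (a * q = RtoC (Cmod a))%C.
Proof.
  destruct (Req_dec (Cmod a) 0) as [H0|H0].
  - exists (RtoC 1). split; [apply Cmod_1|]. rewrite H0. rewrite (Cmod_eq_0 a H0). ring.
  - assert (HR : RtoC (Cmod a) <> RtoC 0) by (intros E; apply RtoC_inj in E; lra).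
    exists (Cconj a / RtoC (Cmod a))%C. split.
    + rewrite Cmod_div, Cmod_conj, Cmod_R, Rabs_pos_eq by (try exact HR; apply Cmod_ge_0).
      field. exact H0.
    + replace (a * (Cconj a / RtoC (Cmod a)))%C with ((a * Cconj a) / RtoC (Cmod a))%C
        by (field; exact HR).
      rewrite <- Cmod2_conj, RtoC_pow. simpl. field. exact HR.
Qed.

Lemma Cmod_1_conj (w : C) : Cmod w = 1 -> (w * Cconj w = 1)%C.
Proof.
  intros H. rewrite <- Cmod2_conj, H. apply f_equal. ring.
Qed.

(* The pair (f1, f2) with u = Re f1 + i Re f2 has derivative (b + conj a, i (conj a - b));
   the phases of b and conj a are removed by rotating the source and the target. *)
Lemma rotation_parameters (a b : C) :
  exists (e : C) (c s : R), Cmod e = 1 /\ c ^ 2 + s ^ 2 = 1 /\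
    (e * (RtoC c * (b + Cconj a) - RtoC s * (Ci * (Cconj a - b))) =
       RtoC (Cmod a + Cmod b))%C /\
    (e * (RtoC s * (b + Cconj a) + RtoC c * (Ci * (Cconj a - b))) =
       Ci * RtoC (Cmod a - Cmod b))%C.
Proof.
  destruct (unit_phase b) as [p [Hp1 Hp]].
  destruct (unit_phase (Cconj a)) as [q [Hq1 Hq]]. rewrite Cmod_conj in Hq.
  (* For w = c + i s the rotated pair is a combination of b e w and conj(a) e conj(w). Asking e w =
     p and e conj(w) = q gives w^2 = p conj(q) and e = p conj(w). *)
  destruct (unit_square_root (p * Cconj q)%C) as [w [Hw Hw1]].
  { rewrite Cmod_mult, Cmod_conj, Hp1, Hq1. ring. }
  assert (Cw := Cmod_1_conj w Hw1). assert (Cp := Cmod_1_conj p Hp1).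
  exists (p * Cconj w)%C, (Re w), (Im w).
  assert (E1 : (p * Cconj w * w = p)%C).
  { replace (p * Cconj w * w)%C with (p * (w * Cconj w))%C by ring. rewrite Cw. ring. }
  assert (E2 : (p * Cconj w * Cconj w = q)%C).
  { replace (p * Cconj w * Cconj w)%C with (p * Cconj (w * w))%C by (rewrite Cmult_conj; ring).
    rewrite Hw, Cmult_conj, Cconj_conj.
    replace (p * (Cconj p * q))%C with ((p * Cconj p) * q)%C by ring. rewrite Cp. ring. }
  split; [rewrite Cmod_mult, Cmod_conj, Hp1, Hw1; ring|].
  split; [rewrite <- Cmod2_alt, Hw1; ring|].
  assert (F1 : forall A B : C, (RtoC (Re w) * (B + A) - RtoC (Im w) * (Ci * (A - B)) =
    B * w + A * Cconj w)%C).
  { intros A B. apply injective_projections; simpl; unfold Re, Im; ring. }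
  assert (F2 : forall A B : C, (RtoC (Im w) * (B + A) + RtoC (Re w) * (Ci * (A - B)) =
    Ci * (A * Cconj w - B * w))%C).
  { intros A B. apply injective_projections; simpl; unfold Re, Im; ring. }
  rewrite F1, F2, RtoC_plus, RtoC_minus, <- Hp, <- Hq.
  set (A := Cconj a).
  split.
  - transitivity (b * (p * Cconj w * w) + A * (p * Cconj w * Cconj w))%C; [ring|].
    rewrite E1, E2. ring.
  - transitivity (Ci * (A * (p * Cconj w * Cconj w) - b * (p * Cconj w * w)))%C; [ring|].
    rewrite E1, E2. ring.
Qed.

(** Shaped to match [tube_disc_rotate] with parameters conj(e), c and -s. *)
Lemma rotation_inverse (e l1 l2 : C) (c s : R) :
  Cmod e = 1 -> c ^ 2 + s ^ 2 = 1 ->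
  let m1 := (e * (RtoC c * l1 - RtoC s * l2))%C in
  let m2 := (e * (RtoC s * l1 + RtoC c * l2))%C in
  (Cconj e * (RtoC c * m1 - RtoC (- s) * m2) = l1)%C /\
  (Cconj e * (RtoC (- s) * m1 + RtoC c * m2) = l2)%C.
Proof.
  intros He Hcs m1 m2. assert (Ce := Cmod_1_conj e He).
  assert (Ccs : (RtoC c * RtoC c + RtoC s * RtoC s = 1)%C).
  { rewrite <- !RtoC_mult, <- RtoC_plus. f_equal. rewrite <- Hcs. ring. }
  unfold m1, m2. rewrite RtoC_opp. split.
  - transitivity ((e * Cconj e) * (RtoC c * RtoC c + RtoC s * RtoC s) * l1)%C; [ring|].
    rewrite Ce, Ccs. ring.
  - transitivity ((e * Cconj e) * (RtoC c * RtoC c + RtoC s * RtoC s) * l2)%C; [ring|].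
    rewrite Ce, Ccs. ring.
Qed.

(** * Discs, the indicatrix and harmonic maps *)

(** The product norm is Euclidean: it dominates each component and is dominated by their sum. *)
Lemma is_derive_C2 (f : C -> C2) (z : C) (l : C2) :
  is_derive (K := C_AbsRing) f z l <->
  C_diff_at (fun w => fst (f w)) z (fst l) /\ C_diff_at (fun w => snd (f w)) z (snd l).
Proof.
  split.
  - intros [_ H].
    assert (Hb : forall eps : posreal, exists delta : posreal, forall w, Cmod (w - z) < delta ->
      sqrt (Cmod (fst (f w) - fst (f z) - (w - z) * fst l) ^ 2 +
            Cmod (snd (f w) - snd (f z) - (w - z) * snd l) ^ 2) <= eps * Cmod (w - z)).
    { intros eps. destruct (H z (fun P HP => HP) eps) as [d Hd]. exists d. exact Hd. }
    split; intros eps; destruct (Hb eps) as [d Hd]; exists d; intros w Hw;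
      specialize (Hd w Hw); (eapply Rle_trans; [|exact Hd]);
      rewrite Cmult_comm;
      (apply Rsqr_incr_0; [|apply Cmod_ge_0|apply sqrt_pos]);
      (rewrite Rsqr_sqrt; [|apply Rplus_le_le_0_compat; apply pow2_ge_0]);
      rewrite Rsqr_pow2.
    + pose proof (pow2_ge_0 (Cmod (snd (f w) - snd (f z) - (w - z) * snd l))). lra.
    + pose proof (pow2_ge_0 (Cmod (fst (f w) - fst (f z) - (w - z) * fst l))). lra.
  - intros [H1 H2]. split; [apply is_linear_scal_l|].
    intros x Hx. apply (is_filter_lim_locally_unique (K := C_AbsRing)
      (V := AbsRing_NormedModule C_AbsRing)) in Hx. subst x.
    intros eps. assert (He : 0 < eps / 2) by (pose proof (cond_pos eps); lra).
    destruct (H1 (mkposreal _ He)) as [d1 D1], (H2 (mkposreal _ He)) as [d2 D2].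
    simpl in D1, D2.
    exists (mkposreal _ (Rmin_stable_in_posreal d1 d2)). intros w Hw.
    change (Cmod (w - z) < Rmin d1 d2) in Hw.
    specialize (D1 w ltac:(eapply Rlt_le_trans; [exact Hw|apply Rmin_l])).
    specialize (D2 w ltac:(eapply Rlt_le_trans; [exact Hw|apply Rmin_r])).
    change (sqrt (Cmod (fst (f w) - fst (f z) - (w - z) * fst l) ^ 2 +
      Cmod (snd (f w) - snd (f z) - (w - z) * snd l) ^ 2) <= eps * Cmod (w - z)).
    rewrite !(Cmult_comm (w - z)).
    set (A := Cmod (fst (f w) - fst (f z) - fst l * (w - z))) in *.
    set (B := Cmod (snd (f w) - snd (f z) - snd l * (w - z))) in *.
    assert (0 <= A) by apply Cmod_ge_0. assert (0 <= B) by apply Cmod_ge_0.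
    change (A <= eps / 2 * Cmod (w - z)) in D1. change (B <= eps / 2 * Cmod (w - z)) in D2.
    apply Rle_trans with (A + B); [|lra].
    rewrite <- (sqrt_Rsqr (A + B)) by lra. apply sqrt_le_1_alt. unfold Rsqr. nra.
Qed.

Lemma tube_disc_frakK (f1 f2 : C -> C) (x y : R) :
  tube_disc 1 f1 f2 (RtoC x) (Ci * RtoC y)%C -> frakK (x, y).
Proof.
  intros [H1 [H2 [HB [[Z1 Z2] [D1 D2]]]]].
  unfold frakK, indicatrix, kobayashi. simpl fst; simpl snd.
  apply Glb_Rbar_correct. split; [lra|].
  exists (fun z => (f1 z, f2 z)), (RtoC x, (Ci * RtoC y)%C).
  split; [|split; [|split]].
  - intros z Hz. split; [exact (HB z Hz)|].
    destruct (H1 z Hz) as [l1 L1], (H2 z Hz) as [l2 L2].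
    exists (l1, l2). apply is_derive_C2. split; assumption.
  - rewrite Z1, Z2. reflexivity.
  - apply is_derive_C2. split; assumption.
  - apply injective_projections; [change (RtoC 1 * RtoC x = RtoC x)%C|
      change (RtoC 1 * (Ci * RtoC y) = Ci * RtoC y)%C]; ring.
Qed.

(** As the infimum is at most 1 < 1 / s, some competitor has t < 1 / s. Dilating its disc by s t
    gives the derivative s X on the radius 1 / (s t) > 1. *)
Lemma frakK_tube_disc (x y s : R) :
  frakK (x, y) -> 0 < s < 1 -> exists rho f1 f2,
    1 < rho /\ tube_disc rho f1 f2 (RtoC s * RtoC x)%C (RtoC s * (Ci * RtoC y))%C.
Proof.
  intros HK Hs. unfold frakK, indicatrix, kobayashi in HK. simpl fst in HK; simpl snd in HK.
  match type of HK with Rbar_le (Glb_Rbar ?E) _ => set (S := E) in HK end.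
  assert (Hex : exists t, S t /\ t < / s).
  { apply NNPP. intros Hn.
    destruct (Glb_Rbar_correct S) as [_ Hg].
    assert (Hlb : is_lb_Rbar S (/ s)).
    { intros t Ht. simpl. apply Rnot_lt_le. intros Hlt. apply Hn. exists t. split; assumption. }
    assert (Hle := Rbar_le_trans _ _ _ (Hg _ Hlb) HK). simpl in Hle.
    assert (1 < / s) by (rewrite <- Rinv_1; apply Rinv_lt_contravar; lra). lra. }
  destruct Hex as [t [[Ht [f [l [Hf [Hf0 [Hl HX]]]]]] Hts]].
  assert (Hst : 0 < s * t < 1).
  { split; [apply Rmult_lt_0_compat; lra|].
    apply (Rmult_lt_compat_l s) in Hts; [|lra]. rewrite Rinv_r in Hts; lra. }
  assert (HT : tube_disc 1 (fun z => fst (f z)) (fun z => snd (f z)) (fst l) (snd l)).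
  { apply is_derive_C2 in Hl.
    split; [|split; [|split; [|split; [|split]]]]; try apply Hl.
    - intros z Hz. destruct (Hf z Hz) as [_ [m Hm]]. apply is_derive_C2 in Hm.
      exists (fst m). apply Hm.
    - intros z Hz. destruct (Hf z Hz) as [_ [m Hm]]. apply is_derive_C2 in Hm.
      exists (snd m). apply Hm.
    - intros z Hz. exact (proj1 (Hf z Hz)).
    - rewrite Hf0. split; reflexivity. }
  apply (tube_disc_scale _ _ _ _ (s * t)) in HT; [|lra].
  assert (X1 : (RtoC t * fst l = RtoC x)%C) by exact (f_equal fst HX).
  assert (X2 : (RtoC t * snd l = Ci * RtoC y)%C) by exact (f_equal snd HX).
  exists (/ (s * t)), (fun z => fst (f (RtoC (s * t) * z)%C)),
    (fun z => snd (f (RtoC (s * t) * z)%C)).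
  split; [rewrite <- Rinv_1; apply Rinv_lt_contravar; lra|].
  rewrite <- X1, <- X2, !Cmult_assoc, <- !RtoC_mult. exact HT.
Qed.

(** The function completing u_j has derivative u_jx - i u_jy. In the interchanged Wirtinger
    convention these are dbar u + conj(d u) for j = 1 and i (conj(d u) - dbar u) for j = 2. *)
Lemma harmonic_self_map_tube_disc (u : C -> C) :
  harmonic_self_map u -> u (RtoC 0) = RtoC 0 ->
  exists f1 f2, tube_disc 1 f1 f2
    (wirtinger_dbar u (RtoC 0) + Cconj (wirtinger_d u (RtoC 0)))%C
    (Ci * (Cconj (wirtinger_d u (RtoC 0)) - wirtinger_dbar u (RtoC 0)))%C.
Proof.
  intros [Hmap [HR HI]] Hu0.
  destruct (harmonic_conjugate _ HR) as [V1 [V10 H1]].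
  destruct (harmonic_conjugate _ HI) as [V2 [V20 H2]].
  exists (fun w => (Re (u w), V1 w)), (fun w => (Im (u w), V2 w)).
  assert (H01 : unit_disc (RtoC 0)) by (unfold unit_disc; rewrite Cmod_0; lra).
  split; [|split; [|split; [|split; [|split]]]].
  - intros z Hz. eexists. apply H1, Hz.
  - intros z Hz. eexists. apply H2, Hz.
  - intros z Hz. specialize (Hmap z Hz). apply unit_disc_in_disc in Hmap. exact Hmap.
  - rewrite V10, V20, Hu0. split; reflexivity.
  - replace (_ + _)%C with
      (Derive (fun s => Re (u (s, 0))) 0, - Derive (fun t => Re (u (0, t))) 0); [exact (H1 _ H01)|].
    unfold wirtinger_d, wirtinger_dbar, partial_x, partial_y.
    apply injective_projections; simpl; field.
  - replace (Ci * _)%C with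
      (Derive (fun s => Im (u (s, 0))) 0, - Derive (fun t => Im (u (0, t))) 0); [exact (H2 _ H01)|].
    unfold wirtinger_d, wirtinger_dbar, partial_x, partial_y.
    apply injective_projections; simpl; field.
Qed.

Lemma power_series_harmonic_self_map (d1 d2 : nat -> C) (a b : C) :
  unit_radius d1 -> unit_radius d2 ->
  d1 0%nat = RtoC 0 -> d2 0%nat = RtoC 0 ->
  d1 1%nat = (b + Cconj a)%C -> d2 1%nat = (Ci * (Cconj a - b))%C ->
  (forall z, Cmod z < 1 -> ball2 (Re (power_series d1 z), Re (power_series d2 z))) ->
  exists u : C -> C, harmonic_self_map u /\ u (RtoC 0) = RtoC 0 /\
    wirtinger_d u (RtoC 0) = a /\ wirtinger_dbar u (RtoC 0) = b.
Proof.
  intros U1 U2 Z1 Z2 E1 E2 HB.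
  set (f1 := power_series d1) in *. set (f2 := power_series d2) in *.
  (* An equality of functions is needed, since the rewriting takes place in the argument of
     [harmonic_on_disc]. *)
  assert (HRe : forall f : C -> C, (fun z => Re (f z)) = (fun z => lin 1 0 (f z))).
  { intros f. apply functional_extensionality. intros z. unfold lin. ring. }
  assert (H01 : Cmod (RtoC 0) < 1) by (rewrite Cmod_0; lra).
  assert (D1 := power_series_C_diff_at d1 (RtoC 0) U1 H01).
  assert (D2 := power_series_C_diff_at d2 (RtoC 0) U2 H01).
  rewrite power_series_0 in D1, D2 by (apply unit_radius_derive; assumption).
  replace (coef_derive d1 0) with (b + Cconj a)%C in D1
    by (unfold coef_derive; rewrite E1; simpl; ring).
  replace (coef_derive d2 0) with (Ci * (Cconj a - b))%C in D2
    by (unfold coef_derive; rewrite E2; simpl; ring).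
  assert (HDx : forall f l, C_diff_at f (RtoC 0) l -> Derive (fun s => Re (f (s, 0))) 0 = Re l).
  { intros f l Hl. assert (K := C_diff_at_is_derive_x f 0 0 1 0 l Hl).
    apply is_derive_unique in K. rewrite (Derive_ext _ (fun s => lin 1 0 (f (s, 0)))).
    - transitivity (lin 1 0 l); [exact K|unfold lin; ring].
    - intros t. unfold lin. ring. }
  assert (HDy : forall f l, C_diff_at f (RtoC 0) l -> Derive (fun t => Re (f (0, t))) 0 = - Im l).
  { intros f l Hl. assert (K := C_diff_at_is_derive_y f 0 0 1 0 l Hl).
    apply is_derive_unique in K. rewrite (Derive_ext _ (fun t => lin 1 0 (f (0, t)))).
    - transitivity (lin 0 (- (1)) l); [exact K|unfold lin; ring].
    - intros t. unfold lin. ring. }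
  exists (fun z => (Re (f1 z), Re (f2 z))).
  assert (X1 := HDx _ _ D1). assert (Y1 := HDy _ _ D1).
  assert (X2 := HDx _ _ D2). assert (Y2 := HDy _ _ D2).
  fold f1 in X1, Y1. fold f2 in X2, Y2.
  split; [|split; [|split]].
  - split; [|split].
    + intros z Hz. apply unit_disc_in_disc. exact (HB z Hz).
    + change (harmonic_on_disc (fun z => Re (f1 z))). rewrite HRe.
      apply harmonic_lin, power_series_holomorphic_n, U1.
    + change (harmonic_on_disc (fun z => Re (f2 z))). rewrite HRe.
      apply harmonic_lin, power_series_holomorphic_n, U2.
  - unfold f1, f2. rewrite !power_series_0, Z1, Z2 by assumption. reflexivity.
  - unfold wirtinger_d, partial_x, partial_y.
    change (RtoC (/ 2) * ((Derive (fun s => Re (f1 (s, 0))) 0, Derive (fun s => Re (f2 (s, 0))) 0) +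
      Ci * (Derive (fun t => Re (f1 (0, t))) 0, Derive (fun t => Re (f2 (0, t))) 0)) = a)%C.
    rewrite X1, X2, Y1, Y2. apply injective_projections; simpl; unfold Re, Im; field.
  - unfold wirtinger_dbar, partial_x, partial_y.
    change (RtoC (/ 2) * ((Derive (fun s => Re (f1 (s, 0))) 0, Derive (fun s => Re (f2 (s, 0))) 0) -
      Ci * (Derive (fun t => Re (f1 (0, t))) 0, Derive (fun t => Re (f2 (0, t))) 0)) = b)%C.
    rewrite X1, X2, Y1, Y2. apply injective_projections; simpl; unfold Re, Im; field.
Qed.

Theorem theorem16 (a b : C) :
  (exists u : C -> C,
     harmonic_self_map u /\ u (RtoC 0) = RtoC 0 /\
     wirtinger_d u (RtoC 0) = a /\ wirtinger_dbar u (RtoC 0) = b)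
  <-> frakK (Cmod a + Cmod b, Cmod a - Cmod b)%R.
Proof.
  destruct (rotation_parameters a b) as [e [c [s [He [Hcs [R1 R2]]]]]].
  split.
  - intros [u [Hu [Hu0 [Ha Hb]]]].
    destruct (harmonic_self_map_tube_disc u Hu Hu0) as [f1 [f2 Hf]].
    rewrite Ha, Hb in Hf.
    destruct (tube_disc_rotate _ _ _ _ _ e c s Hf He Hcs) as [g1 [g2 Hg]].
    rewrite R1, R2 in Hg. exact (tube_disc_frakK g1 g2 _ _ Hg).
  - intros HK.
    destruct (rotation_inverse e (b + Cconj a)%C (Ci * (Cconj a - b))%C c s He Hcs) as [I1 I2].
    rewrite R1, R2 in I1, I2.
    destruct (tube_disc_limit (b + Cconj a)%C (Ci * (Cconj a - b))%C)
      as [d1 [d2 [[U1 U2] [[Z1 Z2] [[E1 E2] HB]]]]].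
    + intros r Hr.
      destruct (frakK_tube_disc _ _ r HK Hr) as [rho [f1 [f2 [Hrho Hf]]]].
      destruct (tube_disc_rotate _ _ _ _ _ (Cconj e) c (- s) Hf) as [g1 [g2 Hg]].
      * rewrite Cmod_conj. exact He.
      * rewrite <- Hcs. ring.
      * exists rho, g1, g2. split; [exact Hrho|].
        (* The real factor r commutes with both rotations, so undoing them on the scaled vector
           gives the scaled target. *)
        rewrite <- I1, <- I2.
        match type of Hg with tube_disc _ _ _ ?p ?q =>
          match goal with |- tube_disc _ _ _ ?p' ?q' =>
            replace p' with p by ring; replace q' with q by ring end end.
        exact Hg.
    + exact (power_series_harmonic_self_map d1 d2 a b U1 U2 Z1 Z2 E1 E2 HB).
Qed.
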